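(* Let $X$ be a generalized flag variety and $L$ an ample line bundle on $X$. Then $a(Y,L)\le a(X,L)$ for every subvariety $Y\subset X$.
   Context: The ground field is algebraically closed of characteristic zero. A variety is an irreducible reduced scheme of finite type over this field; subvarieties are closed and, so that the invariants below are defined, positive-dimensional. A generalized flag variety is a projective homogeneous space $P\backslash G$, with $G$ a connected semisimple linear algebraic group and $P$ a parabolic subgroup. For a smooth projective variety $X$, $\mathrm{NS}(X,\mathbb{R})=\mathrm{NS}(X)\otimes\mathbb{R}$ is the N\'eron–Severi space and $\Lambda_{\mathrm{eff}}(X)\subset \mathrm{NS}(X,\mathbb{R})$ is the cone of pseudo-effective divisors, i.e. the closure of the cone of effective $\mathbb{R}$-divisors. For $L$ big on $X$, put $$a(X,L)=\min\{t\in\mathbb{R}\mid t[L]+[K_X]\in\Lambda_{\mathrm{eff}}(X)\}.$$ This is a birational invariant; for a singular projective variety $Y$ with $L$ big on $Y$ one sets $a(Y,L):=a(\tilde Y,\beta^*L)$ for any resolution of singularities $\beta:\tilde Y\to Y$. For a subvariety $Y\subset X$, $a(Y,L)$ means $a(Y,L|_Y)$. *)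

(* Defs.v *)
From HB Require Import structures.
From mathcomp Require Import all_boot all_order all_algebra.
From mathcomp Require Import all_classical all_reals all_analysis.
From mathcomp Require Import -(notations) mpoly.
Set Implicit Arguments.
Unset Strict Implicit.
Unset Printing Implicit Defensive.

Import Order.TTheory GRing.Theory Num.Theory.
Import numFieldNormedType.Exports.
Local Open Scope classical_set_scope.
Local Open Scope ring_scope.

(** * Varieties as spaces with functions

    Reduced schemes of finite type over an algebraically closed field [k] are
    encoded by their [k]-points: a set, its Zariski-open subsets, and, for each
    open [U], the regular functions on [U].  A regular function on [U] is given
    by a total function of which only the values on [U] matter. *)

Record fspace (k : closedFieldType) := FSpace {
  pt :> Type;
  opn : set (set pt);
  reg : set pt -> set (pt -> k) }.

Definition closed_set (k : closedFieldType) (X : fspace k) (A : set X) : Prop :=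
  opn (~` A).

Definition fspace_axioms (k : closedFieldType) (X : fspace k) : Prop :=
  [/\ opn (setT : set X),
      (forall U V : set X, opn U -> opn V -> opn (U `&` V)),
      (forall F : set (set X), F `<=` @opn k X -> opn (\bigcup_(U in F) U)),
      (forall (U V : set X) (f g : X -> k), opn U -> opn V -> V `<=` U ->
         reg U f -> (forall x, V x -> g x = f x) -> reg V g) &
      (forall (U : set X) (f : X -> k), opn U ->
         (forall x, U x -> exists V, [/\ opn V, V x, V `<=` U & reg V f]) ->
         reg U f)].

Definition morphism (k : closedFieldType) (X Y : fspace k) (phi : X -> Y) : Prop :=
  forall V : set Y, opn V ->
    opn (phi @^-1` V) /\
    forall f : Y -> k, reg V f -> reg (phi @^-1` V) (f \o phi).

Definition isomorphism (k : closedFieldType) (X Y : fspace k) (phi : X -> Y) : Prop :=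
  morphism phi /\
  exists psi : Y -> X, [/\ morphism psi, cancel phi psi & cancel psi phi].

(** The induced structure on a locally closed subset: a function is regular
    when it locally extends to a regular function on an open set of [X]. *)
Definition fsub (k : closedFieldType) (X : fspace k) (A : set X) : fspace k :=
  @FSpace k {x : X | A x}
    [set W | exists2 U : set X, opn U & W = (fun w => U (sval w))]
    (fun W => [set f | forall w, W w ->
       exists (U : set X) (g : X -> k),
         [/\ opn U, U (sval w), reg U g &
             forall y, W y -> U (sval y) -> f y = g (sval y)]]).

(** On affine varieties, the basic open sets and the regular functions below are
    those of [k[X] (x) k[Y]]. *)
Definition fprod (k : closedFieldType) (X Y : fspace k) : fspace k :=
  let bireg (U : set X) (V : set Y) (h : X * Y -> k) :=
    [/\ opn U, opn V &
        exists (m : nat) (f : 'I_m -> X -> k) (g : 'I_m -> Y -> k),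
          [/\ (forall i, reg U (f i)), (forall i, reg V (g i)) &
              forall z, h z = \sum_(i < m) f i z.1 * g i z.2]] in
  let basic (U : set X) (V : set Y) (h : X * Y -> k) : set (X * Y) :=
    [set z | [/\ U z.1, V z.2 & h z != 0]] in
  @FSpace k (X * Y)
    [set W | forall w, W w -> exists U V h,
       [/\ bireg U V h, basic U V h w & basic U V h `<=` W]]
    (fun W => [set f | forall w, W w -> exists U V h' h,
       [/\ bireg U V h', bireg U V h, basic U V h w &
           forall z, W z -> basic U V h z -> f z = h' z / h z]]).

Definition peval (k : closedFieldType) (n : nat) (p : mpoly n k)
  (v : 'rV[k]_n) : k := meval (fun i => v 0 i) p.

Definition phomog (k : closedFieldType) (n d : nat) (p : mpoly n k) : Prop :=
  p \is ishomog1 d (@mdeg n).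

Definition affine_space (k : closedFieldType) (n : nat) : fspace k :=
  @FSpace k 'rV[k]_n
    [set U | exists P : set (mpoly n k),
       U = [set v | exists2 p, P p & peval p v != 0]]
    (fun U => [set f | forall v, U v -> exists p q : mpoly n k,
       peval q v != 0 /\
       forall w, U w -> peval q w != 0 -> f w = peval p w / peval q w]).

(** A point of the projective space is represented by its unique vector of
    homogeneous coordinates whose first nonzero entry is 1. *)
Definition normalized (k : closedFieldType) (n : nat) (v : 'rV[k]_n.+1) : Prop :=
  exists i : 'I_n.+1, v 0 i = 1 /\ forall j : 'I_n.+1, (j < i)%N -> v 0 j = 0.

Definition proj_space (k : closedFieldType) (n : nat) : fspace k :=
  @FSpace k {v : 'rV[k]_n.+1 | normalized v}
    [set U | exists P : set (mpoly n.+1 k),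
       (forall p, P p -> exists d, phomog d p) /\
       U = [set v | exists2 p, P p & peval p (sval v) != 0]]
    (fun U => [set f | forall v, U v -> exists (d : nat) (p q : mpoly n.+1 k),
       [/\ phomog d p, phomog d q, peval q (sval v) != 0 &
           forall w, U w -> peval q (sval w) != 0 ->
             f w = peval p (sval w) / peval q (sval w)]]).

Definition closed_embedding (k : closedFieldType) (X Y : fspace k)
    (phi : X -> Y) : Prop :=
  exists A : set Y, closed_set A /\
    exists psi : X -> fsub A, isomorphism psi /\ forall x, phi x = sval (psi x).

Definition affine (k : closedFieldType) (X : fspace k) : Prop :=
  exists (n : nat) (phi : X -> affine_space k n), closed_embedding phi.

Definition projective (k : closedFieldType) (X : fspace k) : Prop :=
  exists (n : nat) (phi : X -> proj_space k n), closed_embedding phi.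

Definition irreducible_set (k : closedFieldType) (X : fspace k) (A : set X) : Prop :=
  A !=set0 /\
  forall U V : set X, opn U -> opn V ->
    A `&` U !=set0 -> A `&` V !=set0 -> A `&` U `&` V !=set0.

Definition connected_set (k : closedFieldType) (X : fspace k) (A : set X) : Prop :=
  forall U V : set X, opn U -> opn V -> A `<=` U `|` V ->
    A `&` U !=set0 -> A `&` V !=set0 -> A `&` U `&` V !=set0.

(** Irreducible and of finite type.  Separatedness is not imposed; it is automatic
    for the projective varieties below. *)
Definition variety (k : closedFieldType) (X : fspace k) : Prop :=
  [/\ fspace_axioms X,
      (exists (m : nat) (U : 'I_m -> set X),
         (forall i, opn (U i) /\ affine (fsub (U i))) /\
         forall x, exists i, U i x) &
      irreducible_set (setT : set X)].

Definition subvariety (k : closedFieldType) (X : fspace k) (Y : set X) : Prop :=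
  closed_set Y /\ irreducible_set Y.

(** Krull dimension. *)
Definition has_chain (k : closedFieldType) (X : fspace k) (d : nat) : Prop :=
  exists C : nat -> set X,
    (forall i, (i <= d)%N -> subvariety (C i)) /\
    (forall i, (i < d)%N -> C i `<=` C i.+1 /\ C i <> C i.+1).

Definition krull_dim (k : closedFieldType) (X : fspace k) : nat :=
  xget 0%N [set d | has_chain X d /\ forall e, has_chain X e -> (e <= d)%N].

(** * Differentials and smoothness *)

(** The germ of [f] at [p] lies in the square of the maximal ideal of the local
    ring at [p]. *)
Definition in_msquare (k : closedFieldType) (X : fspace k) (p : X)
    (f : X -> k) : Prop :=
  exists (U : set X) (m : nat) (a b : 'I_m -> X -> k),
    [/\ opn U, U p,
        (forall l, reg U (a l) /\ a l p = 0),
        (forall l, reg U (b l) /\ b l p = 0) &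
        forall y, U y -> f y = \sum_(l < m) a l y * b l y].

(** [df = \sum_a c_a dx_a] in the cotangent space [m_p / m_p^2]. *)
Definition is_gradient (k : closedFieldType) (X : fspace k) (d : nat)
    (x : 'I_d -> X -> k) (p : X) (f : X -> k) (c : 'rV[k]_d) : Prop :=
  in_msquare p (fun y => (f y - f p) - \sum_(a < d) c 0 a * (x a y - x a p)).

(** [dx_1, ..., dx_d] is a basis of [m_p / m_p^2]. *)
Definition cotangent_basis (k : closedFieldType) (X : fspace k) (d : nat)
    (x : 'I_d -> X -> k) (p : X) : Prop :=
  forall (V : set X) (f : X -> k), opn V -> V p -> reg V f ->
    exists! c : 'rV[k]_d, is_gradient x p f c.

Definition smooth (k : closedFieldType) (X : fspace k) : Prop :=
  forall p : X, exists (U : set X) (x : 'I_(krull_dim X) -> X -> k),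
    [/\ opn U, U p, (forall a, reg U (x a)) & cotangent_basis x p].

Definition local_coordinates (k : closedFieldType) (X : fspace k) (d : nat)
    (U : set X) (x : 'I_d -> X -> k) : Prop :=
  [/\ opn U, (forall a, reg U (x a)) & forall p, U p -> cotangent_basis x p].

Definition gradient (k : closedFieldType) (X : fspace k) (d : nat)
    (x : 'I_d -> X -> k) (p : X) (f : X -> k) : 'rV[k]_d :=
  xget 0 [set c | is_gradient x p f c].

(** * Line bundles *)

(** Transition data over an open cover; sections transform by
    [s_i = g_ij s_j]. *)
Record cocycle (k : closedFieldType) (X : fspace k) := Cocycle {
  lb_idx : Type;
  lb_dom : lb_idx -> set X;
  lb_fun : lb_idx -> lb_idx -> X -> k }.

Definition line_bundle (k : closedFieldType) (X : fspace k) (L : cocycle X) : Prop :=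
  [/\ (forall i, opn (lb_dom (c:=L) i)),
      (forall x, exists i, lb_dom (c:=L) i x),
      (forall i j, reg (lb_dom i `&` lb_dom j) (lb_fun (c:=L) i j)),
      (forall i x, lb_dom i x -> lb_fun (c:=L) i i x = 1) &
      (forall i j l x, lb_dom i x -> lb_dom j x -> lb_dom l x ->
         lb_fun (c:=L) i j x * lb_fun j l x = lb_fun i l x)].

Definition lb_section (k : closedFieldType) (X : fspace k) (L : cocycle X)
    (s : lb_idx L -> X -> k) : Prop :=
  (forall i, reg (lb_dom i) (s i)) /\
  forall i j x, lb_dom i x -> lb_dom j x -> s i x = lb_fun i j x * s j x.

Definition lb_iso (k : closedFieldType) (X : fspace k) (L M : cocycle X) : Prop :=
  exists h : lb_idx M -> lb_idx L -> X -> k,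
    [/\ (forall j i, reg (lb_dom j `&` lb_dom i) (h j i)),
        (forall j i x, lb_dom j x -> lb_dom i x -> h j i x != 0) &
        (forall j' j i i' x, lb_dom j' x -> lb_dom j x -> lb_dom i x -> lb_dom i' x ->
           lb_fun j' j x * h j i x * lb_fun i i' x = h j' i' x)].

Definition lb_tensor (k : closedFieldType) (X : fspace k) (L M : cocycle X) :
    cocycle X :=
  @Cocycle k X (lb_idx L * lb_idx M)
    (fun i => lb_dom i.1 `&` lb_dom i.2)
    (fun i j x => lb_fun i.1 j.1 x * lb_fun i.2 j.2 x).

Definition lb_power (k : closedFieldType) (X : fspace k) (L : cocycle X) (m : nat) :
    cocycle X :=
  @Cocycle k X (lb_idx L) (@lb_dom k X L) (fun i j x => lb_fun i j x ^+ m).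

Definition lb_pullback (k : closedFieldType) (X Y : fspace k) (phi : X -> Y)
    (L : cocycle Y) : cocycle X :=
  @Cocycle k X (lb_idx L) (fun i => phi @^-1` lb_dom i)
    (fun i j x => lb_fun i j (phi x)).

Definition lb_restrict (k : closedFieldType) (X : fspace k) (Y : set X)
    (L : cocycle X) : cocycle (fsub Y) :=
  @lb_pullback k (fsub Y) X (fun y => sval y) L.

(** O(1) on the projective space: a linear form [l] is the section with local
    expressions [l / v_i]. *)
Definition lb_O1 (k : closedFieldType) (n : nat) : cocycle (proj_space k n) :=
  @Cocycle k (proj_space k n) 'I_n.+1
    (fun i => [set v : proj_space k n | (sval v : 'rV[k]_n.+1) 0 i != 0])
    (fun i j v => (sval v : 'rV[k]_n.+1) 0 j / (sval v : 'rV[k]_n.+1) 0 i).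

Definition very_ample (k : closedFieldType) (X : fspace k) (L : cocycle X) : Prop :=
  exists (n : nat) (phi : X -> proj_space k n),
    closed_embedding phi /\ lb_iso (lb_pullback phi (lb_O1 k n)) L.

Definition ample (k : closedFieldType) (X : fspace k) (L : cocycle X) : Prop :=
  exists m : nat, (0 < m)%N /\ very_ample (lb_power L m).

(** The line bundle of top-degree differential forms on a smooth variety,
    trivialized by [dx_1 /\ ... /\ dx_d] over the domain of each system of local
    coordinates [x]; the transition functions are Jacobian determinants. *)
Definition canonical_bundle (k : closedFieldType) (X : fspace k) : cocycle X :=
  @Cocycle k X
    {c : set X * ('I_(krull_dim X) -> X -> k) | local_coordinates c.1 c.2}
    (fun i => (sval i).1)
    (fun i j p =>
       \det (\matrix_(a < krull_dim X, b < krull_dim X)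
               gradient (sval i).2 p ((sval j).2 a) 0 b)).

(** * The Néron-Severi space and pseudo-effective classes *)

Definition alg_equiv (k : closedFieldType) (X : fspace k) (L M : cocycle X) : Prop :=
  exists (T : fspace k) (N : cocycle (fprod X T)) (t0 t1 : T),
    [/\ variety T, line_bundle N,
        lb_iso (@lb_pullback k X (fprod X T) (fun x => (x, t0)) N) L &
        lb_iso (@lb_pullback k X (fprod X T) (fun x => (x, t1)) N) M].

(** Elements of [NS(X) (x) R] are written as formal real combinations of line
    bundles; [ns_eq] is equality in the tensor product, i.e. the congruence
    generated by bilinearity and by algebraic equivalence. *)
Inductive ns_eq (R : realType) (k : closedFieldType) (X : fspace k) :
    seq (R * cocycle X) -> seq (R * cocycle X) -> Prop :=
| ns_refl D : ns_eq D D
| ns_sym D E : ns_eq D E -> ns_eq E D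
| ns_trans D E F : ns_eq D E -> ns_eq E F -> ns_eq D F
| ns_cat D D' E E' : ns_eq D D' -> ns_eq E E' -> ns_eq (D ++ E) (D' ++ E')
| ns_catC D E : ns_eq (D ++ E) (E ++ D)
| ns_zero L : line_bundle L -> ns_eq [:: (0, L)] [::]
| ns_add r s L : line_bundle L -> ns_eq [:: (r + s, L)] [:: (r, L); (s, L)]
| ns_tensor r L M : line_bundle L -> line_bundle M ->
    ns_eq [:: (r, lb_tensor L M)] [:: (r, L); (r, M)]
| ns_alg r L M : line_bundle L -> line_bundle M -> alg_equiv L M ->
    ns_eq [:: (r, L)] [:: (r, M)].

Definition lincomb (R : realType) (k : closedFieldType) (X : fspace k) (m : nat)
    (c : 'rV[R]_m) (M : 'I_m -> cocycle X) : seq (R * cocycle X) :=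
  [seq (c 0 i, M i) | i <- enum 'I_m].

(** An effective divisor on [X] is the divisor of a nonzero section of a line
    bundle: its local equations are the local expressions of the section. *)
Definition effective_bundle (k : closedFieldType) (X : fspace k) (L : cocycle X) :
    Prop :=
  line_bundle L /\
  exists s : lb_idx L -> X -> k,
    lb_section s /\ exists i x, lb_dom i x /\ s i x != 0.

Definition effective_class (R : realType) (k : closedFieldType) (X : fspace k)
    (D : seq (R * cocycle X)) : Prop :=
  exists (m : nat) (c : 'rV[R]_m) (M : 'I_m -> cocycle X),
    [/\ (forall i, 0 <= c 0 i), (forall i, effective_bundle (M i)) &
        ns_eq D (lincomb c M)].

(** The closure of the effective cone in the finite-dimensional space
    [NS(X) (x) R], computed in a linear parametrization
    [c |-> \sum_i c_i [M_i]] of a subspace by [R^m]. *)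
Definition pseudo_effective (R : realType) (k : closedFieldType) (X : fspace k)
    (D : seq (R * cocycle X)) : Prop :=
  exists (m : nat) (c : 'rV[R]_m) (M : 'I_m -> cocycle X),
    [/\ (forall i, line_bundle (M i)), ns_eq D (lincomb c M) &
        closure [set c' : 'rV[R]_m | effective_class (lincomb c' M)] c].

(** For [L] big the set of admissible [t] is nonempty, closed and bounded below,
    so that the infimum is its minimum. *)
Definition a_invariant (R : realType) (k : closedFieldType) (X : fspace k)
    (L : cocycle X) : \bar R :=
  ereal_inf [set t%:E | t in
    [set t : R | pseudo_effective [:: (t, L); (1, canonical_bundle X)]]].

(** * Resolutions *)

Definition birational (k : closedFieldType) (Z Y : fspace k) (beta : Z -> Y) : Prop :=
  exists (U : set Z) (V : set Y),
    [/\ opn U, U !=set0, opn V &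
        exists gamma : fsub U -> fsub V,
          isomorphism gamma /\ forall u, sval (gamma u) = beta (sval u)].

(** Properness is automatic, as [Z] is projective. *)
Definition resolution (k : closedFieldType) (Z Y : fspace k) (beta : Z -> Y) : Prop :=
  [/\ variety Z, projective Z, smooth Z, morphism beta & birational beta].

(** * Linear algebraic groups and generalized flag varieties *)

Record fgroup (k : closedFieldType) := FGroup {
  fg_group :> groupType;
  fg_opn : set (set fg_group);
  fg_reg : set fg_group -> set (fg_group -> k) }.

Definition fg_space (k : closedFieldType) (G : fgroup k) : fspace k :=
  @FSpace k (fg_group G) (@fg_opn k G) (@fg_reg k G).

Definition linear_algebraic_group (k : closedFieldType) (G : fgroup k) : Prop :=
  [/\ affine (fg_space G),
      @morphism k (fprod (fg_space G) (fg_space G)) (fg_space G)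
        (fun z => (z.1 * z.2 : G)%g) &
      @morphism k (fg_space G) (fg_space G) (fun x => (x^-1 : G)%g)].

Definition subgroup (G : groupType) (H : set G) : Prop :=
  [/\ H 1%g, (forall x y, H x -> H y -> H (x * y)%g) & (forall x, H x -> H x^-1%g)].

Definition normal_subgroup (G : groupType) (H : set G) : Prop :=
  subgroup H /\ forall x y, H x -> H (y^-1 * x * y)%g.

Definition derived_subgroup (G : groupType) (H : set G) : set G :=
  [set x | forall K : set G, subgroup K ->
     (forall a b, H a -> H b -> K (a^-1 * b^-1 * a * b)%g) -> K x].

Definition solvable_subgroup (G : groupType) (H : set G) : Prop :=
  subgroup H /\ exists n : nat, iter n (@derived_subgroup G) H = [set 1%g].

Definition closed_subgroup (k : closedFieldType) (G : fgroup k) (H : set G) : Prop :=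
  subgroup H /\ @closed_set k (fg_space G) H.

Definition connected_group (k : closedFieldType) (G : fgroup k) : Prop :=
  @connected_set k (fg_space G) setT.

(** The radical is trivial. *)
Definition semisimple (k : closedFieldType) (G : fgroup k) : Prop :=
  forall H : set G, closed_subgroup H -> @connected_set k (fg_space G) H ->
    normal_subgroup H -> solvable_subgroup H -> H = [set 1%g].

Definition connected_solvable (k : closedFieldType) (G : fgroup k) (B : set G) : Prop :=
  [/\ closed_subgroup B, @connected_set k (fg_space G) B & solvable_subgroup B].

Definition borel_subgroup (k : closedFieldType) (G : fgroup k) (B : set G) : Prop :=
  connected_solvable B /\
  forall B' : set G, connected_solvable B' -> B `<=` B' -> B' = B.

Definition parabolic_subgroup (k : closedFieldType) (G : fgroup k) (P : set G) : Prop :=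
  closed_subgroup P /\ exists2 B : set G, borel_subgroup B & B `<=` P.

(** [pi] identifies [X] with the space of right cosets [P g], with the quotient
    topology and sheaf of functions. *)
Definition quotient_map (k : closedFieldType) (G : fgroup k) (P : set G)
    (X : fspace k) (pi : G -> X) : Prop :=
  [/\ (forall x, exists g, pi g = x),
      (forall g h, pi g = pi h <-> P (g * h^-1)%g),
      (forall U : set X, opn U <-> @opn k (fg_space G) (pi @^-1` U)) &
      (forall (U : set X) (f : X -> k), opn U ->
         (reg U f <-> @reg k (fg_space G) (pi @^-1` U) (f \o pi)))].

Definition generalized_flag_variety (k : closedFieldType) (X : fspace k) : Prop :=
  [/\ variety X, projective X &
      exists (G : fgroup k) (P : set G) (pi : G -> X),
        [/\ linear_algebraic_group G, connected_group G, semisimple G,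
            parabolic_subgroup P & quotient_map P pi]].

(* Main.v *)
Require Import Defs.
From HB Require Import structures.
From mathcomp Require Import all_boot all_order all_algebra.
From mathcomp Require Import all_classical all_reals all_analysis.
From mathcomp Require Import -(notations) mpoly.
From mathcomp Require Import generic_quotient ring.
Set Implicit Arguments.
Unset Strict Implicit.
Unset Printing Implicit Defensive.
Import Order.TTheory GRing.Theory Num.Theory.
Import numFieldNormedType.Exports.

(** Let [phi : Z -> X] be the composite of the resolution and the inclusion, and let
    [v_1, ..., v_n] be vector fields on [X] induced by the Lie algebra of [G].

    If [s] is a section of a line bundle [M] on [X], its first nonzero iterated
    derivative along the [v_i] at the points of [phi(Z)] is a section of [phi^* M];
    it exists because in characteristic zero a function all of whose derivatives
    along [G] vanish at a point is zero.  So pulling back along [phi] preserves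
    effective, hence pseudo-effective classes.

    Contracting a local generator of [K_X] with [codim Y] of the vector fields and
    pulling the result back to [Z] gives a section of [K_Z - phi^* K_X].  It is
    nonzero for a suitable choice, as the vector fields span the tangent spaces of
    [X] (characteristic zero again) and [phi] is generically an immersion.  Hence
    [t phi^* L + K_Z = phi^* (t L + K_X) + (K_Z - phi^* K_X)] is pseudo-effective
    whenever [t L + K_X] is.

    Both uses of characteristic zero rest on the extension of derivations to
    larger fields.  The fields are ultrapowers of [k] along ultrafilters of
    "general" points, which avoids function fields of possibly reducible [G]. *)

(** * Affine charts *)

Section Spaces.
Local Open Scope classical_set_scope.
Local Open Scope ring_scope.
Variable k : closedFieldType.
Implicit Types X Y : fspace k.

(** Restricting a section fails when it vanishes along [phi(Z)]: on a general variety an effective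
    line bundle may become non-effective there, as an exceptional curve shows. Homogeneity of [X]
    supplies the derivatives that still detect the section. Minimal length is the right choice
    because the Leibniz corrections contain only shorter derivatives, and these vanish on all of
    [phi(Z)].

    Differential identities are needed both at points and in fields of germs. They are proved once
    for every [gderiv], in the form [df = sum c_a dx_a] with regular [c_a] fixed beforehand: at a
    point this computes gradients, in a field of germs it constrains derivations.

    Smoothness of [X] is not deduced from homogeneity: an admissible [t] for [X] already makes
    [canonical_bundle X] a line bundle, which gives local coordinates everywhere, and without an
    admissible [t] the bound is empty. Closures are compared on finite families: pulling back keeps
    the coefficients, and [K_Z - phi^* K_X] enters as one more member with coefficient 1. *)

Lemma opnT X : fspace_axioms X -> opn (setT : set X).
Proof. by case. Qed.

Lemma opnI X (U V : set X) : fspace_axioms X -> opn U -> opn V -> opn (U `&` V).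
Proof. by case=> _ h _ _ _; apply: h. Qed.

Lemma opn_bigcup X (F : set (set X)) : fspace_axioms X ->
  (forall U, F U -> opn U) -> opn (\bigcup_(U in F) U).
Proof. by case=> _ _ h _ _; apply: h. Qed.

Lemma opn_nbhd X (U : set X) : fspace_axioms X ->
  (forall x, U x -> exists V, [/\ opn V, V x & V `<=` U]) -> opn U.
Proof.
move=> aX h; have -> : U = \bigcup_(V in [set V | opn V /\ V `<=` U]) V.
  apply/seteqP; split=> x.
    by move=> /h[V [oV Vx VU]]; exists V.
  by case=> V [_ VU] /VU.
by apply: opn_bigcup => // V [].
Qed.

Lemma reg_res X (U V : set X) (f g : X -> k) : fspace_axioms X ->
  opn U -> opn V -> V `<=` U -> reg U f -> (forall x, V x -> g x = f x) -> reg V g.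
Proof. by case=> _ _ _ h _; apply: h. Qed.

Lemma reg_sub X (U V : set X) (f : X -> k) : fspace_axioms X ->
  opn U -> opn V -> V `<=` U -> reg U f -> reg V f.
Proof. by move=> aX oU oV VU rf; apply: (reg_res aX oU oV VU rf). Qed.

Lemma reg_local X (U : set X) (f : X -> k) : fspace_axioms X -> opn U ->
  (forall x, U x -> exists V, [/\ opn V, V x, V `<=` U & reg V f]) -> reg U f.
Proof. by case=> _ _ _ _ h; apply: h. Qed.

Lemma reg_local_eq X (U : set X) (f : X -> k) : fspace_axioms X -> opn U ->
  (forall x, U x -> exists V g, [/\ opn V, V x, reg V g &
     forall y, V y -> U y -> f y = g y]) -> reg U f.
Proof.
move=> aX oU h; apply: reg_local => // x Ux.
have [V [g [oV Vx rg fg]]] := h x Ux.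
exists (V `&` U); split; [exact: opnI|by []|by move=> y []|].
by apply: (reg_res aX oV _ _ rg) => [|y []|y [Vy Uy]]; [exact: opnI| |exact: fg].
Qed.

(** The trace on [U] of an affine embedding, reduced to the two facts on which all computations
    rest: how polynomials in [t] see open sets and how they see regular functions. *)
Definition affine_chart X (U : set X) (n : nat) (t : X -> 'rV[k]_n) : Prop :=
  [/\ opn U,
      (forall q : mpoly n k, opn [set x | U x /\ peval q (t x) != 0]) &
      (forall (V : set X) (f : X -> k), opn V -> V `<=` U ->
        (reg V f <-> forall x, V x -> exists p q : mpoly n k,
           peval q (t x) != 0 /\
           forall y, V y -> peval q (t y) != 0 -> f y = peval p (t y) / peval q (t y)))].

(** A common framework for [X], [Z] and the group, whose irreducibility is not established. *)
Definition locally_affine X : Prop :=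
  fspace_axioms X /\
  forall p : X, exists (U : set X) (n : nat) (t : X -> 'rV[k]_n),
    U p /\ affine_chart U t.

Lemma affine_space_axioms n : fspace_axioms (affine_space k n).
Proof.
split=> /=.
- exists [set 1]; apply/seteqP; split=> // v _; exists 1 => //.
  by rewrite /peval meval1 oner_neq0.
- move=> _ _ [P ->] [Q ->].
  exists [set r | exists p q, [/\ P p, Q q & r = p * q]].
  apply/seteqP; split=> v.
    case=> -[p Pp p0] [q Qq q0]; exists (p * q); first by exists p, q.
    by rewrite /peval mevalM mulf_neq0.
  case=> _ [p [q [Pp Qq ->]]]; rewrite /peval mevalM mulf_eq0 negb_or => /andP[p0 q0].
  by split; [exists p|exists q].
- move=> F FO; exists [set p | exists U, F U /\ forall v, peval p v != 0 -> U v].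
  apply/seteqP; split=> v.
    case=> U FU Uv; have [P eP] := FO _ FU.
    move: (Uv); rewrite eP => -[p Pp p0]; exists p => //; exists U; split=> // w pw.
    by rewrite eP; exists p.
  by case=> p [U [FU hU]] /hU Uv; exists U.
- move=> U V f g _ _ VU rf fg v Vv.
  have [p [q [q0 h]]] := rf v (VU _ Vv); exists p, q; split=> // w Vw qw.
  by rewrite fg// h//; exact: VU.
- move=> U f oU h v Uv; have [V [[P eV] Vv VU rV]] := h v Uv.
  have [p [q [q0 pq]]] := rV v Vv.
  (* The factor [r] moves the restriction to [V] into the denominator: where [q * r] is nonzero the
     point lies in [V]. *)
  move: (Vv); rewrite eV => -[r Pr r0]; exists (p * r), (q * r); split.
    by rewrite /peval mevalM mulf_neq0.
  move=> w Uw; rewrite /peval !mevalM mulf_eq0 negb_or => /andP[qw rw].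
  rewrite pq//; last by rewrite eV; exists r.
  by rewrite -mulf_div divff// mulr1.
Qed.

Lemma fsub_axioms X (A : set X) : fspace_axioms X -> fspace_axioms (fsub A).
Proof.
move=> aX; split=> /=.
- by exists setT; [exact: opnT|].
- move=> _ _ [U oU ->] [V oV ->]; exists (U `&` V); [exact: opnI|by []].
- move=> F FO.
  exists (\bigcup_(U in [set U | opn U /\ F (fun w => U (sval w))]) U).
    by apply: opn_bigcup => // U [].
  apply/seteqP; split=> w.
    case=> W FW Ww; have [U oU eW] := FO _ FW.
    by exists U; [split=> //; rewrite -eW|rewrite eW in Ww].
  by case=> U [oU FU] Uw; exists (fun w => U (sval w)).
- move=> U V f g oU oV VU rf fg w Vw.
  have [W [h [oW Ww rh fh]]] := rf w (VU _ Vw); exists W, h; split=> // y Vy Wy.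
  by rewrite fg// fh//; exact: VU.
- move=> U f oU h w Uw; have [V [[V' oV' eV] Vw VU rV]] := h w Uw.
  have [W [g [oW Ww rg fg]]] := rV w Vw.
  exists (W `&` V'), g; split.
  + exact: opnI.
  + by split=> //; move: Vw; rewrite eV.
  + by apply: (reg_sub aX oW _ _ rg) => [|y []//]; exact: opnI.
  + by move=> y Uy [Wy V'y]; apply: fg => //; rewrite eV.
Qed.

Lemma iso_axioms X Y (phi : X -> Y) : isomorphism phi -> fspace_axioms Y -> fspace_axioms X.
Proof.
move=> [mphi [psi [mpsi K1 K2]]] aY.
have E (U : set X) : U = phi @^-1` (psi @^-1` U).
  by apply/seteqP; split=> x /=; rewrite K1.
have Ef (f : X -> k) : f = (f \o psi) \o phi by apply/funext => x /=; rewrite K1.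
split.
- by have [] := mphi setT (opnT aY).
- move=> U V oU oV; rewrite (E U) (E V) -preimage_setI.
  by apply: (mphi _ _).1; apply: opnI => //; [exact: (mpsi _ oU).1|exact: (mpsi _ oV).1].
- move=> F FO; rewrite (E (\bigcup_(_ in _) _)).
  apply: (mphi _ _).1; rewrite preimage_bigcup.
  apply: opn_nbhd => // y [U FU Uy]; exists (psi @^-1` U); split=> //.
    exact: (mpsi _ (FO _ FU)).1.
  by move=> z Uz; exists U.
- move=> U V f g oU oV VU rf fg; rewrite (E V) (Ef g).
  have oV' := (mpsi _ oV).1; apply: (mphi _ oV').2.
  apply: (reg_res aY (mpsi _ oU).1 oV' _ ((mpsi _ oU).2 _ rf)).
    by move=> y /= /VU.
  by move=> y /= Vy; exact: fg.
- move=> U f oU h; rewrite (E U) (Ef f).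
  have oU' := (mpsi _ oU).1; apply: (mphi _ oU').2; apply: reg_local => // y Uy.
  have [V [oV Vy VU rV]] := h _ Uy; exists (psi @^-1` V); split=> //.
  + exact: (mpsi _ oV).1.
  + by move=> z /VU.
  + exact: (mpsi _ oV).2.
Qed.

Lemma affine_axioms X : affine X -> fspace_axioms X.
Proof.
move=> [n [_ [A [_ [psi [ipsi _]]]]]]; apply: (iso_axioms ipsi).
exact/fsub_axioms/affine_space_axioms.
Qed.

Lemma affine_chartP X : affine X ->
  exists (n : nat) (t : X -> 'rV[k]_n), affine_chart setT t.
Proof.
move=> aff; have aX := affine_axioms aff.
case: aff => n [_ [A [_ [phi [[mphi [psi [mpsi K1 K2]]] _]]]]].
exists n, (fun x => sval (phi x)); split.
- exact: opnT.
- move=> q; have -> : [set x | setT x /\ peval q (sval (phi x)) != 0] =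
     phi @^-1` [set w | peval q (sval w) != 0].
    by apply/seteqP; split=> x //= [].
  apply: (mphi _ _).1; exists [set v | peval q v != 0] => //.
  exists [set q]; apply/seteqP; split=> v /=; first by exists q.
  by case=> _ ->.
- move=> V f oV _; split.
    move=> rf x Vx; have := (mpsi _ oV).2 _ rf (phi x).
    rewrite /preimage /= K1 => /(_ Vx)[U [g [[P eU] Ux rg fg]]].
    have [p [q [q0 pq]]] := rg _ Ux.
    move: (Ux); rewrite eU => -[r Pr r0]; exists (p * r), (q * r); split.
      by rewrite /peval mevalM mulf_neq0.
    move=> y Vy; rewrite /peval !mevalM mulf_eq0 negb_or => /andP[qw rw].
    have Uy : U (sval (phi y)) by rewrite eU; exists r.
    have := fg (phi y); rewrite K1 => -> //; rewrite pq//.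
    by rewrite -mulf_div divff// mulr1.
  move=> h.
  have -> : V = phi @^-1` (psi @^-1` V) by apply/seteqP; split=> x /=; rewrite K1.
  have -> : f = (f \o psi) \o phi by apply/funext => x /=; rewrite K1.
  apply: (mphi _ (mpsi _ oV).1).2 => w Vw.
  have [p [q [q0 pq]]] := h _ Vw; rewrite K2 in q0.
  exists [set v | peval q v != 0], (fun v => peval p v / peval q v); split=> //.
  + by exists [set q]; apply/seteqP; split=> v /=; [exists q|case=> _ ->].
  + by move=> v /= qv; exists p, q.
  + by move=> y Vy qy /=; rewrite pq ?K2.
Qed.

Lemma fsub_opn X (U : set X) (V : set X) : fspace_axioms X -> opn U -> V `<=` U ->
  opn V <-> @opn k (fsub U) (fun w => V (sval w)).
Proof.
move=> aX oU VU; split; first by exists V.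
case=> W oW eW; suff -> : V = W `&` U by exact: opnI.
apply/seteqP; split=> x.
  move=> Vx; split; last exact: VU.
  by have /(congr1 (fun S => S (exist _ x (VU _ Vx)))) /= := eW => <-.
case=> Wx Ux.
by have /(congr1 (fun S => S (exist _ x Ux))) /= := eW => ->.
Qed.

Lemma fsub_reg X (U V : set X) (f : X -> k) : fspace_axioms X ->
  opn U -> opn V -> V `<=` U ->
  reg V f <-> @reg k (fsub U) (fun w => V (sval w)) (fun w => f (sval w)).
Proof.
move=> aX oU oV VU; split=> [rf|h].
  by move=> w Vw; exists V, f; split.
apply: reg_local_eq => // x Vx.
have [W [g [oW Wx rg fg]]] := h (exist _ x (VU _ Vx)) Vx.
exists W, g; split=> // y Wy Vy; exact: (fg (exist _ y (VU _ Vy))).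
Qed.

Lemma chart_fsub X (U : set X) n (t : fsub U -> 'rV[k]_n) :
  fspace_axioms X -> opn U -> affine_chart setT t ->
  exists t' : X -> 'rV[k]_n, affine_chart U t'.
Proof.
move=> aX oU [_ ct rt].
(* The value 0 off [U] is arbitrary; a chart is only consulted at points of [U]. *)
pose t' x := if pselect (U x) is left Ux then t (exist _ x Ux) else 0.
have t'E (w : fsub U) : t' (sval w) = t w.
  case: w => x Ux; rewrite /t' /=; case: pselect => // Ux'.
  by congr (t (exist _ _ _)); exact: Prop_irrelevance.
exists t'; split=> //.
  move=> q; apply/(fsub_opn aX oU) => [x []//|].
  have := ct q; congr (@opn k (fsub U) _); apply/seteqP; split=> w.
    by case: w => x Ux [_ qx]; split=> //; rewrite t'E.
  by case=> _; rewrite t'E.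
move=> V f oV VU; rewrite (fsub_reg f aX oU oV VU).
have oV' := (fsub_opn aX oU VU).1 oV.
rewrite rt//; split=> h.
  move=> x Vx; have [p [q [q0 pq]]] := h (exist _ x (VU _ Vx)) Vx.
  exists p, q; split; first by rewrite -(t'E (exist _ x (VU _ Vx))) in q0.
  move=> y Vy; rewrite (t'E (exist _ y (VU _ Vy))) => qy.
  exact: (pq (exist _ y (VU _ Vy))).
move=> w Vw; have [p [q [q0 pq]]] := h _ Vw; exists p, q.
by rewrite -t'E; split=> // y Vy; rewrite -t'E; exact: pq.
Qed.

Lemma variety_locally_affine X : variety X -> locally_affine X.
Proof.
case=> aX [m [U [hU cU]]] _; split=> // p; have [i Uip] := cU p.
have [oU /affine_chartP[n [t ct]]] := hU i.
have [t' ct'] := chart_fsub aX oU ct.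
by exists (U i), n, t'.
Qed.

Lemma affine_locally_affine X : affine X -> locally_affine X.
Proof.
move=> aff; split; first exact: affine_axioms.
by move=> p; have [n [t ct]] := affine_chartP aff; exists setT, n, t.
Qed.

End Spaces.

(** * Regular functions *)

Section Regular.
Local Open Scope classical_set_scope.
Local Open Scope ring_scope.
Variables (k : closedFieldType) (X : fspace k).
Hypothesis laX : locally_affine X.
Implicit Types (U V : set X) (f g : X -> k).
Let aX := laX.1.

Lemma peval_cst n (c : k) (v : 'rV[k]_n) : peval (mpolyC n c) v = c.
Proof. by rewrite /peval mevalC. Qed.

(** Regularity is local, so a chart and a fraction may be chosen separately at each point; this
    reduces closure under ring operations to fractions of polynomials. *)
Lemma reg_frac V f : opn V -> reg V f <->
  forall x, V x -> exists (W : set X) n (t : X -> 'rV[k]_n) (p q : mpoly n k),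
    [/\ affine_chart W t, W x, peval q (t x) != 0 &
       forall y, V y -> W y -> peval q (t y) != 0 -> f y = peval p (t y) / peval q (t y)].
Proof.
move=> oV; split=> [rf x Vx|h].
  have [W [n [t [Wx [oW oq rW]]]]] := laX.2 x.
  have oVW := opnI aX oV oW.
  have rf' : reg (V `&` W) f by apply: (reg_sub aX oV oVW) => // y [].
  have [p [q [q0 pq]]] := (rW _ f oVW (@subIsetr _ _ _)).1 rf' x (conj Vx Wx).
  by exists W, n, t, p, q; split=> // y Vy Wy; exact: (pq _ (conj Vy Wy)).
apply: reg_local => // x Vx.
have [W [n [t [p [q [[oW oq rW] Wx q0 pq]]]]]] := h x Vx.
exists (V `&` [set y | W y /\ peval q (t y) != 0]); split.
- exact: opnI.
- by [].
- by move=> y [].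
- apply/rW; [exact: opnI|by move=> y [_ []]|].
  move=> y [Vy [Wy qy]]; exists p, q; split=> // z [Vz [Wz qz]] _; exact: pq.
Qed.

Lemma reg_cst U (c : k) : opn U -> reg U (fun=> c).
Proof.
move=> oU; apply/reg_frac => // x Ux.
have [W [n [t [Wx cW]]]] := laX.2 x; exists W, n, t, (mpolyC n c), 1; split=> //.
  by rewrite /peval meval1 oner_neq0.
by move=> y _ _ _; rewrite peval_cst /peval meval1 divr1.
Qed.

Lemma reg_frac2 U f g x : opn U -> reg U f -> reg U g -> U x ->
  exists (V : set X) n (t : X -> 'rV[k]_n) (p q p' q' : mpoly n k),
    [/\ affine_chart V t /\ V x, peval q (t x) != 0, peval q' (t x) != 0,
       (forall y, V y -> U y -> peval q (t y) != 0 -> f y = peval p (t y) / peval q (t y)) &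
       (forall y, V y -> U y -> peval q' (t y) != 0 -> g y = peval p' (t y) / peval q' (t y))].
Proof.
move=> oU rf rg Ux.
have [W [n [t [Wx cW]]]] := laX.2 x; have [oW oq rW] := cW.
have oUW := opnI aX oU oW.
have rf' : reg (U `&` W) f by apply: (reg_sub aX oU oUW) => // y [].
have rg' : reg (U `&` W) g by apply: (reg_sub aX oU oUW) => // y [].
have [p [q [q0 pq]]] := (rW _ f oUW (@subIsetr _ _ _)).1 rf' x (conj Ux Wx).
have [p' [q' [q0' pq']]] := (rW _ g oUW (@subIsetr _ _ _)).1 rg' x (conj Ux Wx).
exists W, n, t, p, q, p', q'; split=> //.
- by move=> y Vy Uy; exact: (pq _ (conj Uy Vy)).
- by move=> y Vy Uy; exact: (pq' _ (conj Uy Vy)).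
Qed.

Lemma reg_add U f g : opn U -> reg U f -> reg U g -> reg U (fun x => f x + g x).
Proof.
move=> oU rf rg; apply/reg_frac => // x Ux.
have [W [n [t [p [q [p' [q' [[cW Wx] q0 q0' pq pq']]]]]]]] := reg_frac2 oU rf rg Ux.
exists W, n, t, (p * q' + p' * q), (q * q'); split=> //.
  by rewrite /peval mevalM mulf_neq0.
move=> y Uy Wy; rewrite /peval !mevalD !mevalM mulf_eq0 negb_or => /andP[qy qy'].
by rewrite pq// pq'// addf_div.
Qed.

Lemma reg_mul U f g : opn U -> reg U f -> reg U g -> reg U (fun x => f x * g x).
Proof.
move=> oU rf rg; apply/reg_frac => // x Ux.
have [W [n [t [p [q [p' [q' [[cW Wx] q0 q0' pq pq']]]]]]]] := reg_frac2 oU rf rg Ux.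
exists W, n, t, (p * p'), (q * q'); split=> //.
  by rewrite /peval mevalM mulf_neq0.
move=> y Uy Wy; rewrite /peval !mevalM mulf_eq0 negb_or => /andP[qy qy'].
by rewrite pq// pq'// mulf_div.
Qed.

Lemma opn_neq0 U f : opn U -> reg U f -> opn [set x | U x /\ f x != 0].
Proof.
move=> oU rf; apply: opn_nbhd => // x [Ux fx].
have [W [n [t [p [q [[oW oq _] Wx q0 pq]]]]]] := (reg_frac _ oU).1 rf x Ux.
(* Nonvanishing of [q] makes the fraction valid, nonvanishing of [p] makes its value nonzero. *)
exists (U `&` [set y | W y /\ peval (p * q) (t y) != 0]); split.
- exact: opnI.
- do !split=> //; rewrite /peval mevalM mulf_neq0//.
  by apply: contraNneq fx => p0; rewrite pq// /peval p0 mul0r.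
- move=> y [Uy [Wy]]; rewrite /peval mevalM mulf_eq0 negb_or => /andP[py qy].
  by split=> //; rewrite pq// mulf_neq0// invr_eq0.
Qed.

Lemma reg_inv U f : opn U -> reg U f -> (forall x, U x -> f x != 0) ->
  reg U (fun x => (f x)^-1).
Proof.
move=> oU rf f0; apply/reg_frac => // x Ux.
have [W [n [t [p [q [cW Wx q0 pq]]]]]] := (reg_frac _ oU).1 rf x Ux.
have p0 : peval p (t x) != 0.
  by apply: contraNneq (f0 _ Ux) => p0; rewrite pq// p0 mul0r.
exists W, n, t, (q * q), (p * q); split=> //; first by rewrite /peval mevalM mulf_neq0.
move=> y Uy Wy; rewrite /peval !mevalM mulf_eq0 negb_or => /andP[py qy].
by rewrite pq// invf_div -mulf_div divff// mulr1.
Qed.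

Lemma reg_opp U f : opn U -> reg U f -> reg U (fun x => - f x).
Proof.
move=> oU rf; have := reg_mul oU (reg_cst (-1) oU) rf.
by congr (reg _ _); apply/funext => x; rewrite mulN1r.
Qed.

Lemma reg_subr U f g : opn U -> reg U f -> reg U g -> reg U (fun x => f x - g x).
Proof. by move=> oU rf rg; apply: reg_add => //; exact: reg_opp. Qed.

Lemma reg_sum U (I : Type) (r : seq I) (P : pred I) (F : I -> X -> k) : opn U ->
  (forall i, P i -> reg U (F i)) -> reg U (fun x => \sum_(i <- r | P i) F i x).
Proof.
move=> oU rF; elim: r => [|i r IH].
  have := reg_cst 0 oU; congr (reg _ _); apply/funext => x; by rewrite big_nil.
case Pi: (P i).
  have := reg_add oU (rF i Pi) IH; congr (reg _ _); apply/funext => x.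
  by rewrite big_cons Pi.
by move: IH; congr (reg _ _); apply/funext => x; rewrite big_cons Pi.
Qed.

Lemma reg_prod U (I : Type) (r : seq I) (P : pred I) (F : I -> X -> k) : opn U ->
  (forall i, P i -> reg U (F i)) -> reg U (fun x => \prod_(i <- r | P i) F i x).
Proof.
move=> oU rF; elim: r => [|i r IH].
  have := reg_cst 1 oU; congr (reg _ _); apply/funext => x; by rewrite big_nil.
case Pi: (P i).
  have := reg_mul oU (rF i Pi) IH; congr (reg _ _); apply/funext => x.
  by rewrite big_cons Pi.
by move: IH; congr (reg _ _); apply/funext => x; rewrite big_cons Pi.
Qed.

Lemma reg_exp U f n : opn U -> reg U f -> reg U (fun x => f x ^+ n).
Proof.
move=> oU rf; elim: n => [|n IH]; first exact: (reg_cst 1 oU).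
have := reg_mul oU rf IH; congr (reg _ _); apply/funext => x; by rewrite exprS.
Qed.

Definition mxreg U m n (A : X -> 'M[k]_(m, n)) := forall i j, reg U (fun x => A x i j).

Lemma mxreg_mul U m n p (A : X -> 'M[k]_(m, n)) (B : X -> 'M[k]_(n, p)) : opn U ->
  mxreg U A -> mxreg U B -> mxreg U (fun x => A x *m B x).
Proof.
move=> oU rA rB i j.
have := @reg_sum U _ (index_enum 'I_n) xpredT (fun l x => A x i l * B x l j) oU
  (fun l _ => reg_mul oU (rA i l) (rB l j)).
by congr (reg _ _); apply/funext => x; rewrite mxE.
Qed.

Lemma mxreg_cst U m n (A : 'M[k]_(m, n)) : opn U -> mxreg U (fun=> A).
Proof. by move=> oU i j; exact: reg_cst. Qed.

Lemma reg_det U n (A : X -> 'M[k]_n) : opn U -> mxreg U A -> reg U (fun x => \det (A x)).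
Proof.
move=> oU rA; apply: reg_sum => // s _; apply: reg_mul => //; first exact: reg_cst.
by apply: reg_prod => // i _.
Qed.

(** Cramer's rule: the entries of the adjugate are signed minors, hence regular. *)
Lemma mxreg_inv U n (A : X -> 'M[k]_n) : opn U -> mxreg U A ->
  (forall x, U x -> \det (A x) != 0) -> mxreg U (fun x => invmx (A x)).
Proof.
move=> oU rA dA i j.
apply: (reg_res aX oU oU (f := fun x => (\det (A x))^-1 * \adj (A x) i j)) => //.
  apply: reg_mul => //; first by apply: reg_inv => //; exact: reg_det.
  have : reg U (fun x => cofactor (A x) j i).
    apply: reg_mul => //; first exact: reg_cst.
    apply: reg_det => // i' j'.
    by have := rA (lift j i') (lift i j'); congr (reg _ _); apply/funext => x; rewrite !mxE.
  by congr (reg _ _); apply/funext => x; rewrite mxE.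
move=> x Ux; rewrite /invmx unitmxE unitfE dA// mxE; congr (_ * _).
Qed.

Lemma reg_peval U n (p : mpoly n k) (y : X -> 'rV[k]_n) : opn U ->
  (forall i, reg U (fun x => y x 0 i)) -> reg U (fun x => peval p (y x)).
Proof.
move=> oU ry.
have : reg U (fun x => \sum_(m <- msupp p) mcoeff m p * \prod_i y x 0 i ^+ m i).
  apply: reg_sum => // m _; apply: reg_mul => //; first exact: reg_cst.
  by apply: reg_prod => // i _; exact: reg_exp.
by congr (reg _ _); apply/funext => x; rewrite /peval mevalE.
Qed.

Lemma chart_reg U n (t : X -> 'rV[k]_n) : affine_chart U t -> mxreg U t.
Proof.
move=> [oU _ rU] i j; apply/rU => // x Ux; exists (mpolyX k (mnm1 j)), 1.
by rewrite /peval meval1 oner_neq0; split=> // y Uy _; rewrite meval1 divr1 mevalXU ord1.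
Qed.

End Regular.

(** * Derivations *)

Section Derivations.
Local Open Scope classical_set_scope.
Local Open Scope ring_scope.

(** [D] is a derivation modulo [null], over the ring homomorphism [ev].  The two
    instances used are [f |-> f - f q] modulo the square of the maximal ideal
    (with [ev] the evaluation at [q]), and derivations of a field of germs. *)
Record gderiv (k : fieldType) (X : Type) (V : set X) (Phi : fieldType)
  (W : lmodType Phi) (null : set W) (ev : (X -> k) -> Phi) (D : (X -> k) -> W)
  (S : set (X -> k)) : Prop := GDeriv {
  gd0 : null 0;
  gdB : forall a b, null a -> null b -> null (a - b);
  gdZ : forall c a, null a -> null (c *: a);
  gd_cst : forall c, S (fun=> c);
  gd_Dcst : forall c, null (D (fun=> c));
  gd_add : forall f g, S f -> S g -> S (fun x => f x + g x);
  gd_Dadd : forall f g, S f -> S g -> null (D (fun x => f x + g x) - (D f + D g));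
  gd_mul : forall f g, S f -> S g -> S (fun x => f x * g x);
  gd_Dmul : forall f g, S f -> S g ->
    null (D (fun x => f x * g x) - (ev f *: D g + ev g *: D f));
  gd_inv : forall f, S f -> (forall x, V x -> f x != 0) -> S (fun x => (f x)^-1);
  gd_ext : forall f g, S f -> (forall x, V x -> f x = g x) ->
    [/\ S g, null (D f - D g) & ev f = ev g];
  gd_ev1 : ev (fun=> 1) = 1;
  gd_evD : forall f g, ev (fun x => f x + g x) = ev f + ev g;
  gd_evM : forall f g, ev (fun x => f x * g x) = ev f * ev g }.

(** The set [V] only says where functions must agree or be nonzero to be treated as equal or
    invertible, so a smaller set gives stronger axioms. Formulas valid on a large set thus apply to
    derivations living on a smaller one. *)
Lemma gderiv_sub (k : fieldType) (X : Type) (V V' : set X) (Phi : fieldType)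
  (W : lmodType Phi) (null : set W) (ev : (X -> k) -> Phi) (D : (X -> k) -> W)
  (S : set (X -> k)) : V' `<=` V -> gderiv V' null ev D S -> gderiv V null ev D S.
Proof.
move=> VV [g0 gB gZ gc gDc ga gDa gm gDm gi gx e1 eD eM]; split=> //.
- by move=> f Sf f0; apply: gi => // x /VV; exact: f0.
- by move=> f g Sf fg; apply: gx => // x /VV; exact: fg.
Qed.

Section GDerivTheory.
Variables (k : fieldType) (X : Type) (V : set X) (Phi : fieldType).
Variables (W : lmodType Phi) (null : set W) (ev : (X -> k) -> Phi).
Variables (D : (X -> k) -> W) (S : set (X -> k)).
Hypothesis gd : gderiv V null ev D S.

Definition eqm (a b : W) := null (a - b).

Lemma eqm_refl a : eqm a a.
Proof. by rewrite /eqm subrr; exact: (gd0 gd). Qed.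

Lemma nullN a : null a -> null (- a).
Proof. by rewrite -[- a]sub0r => na; apply: (gdB gd) => //; exact: (gd0 gd). Qed.

Lemma nullD a b : null a -> null b -> null (a + b).
Proof. by move=> na nb; rewrite -[b]opprK; apply: (gdB gd) => //; exact: nullN. Qed.

Lemma eqm_sym a b : eqm a b -> eqm b a.
Proof. by rewrite /eqm => /nullN; rewrite opprB. Qed.

Lemma eqm_trans a b c : eqm a b -> eqm b c -> eqm a c.
Proof. by rewrite /eqm => nab nbc; rewrite -(subrKA b); exact: nullD. Qed.

Lemma eqm_add a b c d : eqm a b -> eqm c d -> eqm (a + c) (b + d).
Proof. by rewrite /eqm opprD addrACA => *; exact: nullD. Qed.

Lemma eqm_scale c a b : eqm a b -> eqm (c *: a) (c *: b).
Proof. by rewrite /eqm -scalerBr => nab; exact: (gdZ gd). Qed.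

Lemma eqm_sum I (r : seq I) (P : pred I) (F G : I -> W) :
  (forall i, P i -> eqm (F i) (G i)) ->
  eqm (\sum_(i <- r | P i) F i) (\sum_(i <- r | P i) G i).
Proof.
move=> h; elim/big_ind2: _ => //; first exact: eqm_refl.
by move=> *; exact: eqm_add.
Qed.

Lemma evB f g : ev (fun x => f x - g x) = ev f - ev g.
Proof.
apply/esym/eqP; rewrite subr_eq -(gd_evD gd); apply/eqP.
by congr ev; apply/funext => x; rewrite subrK.
Qed.

Lemma ev0 : ev (fun=> 0) = 0.
Proof.
have : ev (fun=> 0 - 0) = ev (fun=> 0) - ev (fun=> 0) by rewrite evB.
by rewrite !subrr.
Qed.

Lemma ev_bool (b : bool) : ev (fun=> b%:R) = b%:R.
Proof. by case: b; rewrite ?(gd_ev1 gd) ?ev0. Qed.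

Lemma ev_sum I (r : seq I) (P : pred I) (F : I -> X -> k) :
  ev (fun x => \sum_(i <- r | P i) F i x) = \sum_(i <- r | P i) ev (F i).
Proof.
elim: r => [|i r IH].
  rewrite big_nil -ev0; congr ev; apply/funext => x; by rewrite big_nil.
rewrite big_cons -IH; case: ifPn => Pi.
  by rewrite -(gd_evD gd); congr ev; apply/funext => x; rewrite big_cons Pi.
by congr ev; apply/funext => x; rewrite big_cons (negPf Pi).
Qed.

Lemma ev_inv f : (forall x, V x -> f x != 0) -> S f ->
  ev f != 0 /\ ev (fun x => (f x)^-1) = (ev f)^-1.
Proof.
move=> f0 Sf; have : ev (fun x => f x * (f x)^-1) = 1.
  rewrite -(gd_ev1 gd); apply/esym.
  have [|x Vx|//] := gd_ext gd (f := fun=> 1) (g := fun x => f x * (f x)^-1).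
    exact: (gd_cst gd).
  by rewrite divff// f0.
rewrite (gd_evM gd) => e; have ef : ev f != 0.
  by apply: contra_eqN e => /eqP ->; rewrite mul0r eq_sym oner_neq0.
by split=> //; rewrite -[RHS]mulr1 -e mulKf.
Qed.

(** Apply [D] to [f * f^-1 = 1], an equality that holds on [V] only. *)
Lemma D_inv f : (forall x, V x -> f x != 0) -> S f ->
  eqm (D (fun x => (f x)^-1)) (- (ev f ^- 2 *: D f)).
Proof.
move=> f0 Sf; have Si := gd_inv gd Sf f0; have [ef ei] := ev_inv f0 Sf.
have := gd_Dmul gd Sf Si; rewrite -/(eqm _ _) ei => h.
have h1 : eqm (D (fun x => f x * (f x)^-1)) 0.
  have [|x Vx|Sg h1 _] := gd_ext gd (f := fun=> 1) (g := fun x => f x * (f x)^-1).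
    exact: (gd_cst gd).
  by rewrite divff// f0.
  apply: eqm_trans (eqm_sym h1) _; rewrite /eqm subr0; exact: (gd_Dcst gd).
have := eqm_trans (eqm_sym h1) h => /eqm_sym /(eqm_scale (ev f)^-1).
rewrite scaler0 scalerDr !scalerA mulVf// scale1r /eqm subr0 opprK.
by rewrite -exprVn expr2.
Qed.

Lemma D_sum I (r : seq I) (P : pred I) (F : I -> X -> k) :
  (forall i, P i -> S (F i)) ->
  S (fun x => \sum_(i <- r | P i) F i x) /\
  eqm (D (fun x => \sum_(i <- r | P i) F i x)) (\sum_(i <- r | P i) D (F i)).
Proof.
move=> SF; elim: r => [|i r [IH1 IH2]].
  have -> : (fun x => \sum_(i <- [::] | P i) F i x) = (fun=> 0).
    by apply/funext => x; rewrite big_nil.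
  rewrite big_nil; split; first exact: (gd_cst gd).
  by rewrite /eqm subr0; exact: (gd_Dcst gd).
have -> : (fun x => \sum_(j <- i :: r | P j) F j x) =
   (fun x => if P i then F i x + \sum_(j <- r | P j) F j x else \sum_(j <- r | P j) F j x).
  by apply/funext => x; rewrite big_cons.
rewrite big_cons; case: ifPn => // Pi; split; first exact: (gd_add gd (SF i Pi)).
apply: eqm_trans; first exact: (gd_Dadd gd (SF i Pi)).
by apply: eqm_add => //; exact: eqm_refl.
Qed.

Lemma D_scale (c : k) f : S f ->
  S (fun x => c * f x) /\ eqm (D (fun x => c * f x)) (ev (fun=> c) *: D f).
Proof.
move=> Sf; split; first by apply: (gd_mul gd) => //; exact: (gd_cst gd).
apply: eqm_trans; first by apply: (gd_Dmul gd) => //; exact: (gd_cst gd).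
rewrite -[X in eqm _ X]addr0; apply: eqm_add; first exact: eqm_refl.
by rewrite -(scaler0 _ (ev f)); apply: eqm_scale; rewrite /eqm subr0; exact: (gd_Dcst gd).
Qed.

End GDerivTheory.
End Derivations.

(** * Differentials of regular functions in a chart *)

Section Charts.
Local Open Scope classical_set_scope.
Local Open Scope ring_scope.

Section Poly.
Variables (k : closedFieldType) (X : Type) (V : set X) (Phi : fieldType).
Variables (W : lmodType Phi) (null : set W) (ev : (X -> k) -> Phi).
Variables (D : (X -> k) -> W) (S : set (X -> k)).
Hypothesis gd : gderiv V null ev D S.

Variables (n : nat) (t : X -> 'rV[k]_n).
Hypothesis St : forall i, S (fun x => t x 0 i).

(** The property [Q] holds for constants and variables and is stable under sums and products, hence
    holds for all polynomials. *)
Lemma D_peval (p : mpoly n k) : S (fun x => peval p (t x)) /\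
  eqm null (D (fun x => peval p (t x)))
    (\sum_i ev (fun x => peval (mderiv i p) (t x)) *: D (fun x => t x 0 i)).
Proof.
pose Q p := S (fun x => peval p (t x)) /\
  eqm null (D (fun x => peval p (t x)))
    (\sum_i ev (fun x => peval (mderiv i p) (t x)) *: D (fun x => t x 0 i)).
have QC c : Q (mpolyC n c).
  rewrite /Q (_ : (fun x => _) = (fun=> c)); last by apply/funext => x; rewrite peval_cst.
  split; first exact: (gd_cst gd).
  rewrite big1 => [|i _]; first by rewrite /eqm subr0; exact: (gd_Dcst gd).
  rewrite [X in ev X *: _](_ : _ = (fun=> 0)) ?(ev0 gd) ?scale0r//.
  by apply/funext => x; rewrite mderivC /peval meval0.
have QX i : Q (mpolyX k (mnm1 i)).
  rewrite /Q (_ : (fun x => _) = (fun x => t x 0 i)); last first.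
    by apply/funext => x; rewrite /peval mevalXU.
  split=> //; rewrite (bigD1 i)//= big1 ?addr0 => [|j ji].
    rewrite [X in ev X *: _](_ : _ = (fun=> 1)) ?(gd_ev1 gd) ?scale1r//;
      first exact: (eqm_refl gd).
    apply/funext => x; rewrite mderivX mnm1E eqxx scale1r /peval.
    rewrite (_ : mnm_sub _ _ = mnm0) ?mpolyX0 ?meval1//.
    by apply/mnmP => j; rewrite mnmBE mnm0E subnn.
  rewrite [X in ev X *: _](_ : _ = (fun=> 0)) ?(ev0 gd) ?scale0r//.
  by apply/funext => x; rewrite mderivX mnm1E eq_sym (negPf ji) scale0r /peval meval0.
have QD p1 p2 : Q p1 -> Q p2 -> Q (p1 + p2).
  move=> [S1 D1] [S2 D2]; rewrite /Q.
  rewrite (_ : (fun x => _) = (fun x => peval p1 (t x) + peval p2 (t x))); last first.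
    by apply/funext => x; rewrite /peval mevalD.
  split; first exact: (gd_add gd).
  apply: (eqm_trans gd); first exact: (gd_Dadd gd).
  rewrite [X in eqm _ _ X](_ : _ =
    \sum_i ev (fun x => peval (mderiv i p1) (t x)) *: D (fun x => t x 0 i) +
    \sum_i ev (fun x => peval (mderiv i p2) (t x)) *: D (fun x => t x 0 i)).
    exact: (eqm_add gd).
  rewrite -big_split; apply: eq_bigr => i _ /=; rewrite -scalerDl -(gd_evD gd).
  by congr (ev _ *: _); apply/funext => x; rewrite mderivD /peval mevalD.
have QM p1 p2 : Q p1 -> Q p2 -> Q (p1 * p2).
  move=> [S1 D1] [S2 D2]; rewrite /Q.
  rewrite (_ : (fun x => _) = (fun x => peval p1 (t x) * peval p2 (t x))); last first.
    by apply/funext => x; rewrite /peval mevalM.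
  split; first exact: (gd_mul gd).
  apply: (eqm_trans gd); first exact: (gd_Dmul gd).
  apply: (eqm_trans gd); first by apply: (eqm_add gd); apply: (eqm_scale gd); [exact: D2|exact: D1].
  rewrite !scaler_sumr -big_split /=; apply: (eqm_sum gd) => i _.
  rewrite !scalerA -scalerDl -!(gd_evM gd) -(gd_evD gd).
  rewrite [X in eqm _ _ (ev X *: _)](_ : _ =
    (fun x => peval p1 (t x) * peval (mderiv i p2) (t x) +
              peval p2 (t x) * peval (mderiv i p1) (t x))); first exact: (eqm_refl gd).
  by apply/funext => x; rewrite mderivM /peval mevalD !mevalM addrC; congr (_ + _); rewrite mulrC.
have Q1 : Q 1 by rewrite -[1]/(mpolyC n 1).
have Q0 : Q 0 by rewrite -(@mpolyC0 n k).
rewrite -/(Q p) [p]mpolyE; apply: (big_ind Q Q0 QD) => m _.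
rewrite -mul_mpolyC; apply: (QM) => //; rewrite mpolyXE_id.
apply: (big_ind Q Q1 QM) => i _; elim: (m i) => [|j IH]; first by rewrite expr0.
by rewrite exprS; apply: QM.
Qed.

Lemma D_frac (p q : mpoly n k) f :
  (forall x, V x -> peval q (t x) != 0 /\ f x = peval p (t x) / peval q (t x)) ->
  S f /\ eqm null (D f)
    (\sum_i ev (fun x => (peval (mderiv i p) (t x) * peval q (t x) -
      peval p (t x) * peval (mderiv i q) (t x)) / peval q (t x) ^+ 2) *: D (fun x => t x 0 i)).
Proof.
move=> h.
have [Sp Dp] := D_peval p; have [Sq Dq] := D_peval q.
have q0 x : V x -> peval q (t x) != 0 by move=> /h[].
have Si := gd_inv gd Sq q0; have Di := D_inv gd q0 Sq.
have [eq0 ei] := ev_inv gd q0 Sq.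
have [//|x Vx|Sf Df _] := gd_ext gd (f := fun x => peval p (t x) * (peval q (t x))^-1) (g := f).
- exact: (gd_mul gd).
- by have [_ ->] := h _ Vx.
split=> //; apply: (eqm_trans gd); first exact: (eqm_sym gd Df).
apply: (eqm_trans gd); first exact: (gd_Dmul gd).
apply: (eqm_trans gd).
  apply: (eqm_add gd); apply: (eqm_scale gd); last exact: Dp.
  apply: (eqm_trans gd Di); rewrite -scaleNr; apply: (eqm_scale gd); exact: Dq.
rewrite ei scalerA !scaler_sumr -big_split /=; apply: (eqm_sum gd) => i _.
rewrite !scalerA -scalerDl [X in eqm _ _ (X *: _)](_ : _ =
  ev (fun x => peval p (t x)) * - ev (fun x => peval q (t x)) ^- 2 *
  ev (fun x => peval (mderiv i q) (t x)) +
  (ev (fun x => peval q (t x)))^-1 * ev (fun x => peval (mderiv i p) (t x))); first exact: (eqm_refl gd).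
have Sdp := (D_peval (mderiv i p)).1; have Sdq := (D_peval (mderiv i q)).1.
have q20 x : V x -> peval q (t x) ^+ 2 != 0 by move=> Vx; rewrite expf_neq0// q0.
have Sq2 : S (fun x => peval q (t x) ^+ 2).
  have := gd_mul gd Sq Sq; congr S; apply/funext => x; by rewrite expr2.
have [eq20 ei2] := ev_inv gd q20 Sq2.
rewrite (gd_evM gd) ei2.
have -> : ev (fun x => peval q (t x) ^+ 2) = ev (fun x => peval q (t x)) ^+ 2.
  by rewrite expr2 -(gd_evM gd); congr ev; apply/funext => x; rewrite expr2.
by rewrite (evB gd) !(gd_evM gd); field.
Qed.

End Poly.

(** The order of quantifiers matters: [V'] and the coefficients [r] are chosen before the
    derivation. The same [r], those of the quotient rule, serve at every point of [V'] and in every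
    field of germs. *)
Lemma reg_D (k : closedFieldType) (X : fspace k) (p : X) (U V : set X) n
    (t : X -> 'rV[k]_n) (f : X -> k) :
  locally_affine X -> affine_chart U t -> U p -> opn V -> V p -> reg V f ->
  exists (V' : set X) (r : 'I_n -> X -> k),
    [/\ opn V', V' p, V' `<=` U `&` V, (forall i, reg V' (r i)) &
    forall (Phi : fieldType) (W : lmodType Phi) (null : set W) ev D S,
      gderiv V' null ev D S -> (forall i, S (fun x => t x 0 i)) ->
      S f /\ eqm null (D f) (\sum_i ev (r i) *: D (fun x => t x 0 i))].
Proof.
move=> laX ct Up oV Vp rf; have aX := laX.1.
have [oU oq rU] := ct; have oUV := opnI aX oU oV.
have rf' : reg (U `&` V) f by apply: (reg_sub aX oV oUV) => // y [].
have [P [Q [Q0 PQ]]] := (rU _ f oUV (@subIsetl _ _ _)).1 rf' p (conj Up Vp).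
pose V' := V `&` [set x | U x /\ peval Q (t x) != 0].
have oV' : opn V' by exact: opnI.
have rp (q : mpoly n k) : reg V' (fun x => peval q (t x)).
  apply: reg_peval => // i; apply: (reg_sub aX oU oV'); first by move=> y [_ []].
  by have := chart_reg ct; exact.
exists V', (fun i x => (peval (mderiv i P) (t x) * peval Q (t x) -
      peval P (t x) * peval (mderiv i Q) (t x)) / peval Q (t x) ^+ 2); split=> //.
- by move=> y [Vy [Uy _]].
- move=> i; apply: reg_mul => //.
    apply: reg_subr => //; exact: reg_mul.
  apply: reg_inv => //; first exact: reg_exp.
  by move=> x [_ [_ qx]]; rewrite expf_neq0.
- move=> Phi W null ev D S gd St; apply: (D_frac gd St) => x [Vx [Ux qx]].
  by split=> //; apply: PQ.
Qed.

End Charts.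

(** * Coordinates and gradients *)

Section Spanning.
Local Open Scope classical_set_scope.
Local Open Scope ring_scope.
Variables (k : closedFieldType) (X : fspace k).
Hypothesis laX : locally_affine X.
Let aX := laX.1.

Lemma opn_fin m (V : 'I_m -> set X) : (forall i, opn (V i)) ->
  opn [set x | forall i, V i x].
Proof.
elim: m V => [|m IH] V oV.
  have -> : [set x | forall i, V i x] = setT by apply/seteqP; split=> // x _ [].
  exact: opnT.
have -> : [set x | forall i, V i x] = V ord0 `&` [set x | forall i, V (lift ord0 i) x].
  apply/seteqP; split=> x /= => [h|[h h' i]]; first by split.
  by case: (unliftP ord0 i) => [j|] ->.
by apply: opnI => //; apply: IH.
Qed.

Definition regat (p : X) : set (X -> k) := [set f | exists U, [/\ opn U, U p & reg U f]].

Lemma gderiv_pt (V : set X) (p : X) : opn V -> V p ->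
  @gderiv k X V k (X -> k^o) (in_msquare p) (fun f => f p) (fun f y => f y - f p) (regat p).
Proof.
move=> oV Vp; have regat2 f g : regat p f -> regat p g ->
    exists U, [/\ opn U, U p, reg U f & reg U g].
  move=> [U [oU Up rf]] [U' [oU' U'p rg]]; exists (U `&` U').
  have oUU : opn (U `&` U') by exact: opnI.
  split=> //; [exact: (reg_sub aX oU oUU (@subIsetl _ _ _))|].
  exact: (reg_sub aX oU' oUU (@subIsetr _ _ _)).
split=> //.
- exists setT, 0%N, (fun _ _ => 0), (fun _ _ => 0); split=> //; [exact: opnT|by case|by case|].
  by move=> y _; rewrite big_ord0.
- move=> f g [U [m [a [b [oU Up ra rb fab]]]]] [U' [m' [a' [b' [oU' Up' ra' rb' gab]]]]].
  have oUU : opn (U `&` U') by exact: opnI.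
  exists (U `&` U'), (m + m')%N,
    (fun (l : 'I_(m + m')) y => match fintype.split l with inl i => a i y | inr i => - a' i y end),
    (fun l : 'I_(m + m') => match fintype.split l with inl i => b i | inr i => b' i end); split=> //.
  + move=> l; case: fintype.split => i.
      by have [ra1 ra2] := ra i; split=> //; apply: (reg_sub aX oU oUU (@subIsetl _ _ _)).
    have [ra1 ra2] := ra' i; rewrite ra2 oppr0; split=> //; apply: reg_opp => //.
    exact: (reg_sub aX oU' oUU (@subIsetr _ _ _)).
  + move=> l; case: fintype.split => i.
      by have [ra1 ra2] := rb i; split=> //; apply: (reg_sub aX oU oUU (@subIsetl _ _ _)).
    have [ra1 ra2] := rb' i; split=> //.
    exact: (reg_sub aX oU' oUU (@subIsetr _ _ _)).
  + move=> y [Uy U'y]; rewrite big_split_ord /=.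
    transitivity (f y - g y) => //; rewrite fab// gab// -sumrN; congr (_ + _); apply: eq_bigr => i _.
      by rewrite (fintype.unsplitK (inl i)).
    by rewrite (fintype.unsplitK (inr i)) mulNr.
- move=> c f [U [m [a [b [oU Up ra rb fab]]]]].
  exists U, m, (fun l y => c * a l y), b; split=> //.
    move=> l; have [ra1 ra2] := ra l; rewrite ra2 mulr0; split=> //.
    by apply: reg_mul => //; exact: reg_cst.
  move=> y Uy; transitivity (c * f y) => //; rewrite fab// mulr_sumr.
  by apply: eq_bigr => l _; rewrite mulrA.
- by move=> c; exists V; split=> //; exact: reg_cst.
- move=> c; exists V, 0%N, (fun _ _ => 0), (fun _ _ => 0); split=> //; [by case|by case|].
  by move=> y _; rewrite big_ord0 subrr.
- move=> f g Sf Sg; have [U [oU Up rf rg]] := regat2 _ _ Sf Sg.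
  by exists U; split=> //; exact: reg_add.
- move=> f g _ _; exists V, 0%N, (fun _ _ => 0), (fun _ _ => 0); split=> //; [by case|by case|].
  by move=> y _; rewrite big_ord0; apply/eqP; rewrite subr_eq0 opprD addrACA.
- move=> f g Sf Sg; have [U [oU Up rf rg]] := regat2 _ _ Sf Sg.
  by exists U; split=> //; exact: reg_mul.
- move=> f g Sf Sg; have [U [oU Up rf rg]] := regat2 _ _ Sf Sg.
  (* The Leibniz defect of [f - f p] is exactly the product of [f - f p] and [g - g p]. *)
  exists U, 1%N, (fun _ y => f y - f p), (fun _ y => g y - g p); split=> //.
  + by move=> _; rewrite subrr; split=> //; apply: reg_subr => //; exact: reg_cst.
  + by move=> _; rewrite subrr; split=> //; apply: reg_subr => //; exact: reg_cst.
  + move=> y Uy; rewrite big_ord1.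
    transitivity ((f y * g y - f p * g p) - (f p * (g y - g p) + g p * (f y - f p))) => //.
    by ring.
- move=> f [U [oU Up rf]] f0; have oUV : opn (U `&` V) by exact: opnI.
  exists (U `&` V); split=> //; apply: reg_inv => //; last by move=> x [_ /f0].
  exact: (reg_sub aX oU oUV (@subIsetl _ _ _)).
- move=> f g [U [oU Up rf]] fg; split; last exact: fg.
    have oUV : opn (U `&` V) by exact: opnI.
    exists (U `&` V); split=> //; apply: (reg_res aX oU oUV _ rf); first exact: subIsetl.
    by move=> x [_ /fg].
  exists V, 0%N, (fun _ _ => 0), (fun _ _ => 0); split=> //; [by case|by case|].
  move=> y Vy; rewrite big_ord0; transitivity ((f y - f p) - (g y - g p)) => //.
  by rewrite fg// (fg p)// subrr.
Qed.

Lemma is_gradientE d (x : 'I_d -> X -> k) p f (c : 'rV_d) :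
  is_gradient x p f c <->
  @eqm k (X -> k^o) (in_msquare p) (fun y => f y - f p)
    (\sum_a c 0 a *: ((fun y => x a y - x a p) : X -> k^o)).
Proof.
rewrite /is_gradient /eqm; suff -> : (fun y => f y - f p - \sum_(a < d) c 0 a * (x a y - x a p)) =
  ((fun y => f y - f p) : X -> k^o) - \sum_a c 0 a *: ((fun y => x a y - x a p) : X -> k^o) by [].
apply/funext => y; transitivity ((f y - f p) - (\sum_a c 0 a *: ((fun y => x a y - x a p) : X -> k^o)) y) => //.
by congr (_ - _); rewrite fct_sumE.
Qed.

(** The existence half of [cotangent_basis]. It is an open condition by itself, whereas uniqueness
    nearby needs a dimension count. *)
Definition spans d (x : 'I_d -> X -> k) (p : X) : Prop :=
  forall V f, opn V -> V p -> reg V f -> exists c : 'rV_d, is_gradient x p f c.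

(** Spanning at [p] gives an identity of functions near [p], [f = const + C x + sum a_l b_l], which
    any derivation may differentiate. The coefficients [M i] come from [a_l db_l + b_l da_l] and
    vanish at [p] because [a_l] and [b_l] do. *)
Lemma span_relation d (x : 'I_d -> X -> k) p (U : set X) n (t : X -> 'rV[k]_n)
    (U0 : set X) (f : X -> k) :
  affine_chart U t -> U p -> spans x p -> opn U0 -> U0 p -> (forall a, reg U0 (x a)) -> reg U0 f ->
  exists (V : set X) (C : 'rV[k]_d) (M : 'I_n -> X -> k),
    [/\ opn V, V p, V `<=` U `&` U0, (forall i, reg V (M i) /\ M i p = 0) &
    forall (Phi : fieldType) (W : lmodType Phi) (null : set W) ev D S,
      gderiv V null ev D S -> (forall i, S (fun x => t x 0 i)) ->
      (forall a, S (x a)) /\ eqm null (D f)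
        (\sum_a ev (fun=> C 0 a) *: D (x a) + \sum_i ev (M i) *: D (fun x => t x 0 i))].
Proof.
move=> ct Up spx oU0 U0p rx rf.
have [C [U1 [m [a [b [oU1 U1p ra rb fab]]]]]] := spx _ _ oU0 U0p rf.
have /choice[xV hx] : forall a, exists V, [/\ opn V, V p, V `<=` U `&` U0 &
    forall (Phi : fieldType) (W : lmodType Phi) (null : set W) ev D S,
      gderiv V null ev D S -> (forall i, S (fun x => t x 0 i)) -> S (x a)].
  move=> j; have [V [r [oV Vp VU _ h]]] := reg_D laX ct Up oU0 U0p (rx j).
  by exists V; split=> // Phi W null ev D S gd St; have [] := h _ _ _ _ _ _ gd St.
have /choice[abV] : forall l, exists V (M : 'I_n -> X -> k), [/\ opn V, V p, V `<=` U1,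
    (forall i, reg V (M i) /\ M i p = 0) &
    forall (Phi : fieldType) (W : lmodType Phi) (null : set W) ev D S,
      gderiv V null ev D S -> (forall i, S (fun x => t x 0 i)) ->
      S (fun y => a l y * b l y) /\
      eqm null (D (fun y => a l y * b l y)) (\sum_i ev (M i) *: D (fun x => t x 0 i))].
  move=> l; have [ra1 ra2] := ra l; have [rb1 rb2] := rb l.
  have [V [r [oV Vp VU rr h]]] := reg_D laX ct Up oU1 U1p ra1.
  have [V' [r' [oV' V'p VU' rr' h']]] := reg_D laX ct Up oU1 U1p rb1.
  have oVV : opn (V `&` V') by exact: opnI.
  exists (V `&` V'), (fun i y => a l y * r' i y + b l y * r i y); split=> //.
  - by move=> y [/VU[]].
  - move=> i; rewrite ra2 rb2 !mul0r addr0; split=> //.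
    apply: reg_add => //; apply: reg_mul => //.
    + by apply: (reg_sub aX oU1 oVV _ ra1) => y [/VU[]].
    + exact: (reg_sub aX oV' oVV (@subIsetr _ _ _)).
    + by apply: (reg_sub aX oU1 oVV _ rb1) => y [/VU[]].
    + exact: (reg_sub aX oV oVV (@subIsetl _ _ _)).
  - move=> Phi W null ev D S gd St.
    have [Sa Da] := h _ _ _ _ _ _ (gderiv_sub (@subIsetl _ _ _) gd) St.
    have [Sb Db] := h' _ _ _ _ _ _ (gderiv_sub (@subIsetr _ _ _) gd) St.
    split; first exact: (gd_mul gd).
    apply: (eqm_trans gd); first exact: (gd_Dmul gd).
    apply: (eqm_trans gd); first by apply: (eqm_add gd); apply: (eqm_scale gd); [exact: Db|exact: Da].
    rewrite !scaler_sumr -big_split /=; apply: (eqm_sum gd) => i _.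
    by rewrite !scalerA -scalerDl -!(gd_evM gd) -(gd_evD gd); exact: (eqm_refl gd).
move=> /choice[abM hab].
pose V := [set y | forall a, xV a y] `&` [set y | forall l, abV l y] `&` (U `&` U0) `&` U1.
have oV : opn V.
  apply: opnI => //; apply: opnI => //; last by apply: opnI => //; case: ct.
  by apply: opnI => //; apply: opn_fin => i; [have [] := hx i|have [] := hab i].
exists V, C, (fun i y => \sum_l abM l i y); split=> //.
- by do !split=> //; move=> i; [have [] := hx i|have [] := hab i].
- by move=> y [[_ ?] _].
- move=> i; split.
    apply: reg_sum => // l _; have [oVl _ _ hM _] := hab l.
    by apply: (reg_sub aX oVl oV _ (hM i).1) => y [[[_ hy] _] _]; exact: hy.
  by apply: big1 => l _; have [_ _ _ hM _] := hab l; exact: (hM i).2.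
- move=> Phi W null ev D S gd St.
  have Sx j : S (x j).
    have [_ _ _ h] := hx j; apply: (h _ _ _ _ _ _ (gderiv_sub _ gd) St).
    by move=> y [[[hy _] _] _]; exact: hy.
  split=> //.
  have Sab l : S (fun y => a l y * b l y) /\
      eqm null (D (fun y => a l y * b l y)) (\sum_i ev (abM l i) *: D (fun x => t x 0 i)).
    have [_ _ _ _ h] := hab l; apply: (h _ _ _ _ _ _ (gderiv_sub _ gd) St).
    by move=> y [[[_ hy] _] _]; exact: hy.
  pose g1 y := \sum_a C 0 a * x a y; pose g2 y := \sum_l a l y * b l y.
  pose c0 := f p - \sum_a C 0 a * x a p.
  have Sc j : S (fun y => C 0 j * x j y) by have [] := D_scale gd (C 0 j) (Sx j).
  have [Sg1 Dg1] := D_sum gd (index_enum 'I_d) (P := xpredT) (fun j _ => Sc j).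
  have [Sg2 Dg2] := D_sum gd (index_enum 'I_m) (P := xpredT) (fun l _ => (Sab l).1).
  have Sg12 : S (fun y => g1 y + g2 y) by exact: (gd_add gd).
  have [//|y Vy|_ Df _] := gd_ext gd (f := fun y => g1 y + g2 y + c0) (g := f).
  + by apply: (gd_add gd) => //; exact: (gd_cst gd).
  + have U1y : U1 y by case: Vy.
    rewrite /g2 -fab//= /c0 /g1.
    have -> : \sum_(i < d) C 0 i * (x i y - x i p) =
        \sum_i C 0 i * x i y - \sum_i C 0 i * x i p.
      by rewrite -sumrB; apply: eq_bigr => i _; rewrite mulrBr.
    by ring.
  apply: (eqm_trans gd); first exact: (eqm_sym gd Df).
  apply: (eqm_trans gd); first by apply: (gd_Dadd gd) => //; exact: (gd_cst gd).
  rewrite -[X in eqm _ _ X]addr0; apply: (eqm_add gd); last first.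
    by rewrite /eqm subr0; exact: (gd_Dcst gd).
  apply: (eqm_trans gd); first exact: (gd_Dadd gd).
  apply: (eqm_add gd).
    apply: (eqm_trans gd Dg1); apply: (eqm_sum gd) => j _.
    by have [] := D_scale gd (C 0 j) (Sx j).
  apply: (eqm_trans gd Dg2).
  apply: (eqm_trans gd); first by apply: (eqm_sum gd) => l _; exact: (Sab l).2.
  rewrite exchange_big /=; apply: (eqm_sum gd) => i _.
  by rewrite (ev_sum gd) scaler_suml; exact: (eqm_refl gd).
Qed.

End Spanning.

Section Coordinates.
Local Open Scope classical_set_scope.
Local Open Scope ring_scope.

Variables (k : closedFieldType) (X : fspace k).
Hypothesis laX : locally_affine X.
Let aX := laX.1.

(** Differentiating the relations [t = const + C x + sum a b] of [span_relation]
    gives [(1 - M) dt = C dx] with [M p = 0], so [1 - M] is invertible near [p]. *)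
Lemma span_nearby d (x : 'I_d -> X -> k) p (U : set X) n (t : X -> 'rV[k]_n) (U0 : set X) :
  affine_chart U t -> U p -> spans x p -> opn U0 -> U0 p -> (forall a, reg U0 (x a)) ->
  exists (V : set X) (G : X -> 'M[k]_(n, d)),
    [/\ opn V, V p, V `<=` U `&` U0, mxreg V G &
    forall (Phi : fieldType) (W : lmodType Phi) (null : set W) ev D S,
      gderiv V null ev D S -> (forall i, S (fun x => t x 0 i)) ->
      (forall a, S (x a)) /\ forall j, eqm null (D (fun x => t x 0 j))
        (\sum_a ev (fun y => G y j a) *: D (x a))].
Proof.
move=> ct Up spx oU0 U0p rx; have oU : opn U by case: ct.
have oUU : opn (U `&` U0) by exact: opnI.
have UUp : (U `&` U0) p by [].
have rx' a : reg (U `&` U0) (x a) by exact: (reg_sub aX oU0 oUU (@subIsetr _ _ _)).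
have rt j : reg (U `&` U0) (fun x => t x 0 j).
  by apply: (reg_sub aX oU oUU (@subIsetl _ _ _)); exact: (chart_reg ct).
have /choice[Vx hx] : forall a, exists V, [/\ opn V, V p &
    forall (Phi : fieldType) (W : lmodType Phi) (null : set W) ev D S,
      gderiv V null ev D S -> (forall i, S (fun x => t x 0 i)) -> S (x a)].
  move=> j; have [V [r [oV Vp _ _ h]]] := reg_D laX ct Up oU0 U0p (rx j).
  by exists V; split=> // Phi W null ev D S gd St; have [] := h _ _ _ _ _ _ gd St.
have /choice[V0] := fun j => span_relation laX ct Up spx oUU UUp rx' (rt j).
move=> /choice[C0] /choice[M0 h].
pose V1 : set X := [set y | forall a, Vx a y] `&` [set y | forall j, V0 j y] `&` (U `&` U0).
have oV1 : opn V1 by do !apply: opnI => //; apply: opn_fin => // j; [have [] := hx j|have [] := h j].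
pose A y : 'M[k]_n := \matrix_(j, i) ((j == i)%:R - M0 j i y).
pose C : 'M[k]_(n, d) := \matrix_(j, a) C0 j 0 a.
have rA : mxreg V1 A.
  move=> j i; have : reg V1 (fun y => (j == i)%:R - M0 j i y).
    apply: reg_subr => //; first exact: reg_cst.
    have [oV0 _ _ hM _] := h j.
    by apply: (reg_sub aX oV0 oV1 _ (hM i).1) => y [[_ hy] _]; exact: hy.
  by congr (reg _ _); apply/funext => y; rewrite mxE.
have rdA := reg_det laX oV1 rA.
have oV := opn_neq0 laX oV1 rdA; set V := [set _ | _] in oV.
have VV1 : V `<=` V1 by move=> y [].
have rA' : mxreg V A by move=> i j; exact: (reg_sub aX oV1 oV VV1).
have uA y : V y -> A y \in unitmx by case=> _; rewrite unitmxE unitfE.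
exists V, (fun y => invmx (A y) *m C); split=> //.
- split; first by do !split=> //; move=> j; [have [] := hx j|have [] := h j].
  suff -> : A p = 1%:M by rewrite det1 oner_neq0.
  by apply/matrixP => j i; rewrite !mxE; have [_ _ _ hM _] := h j; rewrite (hM i).2 subr0.
- by move=> y /VV1[].
- apply: mxreg_mul => //; last exact: mxreg_cst.
  by apply: mxreg_inv => // y [].
- move=> Phi W null ev D S gd St.
  have gdj j : gderiv (V0 j) null ev D S.
    by apply: (gderiv_sub _ gd) => y /VV1[[_ hy] _]; exact: hy.
  have Dt j : eqm null (D (fun x => t x 0 j))
      (\sum_a ev (fun=> C0 j 0 a) *: D (x a) + \sum_i ev (M0 j i) *: D (fun x => t x 0 i)).
    by have [_ _ _ _ hj] := h j; have [] := hj _ _ _ _ _ _ (gdj j) St.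
  split=> [a|l].
    have [_ _ ha] := hx a; apply: (ha _ _ _ _ _ _ (gderiv_sub _ gd) St).
    by move=> y /VV1[[hy _] _]; exact: hy.
  have AD j : eqm null (\sum_i ev (fun y => A y j i) *: D (fun x => t x 0 i))
                      (\sum_a ev (fun=> C j a) *: D (x a)).
    have -> : \sum_i ev (fun y => A y j i) *: D (fun x => t x 0 i) =
        D (fun x => t x 0 j) - \sum_i ev (M0 j i) *: D (fun x => t x 0 i).
      rewrite [X in _ = X - _](_ : _ = \sum_i (j == i)%:R *: D (fun x => t x 0 i)).
        rewrite -sumrB; apply: eq_bigr => i _; rewrite -scalerBl -(ev_bool gd) -(evB gd).
        by congr (ev _ *: _); apply/funext => y; rewrite mxE.
      rewrite (bigD1 j)//= eqxx scale1r big1 ?addr0// => i ij.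
      by rewrite eq_sym (negPf ij) scale0r.
    rewrite [X in eqm _ _ X](_ : _ = \sum_a ev (fun=> C0 j 0 a) *: D (x a)); last first.
      by apply: eq_bigr => a _; rewrite mxE.
    rewrite /eqm -addrA -opprD [X in _ - X]addrC; exact: Dt.
  pose B y := invmx (A y).
  (* The linear system is solved: [D t] is the inverse matrix [B] applied to [A D t], and [AD]
     computes the latter. *)
  have -> : D (fun x => t x 0 l) =
      \sum_j ev (fun y => B y l j) *: \sum_i ev (fun y => A y j i) *: D (fun x => t x 0 i).
    under eq_bigr do rewrite scaler_sumr.
    rewrite exchange_big /= (bigD1 l)//= [X in _ + X]big1 ?addr0 => [|i il].
      under eq_bigr do rewrite scalerA -(gd_evM gd).
      rewrite -scaler_suml -(ev_sum gd).
      have [//|y Vy|_ _ <-] := gd_ext gd (f := fun=> true%:R) (g := fun y => \sum_j B y l j * A y j l).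
      + exact: (gd_cst gd).
      + have := mulVmx (uA y Vy) => /matrixP /(_ l l); rewrite !mxE eqxx => <-.
        by apply: eq_bigr => j _; rewrite !mxE.
      + by rewrite (ev_bool gd) scale1r.
    under eq_bigr do rewrite scalerA -(gd_evM gd).
    rewrite -scaler_suml -(ev_sum gd).
    have [//|y Vy|_ _ <-] := gd_ext gd (f := fun=> false%:R) (g := fun y => \sum_j B y l j * A y j i).
    + exact: (gd_cst gd).
    + have := mulVmx (uA y Vy) => /matrixP /(_ l i); rewrite !mxE eq_sym (negPf il) => <-.
      by apply: eq_bigr => j _; rewrite !mxE.
    + by rewrite (ev_bool gd) scale0r.
  apply: (eqm_trans gd); first by apply: (eqm_sum gd) => j _; apply: (eqm_scale gd); exact: AD.
  under eq_bigr do rewrite scaler_sumr.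
  rewrite exchange_big /=; apply: (eqm_sum gd) => a _.
  under eq_bigr do rewrite scalerA -(gd_evM gd).
  rewrite -scaler_suml -(ev_sum gd) [X in eqm _ (ev X *: _)](_ : _ = fun y => (B y *m C) l a).
    exact: (eqm_refl gd).
  by apply/funext => y; rewrite mxE.
Qed.

(** Substituting [dt = G dx] into [df = r dt]. Coordinates that span at the single point [p] thereby
    control [df] on a neighbourhood, for point derivations and field derivations alike. *)
Lemma span_reg d (x : 'I_d -> X -> k) p (U : set X) n (t : X -> 'rV[k]_n) (U0 U1 : set X) f :
  affine_chart U t -> U p -> spans x p -> opn U0 -> U0 p -> (forall a, reg U0 (x a)) ->
  opn U1 -> U1 p -> reg U1 f ->
  exists (V : set X) (c : X -> 'rV[k]_d),
    [/\ opn V, V p, V `<=` U `&` (U0 `&` U1), mxreg V c &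
    forall (Phi : fieldType) (W : lmodType Phi) (null : set W) ev D S,
      gderiv V null ev D S -> (forall i, S (fun x => t x 0 i)) ->
      [/\ S f, (forall a, S (x a)) & eqm null (D f) (\sum_a ev (fun y => c y 0 a) *: D (x a))]].
Proof.
move=> ct Up spx oU0 U0p rx oU1 U1p rf; have oU : opn U by case: ct.
have [V [G [oV Vp VU rG hG]]] := span_nearby ct Up spx oU0 U0p rx.
have [V' [r [oV' V'p VU' rr hr]]] := reg_D laX ct Up oU1 U1p rf.
have oVV : opn (V `&` V') by exact: opnI.
exists (V `&` V'), (fun y => (\row_i r i y) *m G y); split=> //.
- by move=> y [/VU[? ?] /VU'[? ?]].
- apply: mxreg_mul => // i j; last exact: (reg_sub aX oV oVV (@subIsetl _ _ _)).
  have := reg_sub aX oV' oVV (@subIsetr _ _ _) (rr j).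
  by congr (reg _ _); apply/funext => y; rewrite mxE.
- move=> Phi W null ev D S gd St.
  have [Sf Df] := hr _ _ _ _ _ _ (gderiv_sub (@subIsetr _ _ _) gd) St.
  have [Sx Dt] := hG _ _ _ _ _ _ (gderiv_sub (@subIsetl _ _ _) gd) St.
  split=> //; apply: (eqm_trans gd Df).
  apply: (eqm_trans gd); first by apply: (eqm_sum gd) => j _; apply: (eqm_scale gd); exact: Dt.
  under eq_bigr do rewrite scaler_sumr.
  rewrite exchange_big /=; apply: (eqm_sum gd) => a _.
  under eq_bigr do rewrite scalerA -(gd_evM gd).
  rewrite -scaler_suml -(ev_sum gd).
  rewrite [X in eqm _ (ev X *: _)](_ : _ = fun y => ((\row_i r i y) *m G y) 0 a).
    exact: (eqm_refl gd).
  by apply/funext => y; rewrite mxE; apply: eq_bigr => i _; rewrite mxE.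
Qed.

End Coordinates.

Section Gradients.
Local Open Scope classical_set_scope.
Local Open Scope ring_scope.
Variables (k : closedFieldType) (X : fspace k).
Hypothesis laX : locally_affine X.
Let aX := laX.1.

Let gdp p := gderiv_pt laX (opnT aX) (I : (setT : set X) p).

Lemma is_gradient_trans d e (x : 'I_d -> X -> k) (y : 'I_e -> X -> k) p f
    (c : 'rV_e) (J : 'M[k]_(e, d)) :
  is_gradient y p f c -> (forall b, is_gradient x p (y b) (row b J)) ->
  is_gradient x p f (c *m J).
Proof.
move=> /is_gradientE h hJ; apply/is_gradientE; have gd := gdp p.
apply: (eqm_trans gd h); apply: (eqm_trans gd).
  by apply: (eqm_sum gd) => b _; apply: (eqm_scale gd); exact: (is_gradientE _ _ _ _).1 (hJ b).
under eq_bigr do rewrite scaler_sumr.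
rewrite exchange_big /=; apply: (eqm_sum gd) => a _.
under eq_bigr do rewrite scalerA.
rewrite -scaler_suml mxE; under eq_bigr do rewrite mxE; exact: (eqm_refl gd).
Qed.

Lemma is_gradient_coord d (x : 'I_d -> X -> k) p a :
  is_gradient x p (x a) (delta_mx 0 a).
Proof.
apply/is_gradientE; rewrite (bigD1 a)//= big1 ?addr0 => [|b ba].
  by rewrite !mxE !eqxx scale1r; exact: (eqm_refl (gdp p)).
by rewrite !mxE (negPf ba) andbF scale0r.
Qed.

Lemma is_gradient_eq d (x : 'I_d -> X -> k) p f g (c : 'rV_d) V :
  opn V -> V p -> (forall y, V y -> f y = g y) -> is_gradient x p f c -> is_gradient x p g c.
Proof.
move=> oV Vp fg [U [m [a [b [oU Up ra rb h]]]]].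
have oUV : opn (U `&` V) by exact: opnI.
exists (U `&` V), m, a, b; split=> //.
- by move=> l; have [ra1 ra2] := ra l; split=> //; exact: (reg_sub aX oU oUV (@subIsetl _ _ _)).
- by move=> l; have [rb1 rb2] := rb l; split=> //; exact: (reg_sub aX oU oUV (@subIsetl _ _ _)).
- by move=> y [Uy Vy]; rewrite -h// !fg.
Qed.

Lemma cotangent_basis_spans d (x : 'I_d -> X -> k) p : cotangent_basis x p -> spans x p.
Proof. by move=> cb V f oV Vp rf; have [c [hc _]] := cb V f oV Vp rf; exists c. Qed.

Lemma gradient_uniq d (x : 'I_d -> X -> k) p f (c : 'rV_d) : cotangent_basis x p ->
  regat p f -> is_gradient x p f c -> gradient x p f = c.
Proof.
move=> cb [V [oV Vp rf]] hc; have [c0 [hc0 u]] := cb V f oV Vp rf.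
rewrite /gradient; case: xgetP => [c' -> hc'|/(_ c)/(_ hc)//].
by rewrite -(u _ hc') (u _ hc).
Qed.

Lemma gradientP d (x : 'I_d -> X -> k) p f : cotangent_basis x p ->
  regat p f -> is_gradient x p f (gradient x p f).
Proof.
move=> cb rf; have [V [oV Vp rVf]] := rf; have [c [hc _]] := cb V f oV Vp rVf.
by rewrite (gradient_uniq cb rf hc).
Qed.

Lemma gradient_eq d (x : 'I_d -> X -> k) p f g V : cotangent_basis x p -> regat p f ->
  opn V -> V p -> (forall y, V y -> f y = g y) -> gradient x p g = gradient x p f.
Proof.
move=> cb rf oV Vp fg; apply: gradient_uniq => //.
  have [U [oU Up rUf]] := rf; exists (U `&` V).
  have oUV : opn (U `&` V) by exact: opnI.
  split=> //; apply: (reg_res aX oU oUV (@subIsetl _ _ _) rUf) => y [_ Vy].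
  by rewrite fg.
exact: (is_gradient_eq oV Vp fg (gradientP cb rf)).
Qed.

Lemma gradient_coord d (x : 'I_d -> X -> k) p a : cotangent_basis x p -> regat p (x a) ->
  gradient x p (x a) = delta_mx 0 a.
Proof. by move=> cb rx; apply: gradient_uniq => //; exact: is_gradient_coord. Qed.

Lemma gradient_chain d e (x : 'I_d -> X -> k) (y : 'I_e -> X -> k) p f :
  cotangent_basis x p -> cotangent_basis y p -> regat p f -> (forall b, regat p (y b)) ->
  gradient x p f = gradient y p f *m (\matrix_(b, a) gradient x p (y b) 0 a).
Proof.
move=> cx cy rf ry; apply: gradient_uniq => //.
apply: (is_gradient_trans (gradientP cy rf)) => b.
rewrite (_ : row b _ = gradient x p (y b)); last by apply/rowP => a; rewrite !mxE.
exact: gradientP.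
Qed.

(** A form of Nakayama's lemma: the formulas [dt = G dx] hold near [p], and read modulo the square
    of the maximal ideal at [q] they show that [x] spans there too. *)
Lemma spans_open d (x : 'I_d -> X -> k) p U0 : spans x p -> opn U0 -> U0 p ->
  (forall a, reg U0 (x a)) ->
  exists V, [/\ opn V, V p, V `<=` U0 & forall q, V q -> spans x q].
Proof.
move=> spx oU0 U0p rx; have [U [n [t [Up ct]]]] := laX.2 p.
have [V [G [oV Vp VU rG hG]]] := span_nearby laX ct Up spx oU0 U0p rx.
exists V; split=> //; first by move=> y /VU[].
move=> q Vq U1 f oU1 U1q rf; have [Uq _] := VU _ Vq; have [oU _ _] := ct.
have [V' [r [oV' V'q VU' rr hr]]] := reg_D laX ct Uq oU1 U1q rf.
have St i : regat q (fun x => t x 0 i) by exists U; split=> //; exact: (chart_reg ct).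
have gdV := gderiv_pt laX oV Vq; have gdV' := gderiv_pt laX oV' V'q.
have [_ Df] := hr _ _ _ _ _ _ gdV' St.
have [_ Dt] := hG _ _ _ _ _ _ gdV St.
exists ((\row_i r i q) *m G q).
apply: (@is_gradient_trans _ _ _ (fun i y => t y 0 i)).
  by apply/is_gradientE; under eq_bigr do rewrite mxE; exact: Df.
by move=> j; apply/is_gradientE; under eq_bigr do rewrite mxE; exact: Dt.
Qed.

(** Both families have [d] members, so the transition matrices are square and [P Q = 1] implies
    [Q P = 1]; two gradients with the same image under [Q] coincide. *)
Lemma spans_cotangent_basis d (x z : 'I_d -> X -> k) q : spans x q -> cotangent_basis z q ->
  (forall a, regat q (x a)) -> (forall a, regat q (z a)) -> cotangent_basis x q.
Proof.
move=> spx cz rx rz V f oV Vq rf.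
have /choice[T hT] : forall b, exists c, is_gradient x q (z b) c.
  by move=> b; have [U [oU Uq rU]] := rz b; exact: (spx _ _ oU Uq rU).
pose P : 'M[k]_d := \matrix_(b, a) T b 0 a.
pose Q : 'M[k]_d := \matrix_(b, a) gradient z q (x b) 0 a.
have gP b : is_gradient x q (z b) (row b P).
  by rewrite (_ : row b P = T b)//; apply/rowP => a; rewrite !mxE.
have gQ b : is_gradient z q (x b) (row b Q).
  rewrite (_ : row b Q = gradient z q (x b)); last by apply/rowP => a; rewrite !mxE.
  exact: gradientP.
have PQ : P *m Q = 1%:M.
  apply/row_matrixP => b; rewrite row_mul row1.
  rewrite -(gradient_coord cz (rz b)); apply/esym/gradient_uniq => //.
  exact: (is_gradient_trans (gP b) gQ).
have QP : Q *m P = 1%:M by apply: mulmx1C.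
have [c hc] := spx _ _ oV Vq rf; exists c; split=> // c' hc'.
have rf' : regat q f by exists V.
have e : c *m Q = c' *m Q.
  by rewrite -(gradient_uniq cz rf' (is_gradient_trans hc gQ)) -(gradient_uniq cz rf' (is_gradient_trans hc' gQ)).
by rewrite -[c]mulmx1 -[c']mulmx1 -QP !mulmxA e.
Qed.

(** For [d = krull_dim X] this is [smooth X]. With the dimension as a parameter, no argument depends
    on the value of [krull_dim]. *)
Definition smooth_dim d := forall p : X, exists (U : set X) (x : 'I_d -> X -> k),
  [/\ opn U, U p, (forall a, reg U (x a)) & cotangent_basis x p].

Lemma cotangent_basis_open d (x : 'I_d -> X -> k) p U0 : smooth_dim d ->
  cotangent_basis x p -> opn U0 -> U0 p -> (forall a, reg U0 (x a)) ->
  exists V, [/\ V p, V `<=` U0 & local_coordinates V x].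
Proof.
move=> sX cx oU0 U0p rx.
have [V [oV Vp VU0 sV]] := spans_open (cotangent_basis_spans cx) oU0 U0p rx.
exists V; split=> //; split=> // [a|q Vq]; first exact: (reg_sub aX oU0 oV).
have [U [z [oU Uq rz cz]]] := sX q.
apply: (spans_cotangent_basis (sV _ Vq) cz) => a; last by exists U.
by exists U0; split=> //; exact: VU0.
Qed.

Lemma smooth_local_coordinates d : smooth_dim d -> forall p : X,
  exists V (x : 'I_d -> X -> k), V p /\ local_coordinates V x.
Proof.
move=> sX p; have [U [x [oU Up rx cx]]] := sX p.
by have [V [Vp _ lV]] := cotangent_basis_open sX cx oU Up rx; exists V, x.
Qed.

(** Near each point the regular coefficients of [span_reg] are the gradient, by uniqueness. *)
Lemma gradient_reg d (x : 'I_d -> X -> k) U V f a : local_coordinates U x ->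
  opn V -> reg V f -> reg (U `&` V) (fun q => gradient x q f 0 a).
Proof.
move=> [oU rx cx] oV rf; have oUV : opn (U `&` V) by exact: opnI.
apply: reg_local_eq => // p [Up Vp].
have [U' [n [t [U'p ct]]]] := laX.2 p; have [oU' _ _] := ct.
have [V' [c [oV' V'p VU' rc hc]]] :=
  span_reg laX ct U'p (cotangent_basis_spans (cx _ Up)) oU Up rx oV Vp rf.
exists V', (fun y => c y 0 a); split=> // q V'q [Uq Vq].
have [U'q _] := VU' _ V'q.
have St i : regat q (fun x => t x 0 i) by exists U'; split=> //; exact: (chart_reg ct).
have [_ _ h] := hc _ _ _ _ _ _ (gderiv_pt laX oV' V'q) St.
rewrite (@gradient_uniq _ x q f (c q)) //; first exact: cx.
  by exists V.
by apply/is_gradientE.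
Qed.

End Gradients.

(** * Extension of derivations *)

Section DerivationExtension.
Local Open Scope classical_set_scope.
Local Open Scope ring_scope.
Variable F : fieldType.
Hypothesis F0 : [pchar F] =i pred0.
Implicit Types (E : set F) (D : F -> F).

(** Subfields are subsets of one fixed field, so that a tower of extensions needs no embeddings and
    derivations are plain functions [F -> F] constrained on [E]. *)
Definition subfield_set E :=
  [/\ E 1, (forall a b, E a -> E b -> E (a - b)),
      (forall a b, E a -> E b -> E (a * b)) & (forall a, E a -> E a^-1)].

Definition der_on E D :=
  (forall a b, E a -> E b -> D (a + b) = D a + D b) /\
  (forall a b, E a -> E b -> D (a * b) = a * D b + b * D a).

Section OneStep.
Variables (E : set F) (D : F -> F).
Hypothesis sE : subfield_set E.
Hypothesis dD : der_on E D.

Lemma subfield0 : E 0. Proof. by case: sE => e1 eB _ _; rewrite -(subrr 1); exact: eB. Qed.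
Lemma subfieldN a : E a -> E (- a).
Proof. by case: sE => _ eB _ _ Ea; rewrite -sub0r; apply: eB => //; exact: subfield0. Qed.
Lemma subfieldD a b : E a -> E b -> E (a + b).
Proof. by case: sE => _ eB _ _ Ea Eb; rewrite -[b]opprK; apply: eB => //; exact: subfieldN. Qed.
Lemma subfieldM a b : E a -> E b -> E (a * b). Proof. by case: sE => _ _ h _; apply: h. Qed.
Lemma subfield_sum I (r : seq I) (P : pred I) (G : I -> F) :
  (forall i, P i -> E (G i)) -> E (\sum_(i <- r | P i) G i).
Proof. by move=> h; apply: (big_ind E) => //; [exact: subfield0|exact: subfieldD]. Qed.

Lemma der0 : D 0 = 0.
Proof.
have := dD.1 0 0 subfield0 subfield0; rewrite addr0 => /eqP.
by rewrite -subr_eq0 opprD addrA subrr sub0r oppr_eq0 => /eqP.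
Qed.

Lemma der1 : D 1 = 0.
Proof.
have e1 : E 1 by case: sE.
have := dD.2 1 1 e1 e1; rewrite !mul1r => /eqP.
by rewrite -subr_eq0 opprD addrA subrr sub0r oppr_eq0 => /eqP.
Qed.

Lemma der_sum I (r : seq I) (P : pred I) (G : I -> F) :
  (forall i, P i -> E (G i)) -> D (\sum_(i <- r | P i) G i) = \sum_(i <- r | P i) D (G i).
Proof.
move=> h; elim: r => [|i r IH]; first by rewrite !big_nil der0.
rewrite !big_cons; case: ifP => // Pi; rewrite dD.1 ?IH//; first exact: h.
exact: subfield_sum.
Qed.

Definition pover (p : {poly F}) := forall i, E p`_i.
Definition pder (p : {poly F}) := \poly_(i < size p) D p`_i.

Lemma pderE p i : (pder p)`_i = D p`_i.
Proof. by rewrite coef_poly; case: ltnP => // h; rewrite nth_default// der0. Qed.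

Lemma poverD p q : pover p -> pover q -> pover (p + q).
Proof. by move=> hp hq i; rewrite coefD; exact: subfieldD. Qed.
Lemma poverN p : pover p -> pover (- p).
Proof. by move=> hp i; rewrite coefN; exact: subfieldN. Qed.
Lemma poverM p q : pover p -> pover q -> pover (p * q).
Proof. by move=> hp hq i; rewrite coefM; apply: subfield_sum => j _; exact: subfieldM. Qed.
Lemma poverC c : E c -> pover c%:P.
Proof. by move=> Ec i; rewrite coefC; case: ifP => // _; exact: subfield0. Qed.
Lemma poverX : pover 'X.
Proof. by move=> i; rewrite coefX; case: eqP => _; [case: sE|exact: subfield0]. Qed.
Lemma poverXn n : pover 'X^n.
Proof. by move=> i; rewrite coefXn; case: eqP => _; [case: sE|exact: subfield0]. Qed.
Lemma pover_deriv p : pover p -> pover p^`().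
Proof.
move=> hp i; rewrite coef_deriv; move: (hp i.+1); move: (p`_i.+1) => a Ea.
by elim: (i.+1) => [|n IH]; [exact: subfield0|rewrite mulrS; exact: subfieldD].
Qed.

Lemma pderD p q : pover p -> pover q -> pder (p + q) = pder p + pder q.
Proof. by move=> hp hq; apply/polyP => i; rewrite coefD !pderE coefD dD.1. Qed.
Lemma pderM p q : pover p -> pover q -> pder (p * q) = p * pder q + pder p * q.
Proof.
move=> hp hq; apply/polyP => i; rewrite coefD pderE !coefM der_sum => [|j _]; last exact: subfieldM.
rewrite -big_split; apply: eq_bigr => j _ /=; rewrite !pderE dD.2//.
by congr (_ + _); rewrite mulrC.
Qed.

Variables (t u : F).
(** The value that the Leibniz rule forces on [p.[t]] once [D] is extended by [t |-> u]. *)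
Definition tder p := (pder p).[t] + p^`().[t] * u.

Lemma tderD p q : pover p -> pover q -> tder (p + q) = tder p + tder q.
Proof. by move=> hp hq; rewrite /tder pderD// derivD !hornerD; ring. Qed.
Lemma tderM p q : pover p -> pover q -> tder (p * q) = p.[t] * tder q + q.[t] * tder p.
Proof. by move=> hp hq; rewrite /tder pderM// derivM !(hornerD, hornerM); ring. Qed.
Lemma tderC c : E c -> tder c%:P = D c.
Proof.
move=> Ec; rewrite /tder derivC horner0 mul0r addr0.
rewrite (_ : pder _ = (D c)%:P) ?hornerC//; apply/polyP => i; rewrite pderE !coefC.
by case: ifP => // _; rewrite der0.
Qed.
Lemma tderX : tder 'X = u.
Proof.
rewrite /tder derivX hornerC mul1r (_ : pder _ = 0) ?horner0 ?add0r//.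
by apply/polyP => i; rewrite pderE coefX coef0; case: (_ == _); rewrite ?der1 ?der0.
Qed.
Lemma tder0 : tder 0 = 0.
Proof. by rewrite -polyC0 tderC ?der0//; exact: subfield0. Qed.
Lemma tderN p : pover p -> tder (- p) = - tder p.
Proof.
move=> hp; apply/eqP; rewrite -addr_eq0 -tderD//; last exact: poverN.
by rewrite addNr tder0.
Qed.

Hypothesis compat : forall p, pover p -> p.[t] = 0 -> tder p = 0.

Definition ext_set : set F := [set z | exists p q, [/\ pover p, pover q, q.[t] != 0 & z = p.[t] / q.[t]]].
Definition fder (pq : {poly F} * {poly F}) :=
  (tder pq.1 * pq.2.[t] - pq.1.[t] * tder pq.2) / pq.2.[t] ^+ 2.
(** The quotient rule applied to an arbitrarily chosen fraction representing [z]; the default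
    [(0, 1)] is only met outside [ext_set]. *)
Definition ext_der z := fder (xget (0, 1)
  [set pq | [/\ pover pq.1, pover pq.2, pq.2.[t] != 0 & z = pq.1.[t] / pq.2.[t]]]).

(** For two fractions of the same value, [p * q' - p' * q] vanishes at [t], so [compat] kills its
    [tder]; this is the equality of the two quotient rules. *)
Lemma ext_derE p q : pover p -> pover q -> q.[t] != 0 -> ext_der (p.[t] / q.[t]) = fder (p, q).
Proof.
move=> hp hq q0; rewrite /ext_der; case: xgetP => [[p' q'] _ [/= hp' hq' q0' e]|/(_ (p, q))[]//].
have e1 : p.[t] * q'.[t] = p'.[t] * q.[t].
  by apply/eqP; rewrite -eqr_div//; apply/eqP.
have : tder (p * q' - p' * q) = 0.
  apply: compat; last by rewrite !hornerE e1 subrr.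
  by apply: poverD; [exact: poverM|apply: poverN; exact: poverM].
rewrite tderD ?tderN ?tderM//; try (exact: poverM); try (apply: poverN; exact: poverM).
move=> /eqP; rewrite subr_eq0 => /eqP e2; rewrite /fder /=.
apply/eqP; rewrite eqr_div ?expf_neq0//; apply/eqP.
have ep : p'.[t] = p.[t] * q'.[t] / q.[t] by rewrite e1 mulfK.
have etp : tder p' = (p.[t] * tder q' + q'.[t] * tder p - p'.[t] * tder q) / q.[t].
  by rewrite e2 addrAC subrr add0r mulrC mulKf.
by rewrite etp ep; field.
Qed.

Lemma ext_spec : [/\ subfield_set ext_set, E `<=` ext_set, ext_set t, der_on ext_set ext_der &
  (forall a, E a -> ext_der a = D a) /\ ext_der t = u].
Proof.
have p1 : pover 1 by rewrite -polyC1; apply: poverC; case: sE.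
have h1 : (1 : {poly F}).[t] != 0 by rewrite hornerC oner_neq0.
split.
- split.
  + by exists 1, 1; split=> //; rewrite divff.
  + move=> _ _ [p [q [hp hq q0 ->]]] [p' [q' [hp' hq' q0' ->]]].
    exists (p * q' - p' * q), (q * q'); split.
    * by apply: poverD; [exact: poverM|apply: poverN; exact: poverM].
    * exact: poverM.
    * by rewrite hornerM mulf_neq0.
    * by rewrite !(hornerD, hornerN, hornerM); field; rewrite ?q0 ?q0'.
  + move=> _ _ [p [q [hp hq q0 ->]]] [p' [q' [hp' hq' q0' ->]]].
    exists (p * p'), (q * q'); split; try exact: poverM.
    * by rewrite hornerM mulf_neq0.
    * by rewrite !(hornerD, hornerN, hornerM); field; rewrite ?q0 ?q0'.
  + move=> _ [p [q [hp hq q0 ->]]]; have [p0|p0] := eqVneq p.[t] 0.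
      by exists 0, 1; split=> //; [exact: poverC subfield0|rewrite p0 horner0 !mul0r invr0].
    by exists q, p; split=> //; rewrite invf_div.
- move=> a Ea; exists a%:P, 1; split=> //; first exact: poverC.
  by rewrite !hornerE divr1.
- by exists 'X, 1; split=> //; [exact: poverX|rewrite !hornerE divr1].
- split.
  + move=> _ _ [p [q [hp hq q0 ->]]] [p' [q' [hp' hq' q0' ->]]].
    have -> : p.[t] / q.[t] + p'.[t] / q'.[t] = (p * q' + p' * q).[t] / (q * q').[t].
      by rewrite !(hornerD, hornerN, hornerM); field; rewrite ?q0 ?q0'.
    have ? := poverM hp hq'; have ? := poverM hp' hq; have ? := poverM hq hq'.
    have q00 : (q * q').[t] != 0 by rewrite hornerM mulf_neq0.
    rewrite !ext_derE//; last exact: poverD.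
    rewrite /fder /= tderD ?tderM//.
    by rewrite !(hornerD, hornerM); field; rewrite ?q0 ?q0'.
  + move=> _ _ [p [q [hp hq q0 ->]]] [p' [q' [hp' hq' q0' ->]]].
    have -> : p.[t] / q.[t] * (p'.[t] / q'.[t]) = (p * p').[t] / (q * q').[t].
      by rewrite !(hornerD, hornerN, hornerM); field; rewrite ?q0 ?q0'.
    have ? := poverM hp hp'; have ? := poverM hq hq'.
    have q00 : (q * q').[t] != 0 by rewrite hornerM mulf_neq0.
    rewrite !ext_derE// /fder /= !tderM//.
    by rewrite !(hornerD, hornerM); field; rewrite ?q0 ?q0'.
- split; last first.
    rewrite (_ : ext_der t = ext_der ('X.[t] / (1 : {poly F}).[t])); last first.
      by rewrite !hornerE divr1.
    rewrite ext_derE//; last exact: poverX.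
    rewrite /fder /= tderX -polyC1 tderC; last by case: sE.
    by rewrite der1 !hornerC !hornerE expr1n divr1 subr0.
  move=> a Ea; have -> : ext_der a = ext_der (a%:P.[t] / (1 : {poly F}).[t]).
    by rewrite !hornerE divr1.
  rewrite ext_derE//; last exact: poverC.
  rewrite /fder /= tderC// -polyC1 tderC; last by case: sE.
  by rewrite der1 !hornerC !hornerE expr1n divr1 subr0.
Qed.

End OneStep.

Lemma der_extend_transcendental E D t u : subfield_set E -> der_on E D ->
  (forall p, pover E p -> p.[t] = 0 -> p = 0) ->
  exists E' D', [/\ subfield_set E', E `<=` E', E' t, der_on E' D' &
    (forall a, E a -> D' a = D a) /\ D' t = u].
Proof.
move=> sE dD tr; exists (ext_set E t), (ext_der E D t u); apply: ext_spec => // p hp pt.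
by rewrite (tr _ hp pt) (tder0 sE dD).
Qed.

(** If [t] is transcendental any value will do. If it is algebraic, its minimal polynomial [p]
    determines the value, and [compat] for [p] propagates to all multiples of [p]. *)
Lemma der_extend E D t : subfield_set E -> der_on E D ->
  exists E' D', [/\ subfield_set E', E `<=` E', E' t, der_on E' D' &
    (forall a, E a -> D' a = D a)].
Proof.
move=> sE dD.
have [tr|/existsNP[p0 /not_implyP[hp0 /not_implyP[p0t p0n]]]] :=
  pselect (forall p, pover E p -> p.[t] = 0 -> p = 0).
  have [E' [D' [? ? ? ? [? _]]]] := der_extend_transcendental 0 sE dD tr.
  by exists E', D'.
pose Q n := `[< exists p : {poly F}, [/\ pover E p, p.[t] = 0, p != 0 & size p = n] >].
have exQ : exists n, Q n by exists (size p0); apply/asboolP; exists p0; split=> //; apply/eqP.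
case: (ex_minnP exQ) => n /asboolP[p [hp pt pn sp]] minp.
(* Separability: in characteristic zero the derivative of [p] is nonzero and smaller than [p], so by
   minimality it cannot vanish at [t]. *)
have p't : p^`().[t] != 0.
  apply/negP => /eqP p't; have [p'0|p'0] := eqVneq p^`() 0.
    have size1 : (size p <= 1)%N.
      rewrite leqNgt; apply/negP => s1.
      have : p^`()`_(size p).-2 = 0 by rewrite p'0 coef0.
      rewrite coef_deriv.
      move/eqP; rewrite -mulr_natr mulf_eq0 (pcharf0P F).1// orbC.
      rewrite (_ : (size p).-2.+1 = (size p).-1); last by case: (size p) s1 => [|[]].
      by rewrite -lead_coefE lead_coef_eq0 (negPf pn) orbF; case: (size p) s1 => [|[]].
    move: pt pn; rewrite (size1_polyC size1) hornerC => ->.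
    by rewrite polyC0 eqxx.
  have := minp (size p^`()); rewrite leqNgt -sp lt_size_deriv// => /(_ _)/negP; apply => //.
  by apply/asboolP; exists p^`(); split=> //; exact: pover_deriv.
pose u := - (pder D p).[t] / p^`().[t].
have tp : tder D t u p = 0 by rewrite /tder /u; field.
exists (ext_set E t), (ext_der E D t u).
have compat : forall p, pover E p -> p.[t] = 0 -> tder D t u p = 0; last first.
  by have [? ? ? ? []] := ext_spec sE dD compat.
(* Division by [p], one leading term at a time; each subtracted [R * p] has zero [tder], since [p]
   and its [tder] are both zero at [t]. *)
move=> P; have [m] := ubnP (size P); elim: m P => // m IH P; rewrite ltnS => sP hP Pt.
have [->|P0] := eqVneq P 0; first exact: (tder0 sE dD).
have psP : (size p <= size P)%N by rewrite sp; apply: minp; apply/asboolP; exists P.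
pose c := lead_coef P / lead_coef p.
have Ec : E c by case: sE => _ _ eM eV; apply: eM; [exact: hP|apply: eV; exact: hp].
pose R := c%:P * 'X^(size P - size p).
have hR : pover E R by apply: (poverM sE); [exact: (poverC sE)|exact: (poverXn sE)].
have hRp : pover E (R * p) by exact: (poverM sE).
rewrite -[P](subrK (R * p)) (tderD sE dD)//; last by apply: (poverD sE) => //; exact: (poverN sE).
rewrite [X in _ + X](tderM sE dD)// tp pt mulr0 mul0r !addr0.
apply: IH; last by rewrite !hornerE Pt pt !mulr0 subrr.
  apply: leq_trans _ sP.
  have lR : lead_coef (R * p) = lead_coef P.
    rewrite lead_coefM /R lead_coefM lead_coefC lead_coefXn mulr1 /c.
    by rewrite divfK// lead_coef_eq0.
  have c0 : c != 0 by rewrite mulf_neq0 ?invr_eq0 ?lead_coef_eq0.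
  have R0 : R != 0 by rewrite mulf_neq0 ?polyC_eq0// -size_poly_eq0 size_polyXn.
  have sR : size (R * p) = size P.
    rewrite size_mul// /R size_Cmul// size_polyXn addSn /= subnK//.
  have Pg : (0 < size P)%N by rewrite lt0n size_poly_eq0.
  rewrite -[X in (_ < X)%N](prednK Pg) ltnS; apply/leq_sizeP => j.
  rewrite leq_eqVlt => /orP[/eqP <-|jP].
    by rewrite coefB -lead_coefE -[in X in _ - X]sR -lead_coefE lR subrr.
  rewrite nth_default// (leq_trans (size_polyD _ _))// size_polyN sR maxnn.
  by rewrite -(prednK Pg).
by apply: (poverD sE) => //; exact: (poverN sE).
Qed.

(** Finitely many elements are enough: by [reg_D], the coordinates of one chart carry the
    differentials of all regular functions near a point. *)
Lemma der_extend_fin E D n (t : 'I_n -> F) : subfield_set E -> der_on E D ->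
  exists E' D', [/\ subfield_set E', E `<=` E', (forall i, E' (t i)), der_on E' D' &
    (forall a, E a -> D' a = D a)].
Proof.
elim: n t E D => [|n IH] t E D sE dD; first by exists E, D; split=> //; case.
have [E1 [D1 [s1 i1 t1 d1 e1]]] := der_extend (t ord0) sE dD.
have [E2 [D2 [s2 i2 t2 d2 e2]]] := IH (fun i => t (lift ord0 i)) _ _ s1 d1.
exists E2, D2; split=> //.
- by move=> a /i1/i2.
- by move=> i; case: (unliftP ord0 i) => [j|] -> //; exact: i2.
- by move=> a Ea; rewrite e2 ?e1//; exact: i1.
Qed.

End DerivationExtension.

(** * Ultrapowers of a field *)

Section Ultrapower.
Local Open Scope classical_set_scope.
Local Open Scope ring_scope.
Local Open Scope quotient_scope.
Variables (T : Type) (k : fieldType) (U : set_system T).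
Hypothesis uU : UltraFilter U.
Implicit Types f g h : T -> k.

Let pU : ProperFilter U := @ultra_proper _ _ uU.

Definition ueq f g : bool := `[< U [set x | f x = g x] >].

Lemma ueq_refl : reflexive ueq.
Proof. by move=> f; apply/asboolP; apply: filterS filterT. Qed.

Lemma ueq_sym : ssrbool.symmetric ueq.
Proof.
move=> f g; rewrite /ueq; congr (`[< U _ >]).
by apply/seteqP; split=> x /= ->.
Qed.

Lemma ueq_trans : transitive ueq.
Proof.
move=> g f h /asboolP fg /asboolP gh; apply/asboolP.
by apply: filterS (filterI fg gh) => x [/= -> ->].
Qed.

Canonical ueq_equiv := EquivRel ueq ueq_refl ueq_sym ueq_trans.
Definition ultrapower := {eq_quot ueq}.
HB.instance Definition _ := Choice.on ultrapower.
HB.instance Definition _ := EqQuotient.on ultrapower.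

Definition uclass f : ultrapower := \pi_ultrapower f.

Lemma uclassP f g : uclass f = uclass g <-> U [set x | f x = g x].
Proof. by split=> [/eqmodP/asboolP|h]; [|apply/eqmodP/asboolP]. Qed.

Lemma uclass_repr (a : ultrapower) : uclass (repr a) = a.
Proof. exact: reprK. Qed.

Definition uop1 (op : k -> k) (a : ultrapower) := uclass (fun x => op (repr a x)).
Definition uop2 (op : k -> k -> k) (a b : ultrapower) :=
  uclass (fun x => op (repr a x) (repr b x)).

Lemma repr_uclass f : U [set x | repr (uclass f) x = f x].
Proof. by apply/uclassP; rewrite uclass_repr. Qed.

Lemma uop1E op f : uop1 op (uclass f) = uclass (fun x => op (f x)).
Proof. by apply/uclassP; apply: filterS (repr_uclass f) => x /= ->. Qed.

Lemma uop2E op f g : uop2 op (uclass f) (uclass g) = uclass (fun x => op (f x) (g x)).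
Proof.
apply/uclassP; apply: filterS (filterI (repr_uclass f) (repr_uclass g)) => x [/= -> ->].
by [].
Qed.

Let uD := uop2 +%R.
Let uM := uop2 *%R.
Let uN := uop1 -%R.
Let uV := uop1 GRing.inv.
Let u0 := uclass (fun=> 0).
Let u1 := uclass (fun=> 1).

Let ind1 (P : ultrapower -> Prop) : (forall f, P (uclass f)) -> forall a, P a.
Proof. by move=> h a; rewrite -(uclass_repr a). Qed.

Lemma uaddA : associative uD.
Proof.
elim/ind1 => f; elim/ind1 => g; elim/ind1 => h; rewrite /uD !uop2E.
by congr uclass; apply/funext => x; rewrite addrA.
Qed.
Lemma uaddC : commutative uD.
Proof.
elim/ind1 => f; elim/ind1 => g; rewrite /uD !uop2E.
by congr uclass; apply/funext => x; rewrite addrC.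
Qed.
Lemma uadd0 : left_id u0 uD.
Proof.
by elim/ind1 => f; rewrite /uD !uop2E; congr uclass; apply/funext => x; rewrite add0r.
Qed.
Lemma uaddN : left_inverse u0 uN uD.
Proof.
elim/ind1 => f; rewrite /uD /uN uop1E !uop2E; congr uclass; apply/funext => x.
by rewrite addNr.
Qed.
HB.instance Definition _ := GRing.isZmodule.Build ultrapower uaddA uaddC uadd0 uaddN.

Lemma umulA : associative uM.
Proof.
elim/ind1 => f; elim/ind1 => g; elim/ind1 => h; rewrite /uM !uop2E.
by congr uclass; apply/funext => x; rewrite mulrA.
Qed.
Lemma umulC : commutative uM.
Proof.
elim/ind1 => f; elim/ind1 => g; rewrite /uM !uop2E.
by congr uclass; apply/funext => x; rewrite mulrC.
Qed.
Lemma umul1 : left_id u1 uM.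
Proof.
by elim/ind1 => f; rewrite /uM !uop2E; congr uclass; apply/funext => x; rewrite mul1r.
Qed.
Lemma umulD : left_distributive uM uD.
Proof.
elim/ind1 => f; elim/ind1 => g; elim/ind1 => h; rewrite /uM /uD !uop2E.
by congr uclass; apply/funext => x; rewrite mulrDl.
Qed.
Lemma u1_neq0 : u1 != u0.
Proof.
apply/eqP => /uclassP h; apply: (@filter_not_empty _ U _).
by apply: filterS h => x /= /eqP; rewrite oner_eq0.
Qed.
HB.instance Definition _ :=
  GRing.Zmodule_isComNzRing.Build ultrapower umulA umulC umul1 umulD u1_neq0.

(** This is where the filter must be ultra: a function is either zero on a large set or nonzero on a
    large set. *)
Lemma umulV (a : ultrapower) : a != 0 -> uV a * a = 1.
Proof.
move: a; elim/ind1 => f f0; rewrite /uV uop1E [LHS]uop2E; apply/uclassP.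
have [h|h] := in_ultra_setVsetC [set x | f x = 0] uU.
  by case/negP: f0; apply/eqP/uclassP.
by apply: filterS h => x /= /eqP fx; rewrite mulVf.
Qed.
Lemma uinv0 : uV 0 = 0.
Proof. by rewrite [LHS]uop1E; apply/uclassP; apply: filterS filterT => x _ /=; rewrite invr0. Qed.
HB.instance Definition _ := GRing.ComNzRing_isField.Build ultrapower umulV uinv0.

Lemma uclassD f g : uclass (fun x => f x + g x) = uclass f + uclass g.
Proof. by rewrite [RHS]uop2E. Qed.
Lemma uclassM f g : uclass (fun x => f x * g x) = uclass f * uclass g.
Proof. by rewrite [RHS]uop2E. Qed.

End Ultrapower.

Local Open Scope classical_set_scope.
Local Open Scope ring_scope.
(** [B] prescribes which sets of points count as general; every property holding on a member of [B]
    then holds for classes in [F]. *)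
Lemma ultrapower_field (T : Type) (k : fieldType) (B : set_system T) :
  ProperFilter B ->
  exists (U : set_system T) (F : fieldType) (ev : (T -> k) -> F),
    [/\ UltraFilter U, B `<=` U,
        (forall a, exists f, a = ev f),
        (forall f g, ev f = ev g <-> U [set x | f x = g x]) &
        [/\ ev (fun=> 0) = 0, ev (fun=> 1) = 1, {morph ev : f g / fun x => f x + g x >-> f + g} &
          {morph ev : f g / fun x => f x * g x >-> f * g}]].
Proof.
move=> pB; have [U [uU BU]] := ultraFilterLemma pB.
exists U, (ultrapower k uU), (@uclass T k U uU); split=> //.
- by move=> a; exists (repr a); rewrite uclass_repr.
- exact: uclassP.
- split=> //; [exact: uclassD|exact: uclassM].
Qed.

(** * Germs of functions at a general point *)

Section Algebraic.
Local Open Scope classical_set_scope.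
Local Open Scope ring_scope.

(** The field instance of [gderiv]. The derivation lives on a subfield [E] only, so [S] consists of
    the functions whose class lies in [E]. *)
Lemma gderiv_field (k : fieldType) (T : Type) (U : set_system T) (F : fieldType)
    (ev : (T -> k) -> F) (V : set T) (E : set F) (D : F -> F) :
  UltraFilter U -> (forall f g, ev f = ev g <-> U [set x | f x = g x]) ->
  ev (fun=> 0) = 0 -> ev (fun=> 1) = 1 ->
  {morph ev : f g / fun x => f x + g x >-> f + g} ->
  {morph ev : f g / fun x => f x * g x >-> f * g} ->
  U V -> subfield_set E -> der_on E D -> (forall c, E (ev (fun=> c))) ->
  (forall c, D (ev (fun=> c)) = 0) ->
  @gderiv k T V F F^o [set 0] ev (fun f => D (ev f)) [set f | E (ev f)].
Proof.
move=> uU evP ev0 ev1 evD evM UV sE dD Ec Dc.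
have pU : ProperFilter U := ultra_proper.
have null0 (a : F^o) : a = 0 -> [set 0] a by [].
have evV f g : (forall x, V x -> f x = g x) -> ev f = ev g.
  by move=> fg; apply/evP; apply: filterS UV.
split=> //.
- by move=> a b -> ->; rewrite /= subrr.
- by move=> c a ->; rewrite /= scaler0.
- by move=> f g Ef Eg; rewrite /= evD; exact: (subfieldD sE).
- by move=> f g Ef Eg; apply: null0; rewrite evD dD.1// subrr.
- by move=> f g Ef Eg; rewrite /= evM; exact: (subfieldM sE).
- by move=> f g Ef Eg; apply: null0; rewrite evM dD.2// subrr.
- move=> f Ef f0; have e : ev f * ev (fun x => (f x)^-1) = 1.
    by rewrite -evM -ev1; apply: evV => x Vx; rewrite divff// f0.
  have ef : ev f != 0 by apply: contra_eqN e => /eqP ->; rewrite mul0r eq_sym oner_neq0.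
  rewrite /= (_ : ev _ = (ev f)^-1); first by case: sE => _ _ _; exact.
  by rewrite -[RHS]mulr1 -e mulKf.
- move=> f g Ef fg; have e := evV _ _ fg; rewrite /= -e; split=> //.
  by apply: null0; rewrite subrr.
Qed.

Lemma eqm0 (F : fieldType) (a b : F^o) : eqm [set 0] a b -> a = b.
Proof. by move=> /= /eqP; rewrite subr_eq0 => /eqP. Qed.

Section OverK.
Variables (k : closedFieldType).
Hypothesis char0 : [pchar k] =i pred0.

Lemma pchar_ev (T : Type) (U : set_system T) (F : fieldType) (ev : (T -> k) -> F) :
  UltraFilter U -> (forall f g, ev f = ev g <-> U [set x | f x = g x]) ->
  ev (fun=> 0) = 0 -> ev (fun=> 1) = 1 ->
  {morph ev : f g / fun x => f x + g x >-> f + g} -> [pchar F] =i pred0.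
Proof.
move=> uU evP ev0 ev1 evD; apply/pcharf0P => n.
have pU : ProperFilter U := ultra_proper.
have -> : n%:R = ev (fun=> n%:R).
  elim: n => [|n IH]; first by rewrite ev0.
  by rewrite -natr1 IH -ev1 -evD; congr ev; apply/funext => x; rewrite natr1.
rewrite -ev0; apply/eqP/eqP => [/evP h|->//].
apply/eqP; rewrite -((pcharf0P k).1 char0); apply/eqP.
by have [x] := filter_ex h.
Qed.

Variable X : fspace k.
Hypothesis laX : locally_affine X.
Hypothesis irrX : irreducible_set (setT : set X).
Let aX := laX.1.

Lemma irr_meet (U V : set X) : opn U -> opn V -> U !=set0 -> V !=set0 -> U `&` V !=set0.
Proof.
move=> oU oV U0 V0; have [_ /(_ U V oU oV)] := irrX.
by rewrite !setTI; exact.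
Qed.

(** The neighbourhoods of the generic point; irreducibility makes the filter proper. *)
Definition generic_filter : set_system X := [set A | exists V, [/\ opn V, V !=set0 & V `<=` A]].

Lemma generic_filter_proper : ProperFilter generic_filter.
Proof.
split; first by case=> V [_ [x Vx] V0]; exact: V0 Vx.
split.
- by exists setT; split=> //; [exact: opnT|case: irrX].
- move=> A B [V [oV V0 VA]] [V' [oV' V'0 VB]]; exists (V `&` V').
  split; [exact: opnI|exact: irr_meet|].
  by move=> x [/VA Ax /VB Bx].
- by move=> A B AB [V [oV V0 VA]]; exists V; split=> // x /VA /AB.
Qed.

Lemma common_denominator d (x : X -> 'rV[k]_d) (F : fieldType) (ev : (X -> k) -> F) n (c : 'I_n -> F) :
  {morph ev : f g / fun x => f x * g x >-> f * g} -> ev (fun=> 1) = 1 ->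
  (forall i, exists P Q : mpoly d k, ev (fun y => peval Q (x y)) != 0 /\
     c i = ev (fun y => peval P (x y)) / ev (fun y => peval Q (x y))) ->
  exists (Q : mpoly d k) (P : 'I_n -> mpoly d k), ev (fun y => peval Q (x y)) != 0 /\
     forall i, c i * ev (fun y => peval Q (x y)) = ev (fun y => peval (P i) (x y)).
Proof.
move=> evM ev1; have evpM P Q : ev (fun y => peval (P * Q) (x y)) =
    ev (fun y => peval P (x y)) * ev (fun y => peval Q (x y)).
  by rewrite -evM; congr ev; apply/funext => y; rewrite /peval mevalM.
elim: n c => [|n IH] c hc.
  exists 1, (fun=> 0); split; last by case.
  rewrite (_ : (fun _ => _) = fun=> 1) ?ev1 ?oner_neq0//.
  by apply/funext => y; rewrite /peval meval1.
have [Q [P [Q0 PQ]]] := IH (fun i => c (lift ord0 i)) (fun i => hc _).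
have [P0 [Q0' [Q0'0 e]]] := hc ord0.
exists (Q * Q0'), (fun i => if unlift ord0 i is Some j then P j * Q0' else P0 * Q).
rewrite evpM mulf_neq0//; split=> // i; case: (unliftP ord0 i) => [j|] ->.
  by rewrite evpM -PQ mulrA.
by rewrite e evpM; field.
Qed.

(** Otherwise [dx = 0, df = 1] would extend to a derivation of a field of germs,
    although [df] is a combination of the [dx]. *)
Lemma algebraic_over_coordinates d (x : 'I_d -> X -> k) p U0 U1 f :
  spans x p -> opn U0 -> U0 p -> (forall a, reg U0 (x a)) ->
  opn U1 -> U1 p -> reg U1 f -> (exists y, U1 y /\ f y != 0) ->
  exists n (P : 'I_n.+1 -> mpoly d k), P ord0 != 0 /\
    forall y, U0 y -> U1 y -> \sum_i peval (P i) (\row_a x a y) * f y ^+ i = 0.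
Proof.
move=> spx oU0 U0p rx oU1 U1p rf [y0 [U1y0 fy0]].
have [U [F [ev [uU BU evs evP [ev0 ev1 evD evM]]]]] :=
  @ultrapower_field X k _ generic_filter_proper.
have pU : ProperFilter U := ultra_proper.
have F0 := pchar_ev uU evP ev0 ev1 evD.
have [Uc [n [t [Ucp ct]]]] := laX.2 p.
have [V [c [oV Vp VU rc hc]]] := span_reg laX ct Ucp spx oU0 U0p rx oU1 U1p rf.
pose xr y : 'rV[k]_d := \row_a x a y.
pose pe (P : mpoly d k) := ev (fun y => peval P (xr y)).
have peM P Q : pe (P * Q) = pe P * pe Q.
  by rewrite -evM; congr ev; apply/funext => y; rewrite /peval mevalM.
have peD P Q : pe (P + Q) = pe P + pe Q.
  by rewrite -evD; congr ev; apply/funext => y; rewrite /peval mevalD.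
have peC a : pe (mpolyC d a) = ev (fun=> a).
  by congr ev; apply/funext => y; rewrite peval_cst.
have pe1 : pe 1 = 1 by rewrite -ev1 -peC.
have pe0 : pe 0 = 0 by rewrite -ev0 -peC mpolyC0.
have peN P : pe (- P) = - pe P.
  by apply/eqP; rewrite -addr_eq0 -peD addNr pe0.
(* The field [k(x)] generated by the classes of the coordinates. *)
pose E0 : set F := [set z | exists P Q, pe Q != 0 /\ z = pe P / pe Q].
have sE0 : subfield_set E0.
  split.
  - by exists 1, 1; rewrite pe1 oner_neq0 divr1.
  - move=> _ _ [P [Q [Q0 ->]]] [P' [Q' [Q'0 ->]]].
    exists (P * Q' - P' * Q), (Q * Q'); rewrite !(peM, peD, peN) mulf_neq0//.
    by split=> //; field; rewrite ?Q0 ?Q'0.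
  - move=> _ _ [P [Q [Q0 ->]]] [P' [Q' [Q'0 ->]]].
    exists (P * P'), (Q * Q'); rewrite !peM mulf_neq0//.
    by split=> //; field; rewrite ?Q0 ?Q'0.
  - move=> _ [P [Q [Q0 ->]]]; have [P0|P0] := eqVneq (pe P) 0.
      by exists 0, 1; rewrite pe1 oner_neq0 P0 pe0 !mul0r invr0.
    by exists Q, P; rewrite invf_div.
have dE0 : der_on E0 (fun=> 0) by split=> a b _ _; rewrite ?addr0 ?mulr0 ?addr0.
have E0c a : E0 (ev (fun=> a)).
  by exists (mpolyC d a), 1; rewrite pe1 oner_neq0 divr1 peC.
have E0x a : E0 (ev (x a)).
  exists (mpolyX k (mnm1 a)), 1; rewrite pe1 oner_neq0 divr1; split=> //.
  by congr ev; apply/funext => y; rewrite /peval mevalXU mxE.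
(* A regular function that is nonzero at one point is nonzero on a nonempty open set, hence has
   nonzero class. This also turns relations between classes back into identities of functions. *)
have nz g (W : set X) : opn W -> (exists y, W y /\ g y != 0) -> reg W g -> ev g != 0.
  move=> oW [y [Wy gy]] rg; apply/negP; rewrite -ev0 => /eqP/evP h.
  have : generic_filter [set y | W y /\ g y != 0].
    by exists [set y | W y /\ g y != 0]; split=> //; [exact: opn_neq0|exists y].
  move/BU => h'; have [z [/= gz [_]]] := filter_ex (filterI h h').
  by rewrite gz eqxx.
have evf0 : ev f != 0 by apply: (nz f U1) => //; exists y0.
have [tr|] := pselect (forall p, pover E0 p -> p.[ev f] = 0 -> p = 0).
  have [E1 [D1 [s1 i1 f1 d1 [e1 D1f]]]] := der_extend_transcendental 1 sE0 dE0 tr.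
  have [E2 [D2 [s2 i2 t2 d2 e2]]] := der_extend_fin F0 (fun i => ev (fun y => t y 0 i)) s1 d1.
  have UV : U V by apply: BU; exists V; split=> //; exists p.
  have E0D2 z : E0 z -> D2 z = 0 by move=> E0z; rewrite e2 ?e1//; exact: i1.
  have gd : @gderiv k X V F F^o [set 0] ev (fun f => D2 (ev f)) [set f | E2 (ev f)].
    apply: gderiv_field => //; last by move=> a; exact: E0D2.
    by move=> a; apply/i2/i1.
  have [_ _ /eqm0] := hc _ _ _ _ _ _ gd t2.
  rewrite e2// D1f big1 => [/eqP|a _]; first by rewrite oner_eq0.
  by rewrite E0D2// scaler0.
move=> /existsNP[q0 /not_implyP[hq0 /not_implyP[q0f q0n]]].
pose Q m := `[< exists p : {poly F}, [/\ pover E0 p, p.[ev f] = 0, p != 0 & size p = m] >].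
have exQ : exists m, Q m by exists (size q0); apply/asboolP; exists q0; split=> //; apply/eqP.
case: (ex_minnP exQ) => m /asboolP[q [hq qf qn sq]] minq.
(* The class of [f] is nonzero, so a factor ['X] could be cancelled from [q] against minimality.
   This is what makes [P ord0] nonzero. *)
have q00 : q`_0 != 0.
  apply/negP => /eqP q00.
  have qE : q = Poly (behead q) * 'X.
    by apply/polyP => -[|i]; rewrite coefMX//= coef_Poly nth_behead.
  have bf : (Poly (behead q)).[ev f] = 0.
    by move: qf; rewrite {1}qE hornerM hornerX => /eqP; rewrite mulf_eq0 (negPf evf0) orbF => /eqP.
  have bn : Poly (behead q) != 0 by apply: contraNneq qn => b0; rewrite qE b0 mul0r.
  have sqE : size q = (size (Poly (behead q))).+1 by rewrite {1}qE size_mulX.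
  have := minq (size (Poly (behead q))); rewrite leqNgt -sq sqE leqnn.
  move=> /(_ _)/negP; apply => //; apply/asboolP; exists (Poly (behead q)); split=> // i.
  by rewrite coef_Poly nth_behead.
have [m' sq'] : exists m', size q = m'.+1.
  by exists (size q).-1; rewrite prednK// lt0n size_poly_eq0.
have [R [P [R0 RP]]] := @common_denominator d xr F ev m'.+1 (fun i => q`_i) evM ev1
  (fun i => hq i).
exists m', P; split.
  apply: contraNneq q00 => P0; have := RP ord0; rewrite P0 /= -/(pe 0) pe0 => /eqP.
  by rewrite mulf_eq0 (negPf R0) orbF => /eqP ->.
have evsum I (r : seq I) (G : I -> X -> k) :
    ev (fun y => \sum_(i <- r) G i y) = \sum_(i <- r) ev (G i).
  elim: r => [|i r IH]; first by rewrite big_nil -ev0; congr ev; apply/funext => y; rewrite big_nil.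
  by rewrite big_cons -IH -evD; congr ev; apply/funext => y; rewrite big_cons.
have evX i : ev (fun y => f y ^+ i) = ev f ^+ i.
  elim: i => [|i IH]; first by rewrite expr0 -ev1.
  by rewrite exprS -IH -evM; congr ev; apply/funext => y; rewrite exprS.
pose g y := \sum_(i < m'.+1) peval (P i) (xr y) * f y ^+ i.
have evg : ev g = 0.
  rewrite evsum; under eq_bigr do rewrite evM evX -RP.
  transitivity (pe R * q.[ev f]); last by rewrite qf mulr0.
  rewrite horner_coef sq' mulr_sumr; apply: eq_bigr => i _.
  by rewrite -/(pe R); ring.
have oUU : opn (U0 `&` U1) by exact: opnI.
have rg : reg (U0 `&` U1) g.
  apply: reg_sum => // i _; apply: reg_mul => //.
    apply: reg_peval => // a.
    have := reg_sub aX oU0 oUU (@subIsetl _ _ _) (rx a).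
    by congr (reg _ _); apply/funext => y; rewrite mxE.
  by apply: reg_exp => //; exact: (reg_sub aX oU1 oUU (@subIsetr _ _ _)).
(* A value of [g] different from 0 would make its class nonzero, by [nz]. *)
move=> y U0y U1y; apply/eqP; rewrite -/(g y); apply/negPn/negP => gy.
have : ev g != 0 by apply: (nz g _ oUU) => //; exists y.
by rewrite evg eqxx.
Qed.

End OverK.
End Algebraic.

(** * Tangent vectors and coordinates at some point *)

Section Submersion.
Local Open Scope classical_set_scope.
Local Open Scope ring_scope.
Variable k : closedFieldType.

(** A tangent vector at [p], as a functional on all functions; its laws concern germs of regular
    functions only. *)
Definition point_deriv (X : fspace k) (p : X) (delta : (X -> k) -> k) : Prop :=
  [/\ forall c, delta (fun=> c) = 0,
      (forall f g, regat p f -> regat p g -> delta (fun x => f x + g x) = delta f + delta g),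
      (forall f g, regat p f -> regat p g ->
         delta (fun x => f x * g x) = f p * delta g + g p * delta f) &
      (forall V f g, opn V -> V p -> regat p f -> (forall x, V x -> f x = g x) ->
         delta f = delta g)].

Section Basis.
Variable X : fspace k.
Hypothesis laX : locally_affine X.
Let aX := laX.1.
Let gdp (p : X) := gderiv_pt laX (opnT aX) (I : (setT : set X) p).

Lemma regat_add p (f g : X -> k) : regat p f -> regat p g -> regat p (fun x => f x + g x).
Proof. exact: (gd_add (gdp p)). Qed.
Lemma regat_mul p (f g : X -> k) : regat p f -> regat p g -> regat p (fun x => f x * g x).
Proof. exact: (gd_mul (gdp p)). Qed.
Lemma regat_cst (p : X) (c : k) : regat p (fun _ : X => c).
Proof. exact: (gd_cst (gdp p)). Qed.

Lemma gradient_cst d (x : 'I_d -> X -> k) p c : cotangent_basis x p ->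
  gradient x p (fun=> c) = 0.
Proof.
move=> cx; apply: gradient_uniq => //; first exact: regat_cst.
apply/is_gradientE; rewrite big1 => [|a _]; last by rewrite mxE scale0r.
by rewrite /eqm subr0; exact: (gd_Dcst (gdp p)).
Qed.

Lemma gradient_add d (x : 'I_d -> X -> k) p f g : cotangent_basis x p ->
  regat p f -> regat p g ->
  gradient x p (fun y => f y + g y) = gradient x p f + gradient x p g.
Proof.
move=> cx rf rg; apply: gradient_uniq => //; first exact: regat_add.
have /is_gradientE hf := gradientP cx rf; have /is_gradientE hg := gradientP cx rg.
apply/is_gradientE; under eq_bigr do rewrite mxE scalerDl.
rewrite big_split /=; apply: (eqm_trans (gdp p)); first exact: (gd_Dadd (gdp p)).
exact: (eqm_add (gdp p)).
Qed.

Lemma gradient_mul d (x : 'I_d -> X -> k) p f g : cotangent_basis x p ->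
  regat p f -> regat p g ->
  gradient x p (fun y => f y * g y) = f p *: gradient x p g + g p *: gradient x p f.
Proof.
move=> cx rf rg; apply: gradient_uniq => //; first exact: regat_mul.
have /is_gradientE hf := gradientP cx rf; have /is_gradientE hg := gradientP cx rg.
apply/is_gradientE; under eq_bigr do rewrite !mxE scalerDl -!scalerA.
rewrite big_split /= -!scaler_sumr; apply: (eqm_trans (gdp p)); first exact: (gd_Dmul (gdp p)).
by apply: (eqm_add (gdp p)); exact: (eqm_scale (gdp p)).
Qed.

Lemma point_deriv_gradient d (x : 'I_d -> X -> k) p (w : 'I_d -> k) : cotangent_basis x p ->
  point_deriv p (fun f => \sum_a w a * gradient x p f 0 a).
Proof.
move=> cx; split.
- by move=> c; rewrite gradient_cst//; apply: big1 => a _; rewrite mxE mulr0.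
- move=> f g rf rg; rewrite gradient_add// -big_split; apply: eq_bigr => a _ /=.
  by rewrite mxE mulrDr.
- move=> f g rf rg; rewrite gradient_mul// !mulr_sumr -big_split; apply: eq_bigr => a _ /=.
  by rewrite !mxE; ring.
- by move=> V f g oV Vp rf fg; rewrite (gradient_eq laX cx rf oV Vp fg).
Qed.

(** If two gradients of one function differ in the entry [a0], their difference expresses [dx_a0]
    through the other differentials, and dropping [x a0] leaves a smaller spanning family. *)
Lemma minimal_spans_basis d (x : 'I_d -> X -> k) p :
  (forall e (y : 'I_e -> X -> k) , (forall a, regat p (y a)) -> spans y p -> (d <= e)%N) ->
  (forall a, regat p (x a)) -> spans x p -> cotangent_basis x p.
Proof.
move=> mind rx spx V f oV Vp rf; have [c hc] := spx _ _ oV Vp rf; exists c; split=> // c' hc'.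
apply/eqP; apply: contraT => cc'; have [a0 ca0] : exists a0, c 0 a0 != c' 0 a0.
  apply/existsP; apply: contraNT cc' => /existsPn h; apply/eqP/rowP => a.
  by apply/eqP; rewrite eq_sym; have := h a; rewrite negbK eq_sym.
case: d x c c' a0 mind rx spx hc hc' ca0 {cc'} => [|d] x c c' a0 mind rx spx hc hc' ca0.
  by case: a0 ca0.
pose y b := x (lift a0 b).
have : (d.+1 <= d)%N; last by rewrite ltnn.
apply: (mind _ y) => [b|]; first exact: rx.
have gd := gdp p; pose dx a : X -> k^o := fun z => x a z - x a p.
have rel : @eqm k (X -> k^o) (in_msquare p) (dx a0)
    (\sum_b (- (c 0 (lift a0 b) - c' 0 (lift a0 b)) / (c 0 a0 - c' 0 a0)) *: dx (lift a0 b)).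
  have cc0 : c 0 a0 - c' 0 a0 != 0 by rewrite subr_eq0.
  have /is_gradientE h := hc; have /is_gradientE h' := hc'.
  have := eqm_trans gd (eqm_sym gd h) h'.
  rewrite /eqm -sumrB (bigD1_ord a0)//= -scalerBl.
  under eq_bigr do rewrite -scalerBl.
  move=> /(gdZ gd (c 0 a0 - c' 0 a0)^-1); rewrite scalerDr scalerA mulVf// scale1r.
  congr (in_msquare p _); congr (_ + _); rewrite -sumrN scaler_sumr; apply: eq_bigr => b _.
  rewrite scalerA -scaleNr.
  have -> // : (c 0 a0 - c' 0 a0)^-1 * (c 0 (lift a0 b) - c' 0 (lift a0 b)) =
      - (- (c 0 (lift a0 b) - c' 0 (lift a0 b)) / (c 0 a0 - c' 0 a0)) by field.
move=> W g oW Wp rg; have [e he] := spx _ _ oW Wp rg.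
exists (e *m \matrix_(a, b) (if unlift a0 a is Some b' then (b' == b)%:R
   else - (c 0 (lift a0 b) - c' 0 (lift a0 b)) / (c 0 a0 - c' 0 a0))).
apply: (is_gradient_trans laX he) => a; apply/is_gradientE.
case: (unliftP a0 a) => [b0|] ->.
  rewrite (bigD1 b0)//= big1 ?addr0 => [|b bb0].
    by rewrite !mxE liftK eqxx scale1r; exact: (eqm_refl gd).
  by rewrite !mxE liftK eq_sym (negPf bb0) scale0r.
by under eq_bigr do rewrite !mxE unlift_none; exact: rel.
Qed.

(** The minimal size of a spanning family is attained somewhere, and then remains
    minimal nearby. *)
Lemma generic_coordinates (p0 : X) : exists p d (x : 'I_d -> X -> k) U,
  U p /\ local_coordinates U x.
Proof.
pose Q d := `[< exists p (x : 'I_d -> X -> k) U,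
  [/\ opn U, U p, (forall a, reg U (x a)) & spans x p] >].
have exQ : exists d, Q d.
  have [U [n [t [Up ct]]]] := laX.2 p0; have [oU _ _] := ct.
  exists n; apply/asboolP; exists p0, (fun i y => t y 0 i), U; split=> //.
    by move=> a; exact: (chart_reg ct).
  move=> V f oV Vp rf; have [V' [r [oV' V'p VU' rr hr]]] := reg_D laX ct Up oV Vp rf.
  have St i : regat p0 (fun x => t x 0 i) by exists U; split=> //; exact: (chart_reg ct).
  have [_ Df] := hr _ _ _ _ _ _ (gderiv_pt laX oV' V'p) St.
  by exists (\row_i r i p0); apply/is_gradientE; under eq_bigr do rewrite mxE.
case: (ex_minnP exQ) => d /asboolP[p [x [U [oU Up rx spx]]]] mind.
have [V [oV Vp VU sV]] := spans_open laX spx oU Up rx.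
exists p, d, x, V; split=> //; split=> // [a|q Vq]; first exact: (reg_sub aX oU oV).
apply: minimal_spans_basis (sV _ Vq) => [e y ry spy|a]; last first.
  by exists V; split=> //; exact: (reg_sub aX oU oV).
apply: mind; apply/asboolP.
have /choice[W hW] := ry.
exists q, y, [set z | forall a, W a z].
have oW : opn [set z | forall a, W a z] by apply: opn_fin => // a; have [] := hW a.
split=> // a; have [oWa Wq rW] := hW a; first by [].
by apply: (reg_sub aX oWa oW _ rW) => z; exact.
Qed.

End Basis.
End Submersion.

(** * Lifting tangent vectors along an open morphism *)

Section GenericSubmersion.
Local Open Scope classical_set_scope.
Local Open Scope ring_scope.
Variables (k : closedFieldType).
Hypothesis char0 : [pchar k] =i pred0.
Variables (G X : fspace k) (pi : G -> X) (n : nat).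
Hypotheses (laG : locally_affine G) (laX : locally_affine X).
Hypothesis irrX : irreducible_set (setT : set X).
Hypothesis smX : smooth_dim X n.
Hypothesis mpi : morphism pi.
Hypothesis open_pi : forall N : set G, opn N -> opn (pi @` N).
Let aG := laG.1.
Let aX := laX.1.

(** In characteristic zero the derivations [d/dy_b] of [k(X)] extend to a field
    containing [k(X)] and the germs of functions on [G]; evaluating them at a general
    point gives tangent vectors of [G] lifting those of [X]. *)
Lemma generic_submersion (g0 : G) :
  exists (h : G) (V : set X) (y : 'I_n -> X -> k) (delta : 'I_n -> (G -> k) -> k),
    [/\ V (pi h), local_coordinates V y, (forall b, point_deriv h (delta b)) &
      forall b c, delta b (y c \o pi) = (b == c)%:R].
Proof.
have [h0 [d [x [U0 [U0h0 lcx]]]]] := generic_coordinates laG g0.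
have [oU0 rx cbx] := lcx.
have [V [y [Vh0 lcy]]] := smooth_local_coordinates laX smX (pi h0).
have [oV ry cby] := lcy.
have [Uc [m [t [Uch0 ct]]]] := laG.2 h0.
have oV' := (mpi oV).1.
have ryp c := (mpi oV).2 _ (ry c).
have spx := cotangent_basis_spans (cbx _ U0h0).
have /choice[W] := fun c => span_reg laG ct Uch0 spx oU0 U0h0 rx oV' Vh0 (ryp c).
move=> /choice[co hco].
pose W0 : set G := [set h | forall c, W c h] `&` (Uc `&` (U0 `&` (pi @^-1` V))).
have oUc : opn Uc by case: ct.
have oW0 : opn W0.
  apply: opnI => //; first by apply: opn_fin => // c; have [] := hco c.
  by do !apply: opnI => //.
have W0h0 : W0 h0 by split; [move=> c; have [] := hco c|].
(* Germs at [h0], on which moreover every nonzero rational function of [X] is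
   invertible: [k(X)] embeds in the field of classes modulo an ultrafilter. *)
pose B : set_system G := [set A | exists N V', [/\ opn N, N h0, opn V', V' !=set0 &
   N `&` pi @^-1` V' `<=` A]].
have pB : ProperFilter B.
  split.
    case=> N [V' [oO Oh0 oV'' V'0 hO]].
    have [z [[g Og <-] V'z]] := irr_meet irrX (open_pi oO) oV'' (ex_intro _ _ (imageP pi Oh0)) V'0.
    exact: (hO g).
  split.
  - exists setT, setT; split=> //; try exact: opnT.
    by exists (pi h0).
  - move=> A A' [N [V1 [oO Oh oV1 V10 h]]] [N' [V1' [oO' Oh' oV1' V10' h']]].
    exists (N `&` N'), (V1 `&` V1'); split=> //; try exact: opnI.
      exact: irr_meet.
    by move=> g [[Og N'g] [V1g V1'g]]; split; [exact: h|exact: h'].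
  - move=> A A' AA' [N [V1 [oO Oh oV1 V10 h]]]; exists N, V1; split=> //; exact: (subset_trans h).
have [U [F [ev [uU BU evs evP [ev0 ev1 evD evM]]]]] := @ultrapower_field G k B pB.
have pU : ProperFilter U := ultra_proper.
have F0 := pchar_ev char0 uU evP ev0 ev1 evD.
have UW0 : U W0.
  apply: BU; exists W0, setT; split=> //; [exact: opnT|by exists (pi h0)].
have Ugen V1 : opn V1 -> V1 !=set0 -> U (pi @^-1` V1).
  by move=> oV1 V10; apply: BU; exists setT, V1; split=> //; exact: opnT.
(* The image of [k(X)] in [F], pulled back along [pi]. *)
pose E : set F := [set z | exists f V1, [/\ opn V1, V1 !=set0, reg V1 f & z = ev (f \o pi)]].
have E2 (f f' : X -> k) (V1 V1' : set X) : opn V1 -> V1 !=set0 -> reg V1 f ->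
    opn V1' -> V1' !=set0 -> reg V1' f' ->
    [/\ opn (V1 `&` V1'), V1 `&` V1' !=set0, reg (V1 `&` V1') f & reg (V1 `&` V1') f'].
  move=> oV1 V10 rf oV1' V10' rf'; have oVV : opn (V1 `&` V1') by exact: opnI.
  split=> //; first exact: irr_meet.
    exact: (reg_sub aX oV1 oVV (@subIsetl _ _ _)).
  exact: (reg_sub aX oV1' oVV (@subIsetr _ _ _)).
have evN f : ev (fun x => - f x) = - ev f.
  apply/eqP; rewrite -addr_eq0 -evD -ev0; apply/eqP; congr ev.
  by apply/funext => g; rewrite addNr.
have sE : subfield_set E.
  split.
  - exists (fun=> 1), setT; split=> //; [exact: opnT|by exists (pi h0)|].
    by apply: reg_cst => //; exact: opnT.
  - move=> _ _ [f [V1 [oV1 V10 rf ->]]] [f' [V1' [oV1' V10' rf' ->]]].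
    have [oVV VV0 r r'] := E2 _ _ _ _ oV1 V10 rf oV1' V10' rf'.
    exists (fun x => f x - f' x), (V1 `&` V1'); split=> //; first exact: reg_subr.
    by rewrite -evN -evD.
  - move=> _ _ [f [V1 [oV1 V10 rf ->]]] [f' [V1' [oV1' V10' rf' ->]]].
    have [oVV VV0 r r'] := E2 _ _ _ _ oV1 V10 rf oV1' V10' rf'.
    exists (fun x => f x * f' x), (V1 `&` V1'); split=> //; first exact: reg_mul.
    by rewrite -evM.
  - move=> _ [f [V1 [oV1 V10 rf ->]]].
    have [/existsNP[z /not_implyP[V1z /eqP fz]]|fz0] := pselect (~ forall z, V1 z -> f z = 0).
      have oV1' := opn_neq0 laX oV1 rf; set V1' := [set _ | _] in oV1'.
      have V1'0 : V1' !=set0 by exists z.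
      exists (fun x => (f x)^-1), V1'; split=> //.
        apply: reg_inv => //; last by move=> w [].
        by apply: (reg_sub aX oV1 oV1') => // w [].
      have e : ev (f \o pi) * ev (fun x => (f (pi x))^-1) = 1.
        rewrite -evM -ev1; apply/evP; apply: filterS (Ugen _ oV1' V1'0) => g [_ fg] /=.
        by rewrite divff.
      have ef : ev (f \o pi) != 0 by apply: contra_eqN e => /eqP ->; rewrite mul0r eq_sym oner_neq0.
      by rewrite -[LHS]mulr1 -e mulKf.
    have e : ev (f \o pi) = 0.
      rewrite -ev0; apply/evP; apply: filterS (Ugen _ oV1 V10) => g V1g /=.
      by have /contrapT -> := fz0.
    by exists f, V1; split=> //; rewrite e invr0.
(* Injectivity of [k(X) -> F]: a difference that is nonzero somewhere is nonzero on an open set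
   belonging to [U] after pullback. It makes [dE] independent of the chosen representative. *)
have evinj (f f' : X -> k) (V1 : set X) : opn V1 -> V1 !=set0 -> reg V1 f -> reg V1 f' ->
    ev (f \o pi) = ev (f' \o pi) ->
    forall z, V1 z -> f z = f' z.
  move=> oV1 V10 rf rf' /evP h z V1z; apply/eqP; rewrite -subr_eq0; apply/negPn/negP => fz.
  have rff : reg V1 (fun x => f x - f' x) by exact: reg_subr.
  have oN := opn_neq0 laX oV1 rff.
  have M0 : [set x | V1 x /\ f x - f' x != 0] !=set0 by exists z.
  have [g [/= e [_]]] := filter_ex (filterI h (Ugen _ oN M0)).
  by rewrite e subrr eqxx.
have rat (z : X) (f : X -> k) (V1 : set X) : opn V1 -> V1 z -> reg V1 f -> regat z f by move=> *; exists V1.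
have V0 : V !=set0 by exists (pi h0).
pose dE b z := ev (fun g => gradient y (pi g)
   (xget (fun=> 0) [set f | exists V1, [/\ opn V1, V1 !=set0, reg V1 f & z = ev (f \o pi)]]) 0 b).
have dEE b f V1 : opn V1 -> V1 !=set0 -> reg V1 f ->
    dE b (ev (f \o pi)) = ev (fun g => gradient y (pi g) f 0 b).
  move=> oV1 V10 rf; rewrite /dE; case: xgetP => [f' _ [V1' [oV1' V10' rf' e]]|/(_ f)[]]; last by exists V1.
  have [oVV VV0 r r'] := E2 _ _ _ _ oV1 V10 rf oV1' V10' rf'.
  have ff' := evinj _ _ _ oVV VV0 r r' e.
  apply/evP; apply: filterS (filterI (Ugen _ oV V0) (Ugen _ oVV VV0)) => g [Vg VVg] /=.
  by rewrite (gradient_eq laX (cby _ Vg) (rat _ _ _ oVV VVg r) oVV VVg ff').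
have dd b : der_on E (dE b).
  split=> _ _ [f [V1 [oV1 V10 rf ->]]] [f' [V1' [oV1' V10' rf' ->]]];
    have [oVV VV0 r r'] := E2 _ _ _ _ oV1 V10 rf oV1' V10' rf'.
    rewrite -evD (dEE b (fun x => f x + f' x) _ oVV VV0 (reg_add laX oVV r r')).
    rewrite !(dEE b _ _ oVV VV0)// -evD; apply/evP.
    apply: filterS (filterI (Ugen _ oV V0) (Ugen _ oVV VV0)) => g [Vg VVg] /=.
    rewrite (gradient_add laX (cby _ Vg)) ?mxE//; exact: (rat _ _ _ oVV VVg).
  rewrite -evM (dEE b (fun x => f x * f' x) _ oVV VV0 (reg_mul laX oVV r r')).
  rewrite !(dEE b _ _ oVV VV0)// -!evM -evD; apply/evP.
  apply: filterS (filterI (Ugen _ oV V0) (Ugen _ oVV VV0)) => g [Vg VVg] /=.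
  rewrite (gradient_mul laX (cby _ Vg)) ?mxE//; exact: (rat _ _ _ oVV VVg).
have T0 : (setT : set X) !=set0 by exists (pi h0).
have Ec a : E (ev (fun=> a)).
  by exists (fun=> a), setT; split=> //; [exact: opnT|apply: reg_cst => //; exact: opnT].
have dc b a : dE b (ev (fun=> a)) = 0.
  rewrite (dEE b (fun=> a) _ (opnT aX) T0 (reg_cst laX a (opnT aX))) -ev0; apply/evP.
  apply: filterS (Ugen _ oV V0) => g Vg /=.
  by rewrite (gradient_cst laX _ (cby _ Vg)) mxE.
have dy b c : dE b (ev (y c \o pi)) = ev (fun=> (b == c)%:R).
  rewrite (dEE b _ _ oV V0 (ry c)); apply/evP; apply: filterS (Ugen _ oV V0) => g Vg /=.
  by rewrite (gradient_coord laX (cby _ Vg) (rat _ _ _ oV Vg (ry c))) !mxE eqxx.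
have /choice[E' /choice[dE' hE']] := fun b => der_extend_fin F0 (fun i => ev (fun z => t z 0 i)) sE (dd b).
(* The function [tau (b, a)] represents the value of the extended [d/dy_b] on [x_a]; its value at a
   point will be the [a]-th component of the lifted tangent vector. *)
have /choice[tau htau] : forall ba : 'I_n * 'I_d, exists f, dE' ba.1 (ev (x ba.2)) = ev f.
  by move=> ba; exact: evs.
have key b c : ev (fun=> (b == c)%:R) = ev (fun g => \sum_a co c g 0 a * tau (b, a) g).
  have [sE' EE' tE' d' e'] := hE' b.
  have [_ _ _ _ hc] := hco c.
  have gd : @gderiv k G (W c) F F^o [set 0] ev (fun f => dE' b (ev f)) [set f | E' b (ev f)].
    apply: (gderiv_sub (V' := W0)); first by move=> g [].
    apply: gderiv_field => //; first by move=> a; exact: EE'.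
    by move=> a; rewrite e'.
  have [_ _ /eqm0] := hc _ _ _ _ _ _ gd tE'.
  rewrite e'; last by exists (y c), V.
  rewrite dy => ->; rewrite (ev_sum gd); apply: eq_bigr => a _.
  by rewrite evM (htau (b, a)).
(* The finitely many equalities [key] between classes hold together on a member of [U], so at some
   actual point [h] of [W0]. *)
have /filter_ex[h [W0h hk]] : U (W0 `&` [set g | forall bc : 'I_n * 'I_n,
     (bc.1 == bc.2)%:R = \sum_a co bc.2 g 0 a * tau (bc.1, a) g]).
  apply: filterI => //; apply: filter_forall => -[b c] /=.
  exact/evP/key.
have [hW [Uch [U0h Vh]]] := W0h.
exists h, V, y, (fun b f => \sum_a tau (b, a) h * gradient x h f 0 a); split=> //.
  by move=> b; exact: (point_deriv_gradient laG (fun a => tau (b, a) h) (cbx _ U0h)).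
move=> b c; rewrite (hk (b, c)) /=; apply: eq_bigr => a _; rewrite mulrC; congr (_ * _).
have [oWc _ WU _ hc] := hco c.
have St i : regat h (fun z => t z 0 i) by exists Uc; split=> //; exact: (chart_reg ct).
have [_ _ hg] := hc _ _ _ _ _ _ (gderiv_pt laG oWc (hW c)) St.
rewrite (@gradient_uniq _ _ _ x h _ (co c h)) //; first exact: cbx.
  by exists (pi @^-1` V).
by apply/is_gradientE.
Qed.

End GenericSubmersion.

(** * Vector fields of the group *)

Section PointDerivations.
Local Open Scope classical_set_scope.
Local Open Scope ring_scope.
Variable k : closedFieldType.
Implicit Types X Y : fspace k.

Lemma gderiv_point X (p : X) (V : set X) delta : locally_affine X -> opn V -> V p ->
  point_deriv p delta ->
  @gderiv k X V k k^o [set 0] (fun f => f p) delta (regat p).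
Proof.
move=> laX oV Vp [dc dD dM dE]; have gd := gderiv_pt laX oV Vp.
have null0 (a : k^o) : a = 0 -> [set 0] a by [].
split=> //.
- by move=> a b -> ->; rewrite /= subrr.
- by move=> c a ->; rewrite /= scaler0.
- exact: (gd_cst gd).
- exact: (gd_add gd).
- by move=> f g rf rg; apply: null0; rewrite dD// subrr.
- exact: (gd_mul gd).
- by move=> f g rf rg; apply: null0; rewrite dM// subrr.
- exact: (gd_inv gd).
- move=> f g rf fg; have [rg _ e] := gd_ext gd rf fg; split=> //; apply: null0.
  by rewrite (dE V f g)// subrr.
Qed.

Lemma morphism_regat X Y (phi : X -> Y) p f : morphism phi -> regat (phi p) f -> regat p (f \o phi).
Proof.
move=> mphi [V [oV Vp rf]]; exists (phi @^-1` V); split=> //; first exact: (mphi _ oV).1.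
exact: (mphi _ oV).2.
Qed.

Lemma morphism_comp X Y (Z : fspace k) (phi : X -> Y) (psi : Y -> Z) :
  morphism phi -> morphism psi -> morphism (psi \o phi).
Proof.
move=> mphi mpsi V oV; have [oV' rV'] := mpsi _ oV; have [oV'' rV''] := mphi _ oV'.
by split=> // f rf; exact: (rV'' _ (rV' _ rf)).
Qed.

Lemma point_deriv_push X Y (phi : X -> Y) p delta : morphism phi ->
  point_deriv p delta -> point_deriv (phi p) (fun f => delta (f \o phi)).
Proof.
move=> mphi [dc dD dM dE]; split=> //.
- by move=> f g rf rg; apply: (dD (f \o phi) (g \o phi)); exact: morphism_regat.
- by move=> f g rf rg; apply: (dM (f \o phi) (g \o phi)); exact: morphism_regat.
- move=> V f g oV Vp rf fg; apply: (dE (phi @^-1` V)) => //.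
  + exact: (mphi _ oV).1.
  + exact: morphism_regat.
  + by move=> x Vx; exact: fg.
Qed.

Lemma point_deriv_chain X d (y : 'I_d -> X -> k) p delta f : locally_affine X ->
  cotangent_basis y p -> (forall b, regat p (y b)) -> regat p f -> point_deriv p delta ->
  delta f = \sum_b gradient y p f 0 b * delta (y b).
Proof.
move=> laX cy ry rf pd; have aX := laX.1.
have [U [m [a [b [oU Up ra rb fab]]]]] := gradientP cy rf; set c := gradient y p f in fab *.
have gd := gderiv_point laX oU Up pd.
have Sab l : regat p (fun x => a l x * b l x).
  by apply: (regat_mul laX); exists U; split=> //; [have [] := ra l|have [] := rb l].
have Sc l : regat p (fun x => c 0 l * y l x) by apply: (regat_mul laX) => //; exact: (regat_cst laX).
pose g1 x := \sum_l a l x * b l x; pose g2 x := \sum_l c 0 l * y l x.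
have [S1 /eqm0 D1] := D_sum gd (index_enum 'I_m) (P := xpredT) (fun l _ => Sab l).
have [S2 /eqm0 D2] := D_sum gd (index_enum 'I_d) (P := xpredT) (fun l _ => Sc l).
pose c0 := f p - g2 p.
have Sg : regat p (fun x => g1 x + g2 x) by exact: (regat_add laX).
have e x : U x -> f x = (g1 x + g2 x) + c0.
  move=> Ux; rewrite /g1 -fab// /c0 /g2.
  have -> : \sum_(i < d) c 0 i * (y i x - y i p) = \sum_i c 0 i * y i x - \sum_i c 0 i * y i p.
    by rewrite -sumrB; apply: eq_bigr => i _; rewrite mulrBr.
  by ring.
have [dc dD dM dE] := pd.
rewrite (dE U f (fun x => (g1 x + g2 x) + c0))// dD//; last exact: (regat_cst laX).
rewrite dc addr0 dD//.
have -> : delta g1 = 0.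
  rewrite [LHS]D1; apply: big1 => l _; rewrite dM; last 2 first.
  - by exists U; split=> //; have [] := ra l.
  - by exists U; split=> //; have [] := rb l.
  by rewrite (ra l).2 (rb l).2 !mul0r addr0.
rewrite add0r [LHS]D2; apply: eq_bigr => l _; rewrite dM//; last exact: (regat_cst laX).
by rewrite dc mulr0 addr0.
Qed.

Lemma slice_morphism X Y (y0 : Y) : locally_affine X ->
  @morphism k X (Defs.fprod X Y) (fun x => (x, y0)).
Proof.
move=> laX; have aX := laX.1.
have breg (U : set X) (V : set Y) m (f : 'I_m -> X -> k) (g : 'I_m -> Y -> k) h :
    opn U -> (forall i, reg U (f i)) -> (forall z, h z = \sum_(i < m) f i z.1 * g i z.2) ->
    reg U (fun x => h (x, y0)).
  move=> oU rf hE.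
  have -> : (fun x => h (x, y0)) = (fun x => \sum_i f i x * g i y0).
    by apply/funext => x; rewrite hE.
  by apply: reg_sum => // i _; apply: reg_mul => //; exact: reg_cst.
move=> W oW; have oW' : opn ((fun x : X => (x, y0)) @^-1` W).
  apply: opn_nbhd => // x Wx.
  have [U [V [h [[oU oV [m [f [g [rf rg hE]]]]] [Ux Vy hx] hW]]]] := oW _ Wx.
  exists [set x | U x /\ h (x, y0) != 0]; split=> //.
    by apply: opn_neq0 => //; exact: breg hE.
  by move=> x' [Ux' hx']; apply: hW.
split=> // F rF; apply: reg_local_eq => // x Wx.
have [U [V [h' [h [[oU oV [m [f [g [rf rg hE]]]]] [_ _ [m' [f' [g' [rf' rg' hE']]]]] [Ux Vy hx] hF]]]]] := rF _ Wx.
have oN := opn_neq0 laX oU (breg _ V _ _ _ _ oU rf' hE').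
exists [set x | U x /\ h (x, y0) != 0], (fun x => h' (x, y0) / h (x, y0)); split=> //.
  have UU : [set x | U x /\ h (x, y0) != 0] `<=` U by move=> z [].
  apply: reg_mul => //; first by apply: (reg_sub aX oU oN UU); exact: (breg _ V _ _ _ _ oU rf hE).
  apply: reg_inv => //; last by move=> z [].
  by apply: (reg_sub aX oU oN UU); exact: (breg _ V _ _ _ _ oU rf' hE').
by move=> z [Uz hz] Wz; exact: hF.
Qed.

Lemma slice_morphism2 X Y (x0 : X) : locally_affine Y ->
  @morphism k Y (Defs.fprod X Y) (fun y => (x0, y)).
Proof.
move=> laY; have aY := laY.1.
have breg (V : set Y) m (f : 'I_m -> X -> k) (g : 'I_m -> Y -> k) h :
    opn V -> (forall i, reg V (g i)) -> (forall z, h z = \sum_(i < m) f i z.1 * g i z.2) ->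
    reg V (fun y => h (x0, y)).
  move=> oV rg hE.
  have -> : (fun y => h (x0, y)) = (fun y => \sum_i f i x0 * g i y).
    by apply/funext => x; rewrite hE.
  by apply: reg_sum => // i _; apply: reg_mul => //; exact: reg_cst.
move=> W oW; have oW' : opn ((fun y : Y => (x0, y)) @^-1` W).
  apply: opn_nbhd => // y Wy.
  have [U [V [h [[oU oV [m [f [g [rf rg hE]]]]] [Ux Vy hx] hW]]]] := oW _ Wy.
  exists [set y | V y /\ h (x0, y) != 0]; split=> //.
    by apply: opn_neq0 => //; exact: breg hE.
  by move=> x' [Ux' hx']; apply: hW.
split=> // F rF; apply: reg_local_eq => // y Wy.
have [U [V [h' [h [[oU oV [m [f [g [rf rg hE]]]]] [_ _ [m' [f' [g' [rf' rg' hE']]]]] [Ux Vy hx] hF]]]]] := rF _ Wy.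
have oN := opn_neq0 laY oV (breg _ _ _ _ _ oV rg' hE').
exists [set y | V y /\ h (x0, y) != 0], (fun y => h' (x0, y) / h (x0, y)); split=> //.
  have UU : [set y | V y /\ h (x0, y) != 0] `<=` V by move=> z [].
  apply: reg_mul => //; first by apply: (reg_sub aY oV oN UU); exact: (breg _ _ _ _ _ oV rg hE).
  apply: reg_inv => //; last by move=> z [].
  by apply: (reg_sub aY oV oN UU); exact: (breg _ _ _ _ _ oV rg' hE').
by move=> z [Uz hz] Wz; exact: hF.
Qed.

End PointDerivations.

(** * The right action of the group and its vector fields *)

Section Action.
Local Open Scope classical_set_scope.
Local Open Scope ring_scope.
Variables (k : closedFieldType).
Variables (X : fspace k) (G : fgroup k) (P : set G) (pi : fg_space G -> X).
Hypothesis lagG : linear_algebraic_group G.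
Hypothesis qpi : @quotient_map k G P X pi.
Let laG : locally_affine (fg_space G). Proof. by case: lagG => /affine_locally_affine. Qed.
Let aG := laG.1.

Lemma lmul_morphism (a : G) : @morphism k (fg_space G) (fg_space G) (fun g => (a * g : G)%g).
Proof.
have [_ mm _] := lagG.
exact: (morphism_comp (slice_morphism2 (X := fg_space G) a laG) mm).
Qed.

Lemma rmul_morphism (a : G) : @morphism k (fg_space G) (fg_space G) (fun g => (g * a : G)%g).
Proof.
have [_ mm _] := lagG.
exact: (morphism_comp (slice_morphism (Y := fg_space G) a laG) mm).
Qed.

Lemma pi_morphism : morphism pi.
Proof.
have [_ _ qo qr] := qpi; move=> V oV; split; first exact/qo.
by move=> f rf; apply/(qr V f oV).
Qed.

(** The preimage of [pi W] is the union of the left translates of [W] by elements of [P]; the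
    translation by [w * g^-1] gives the neighbourhood of [g]. *)
Lemma pi_open (W : set (fg_space G)) : opn W -> opn (pi @` W).
Proof.
move=> oW; have [_ qe qo _] := qpi; apply/qo.
apply: opn_nbhd => // g [w Ww e].
exists ((fun h : fg_space G => ((w * g^-1) * h : G)%g) @^-1` W); split.
- exact: (lmul_morphism _ oW).1.
- by rewrite /preimage /= mulgVK.
- move=> h /= Wh; exists ((w * g^-1) * h : G)%g => //.
  by apply/qe; rewrite mulgK; exact/qe.
Qed.

Definition act (x : X) (g : G) : X := pi ((xget 1%g [set h | pi h = x] : G) * g)%g.

Lemma act_pi (h g : G) : act (pi h) g = pi (h * g : G)%g.
Proof.
rewrite /act; have [_ qe _ _] := qpi; apply/qe.
case: xgetP => [h' _ /= /qe hh'|/(_ h)/(_ erefl)[]].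
by rewrite invgM -!mulgA mulVKg ?mulgA.
Qed.

Lemma act1 x : act x 1%g = x.
Proof. by have [/(_ x)[h <-] _ _ _] := qpi; rewrite act_pi mulg1. Qed.

Lemma actM x g h : act (act x g) h = act x (g * h)%g.
Proof. by have [/(_ x)[a <-] _ _ _] := qpi; rewrite !act_pi mulgA. Qed.

Lemma act_morphism g : morphism (act^~ g).
Proof.
have [_ _ qo qr] := qpi; move=> V oV.
have pE : pi @^-1` (act^~ g @^-1` V) = (fun h : fg_space G => (h * g : G)%g) @^-1` (pi @^-1` V).
  by apply/seteqP; split=> h /=; rewrite act_pi.
have oV' : opn (act^~ g @^-1` V).
  by apply/qo; rewrite pE; exact: (rmul_morphism g (pi_morphism oV).1).1.
split=> // f rf; apply/(qr _ _ oV'); rewrite pE.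
have -> : (f \o act^~ g) \o pi = (f \o pi) \o (fun h : fg_space G => (h * g : G)%g).
  by apply/funext => h /=; rewrite act_pi.
exact: (rmul_morphism g (pi_morphism oV).1).2 _ ((pi_morphism oV).2 _ rf).
Qed.

Lemma orbit_morphism x : @morphism k (fg_space G) X (act x).
Proof.
have [/(_ x)[h <-] _ _ _] := qpi.
have -> : act (pi h) = pi \o (fun g => (h * g : G)%g) by apply/funext => g; rewrite act_pi.
exact: morphism_comp (lmul_morphism h) pi_morphism.
Qed.

(** The fundamental vector field of the tangent vector [delta] at [1]: the derivative of the orbit
    map. *)
Definition vf (delta : (fg_space G -> k) -> k) (f : X -> k) : X -> k :=
  fun x => delta (fun g => f (act x g)).

Lemma vf_point delta x : @point_deriv k (fg_space G) 1%g delta ->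
  point_deriv x (fun f => vf delta f x).
Proof.
move=> pd; have := point_deriv_push (orbit_morphism x) pd; rewrite act1; exact.
Qed.

(** By the quotient sheaf it suffices to work on the group. There [f (pi (h * g))] is a regular
    function of the pair, locally a quotient of sums of products of functions of [h] and of [g];
    differentiating the factors in [g] leaves regular functions of [h]. *)
Lemma vf_reg delta V f : @point_deriv k (fg_space G) 1%g delta ->
  opn V -> reg V f -> reg V (vf delta f).
Proof.
move=> pd oV rf; have [_ _ qo qr] := qpi; apply/(qr _ _ oV).
have [_ mm _] := lagG.
have oV' := (pi_morphism oV).1; have [oW rW] := mm _ oV'.
have rfm := rW _ ((pi_morphism oV).2 _ rf).
apply: reg_local_eq => // h0 Vh0.
have Wh : V (pi (h0 * 1 : G)%g) by rewrite mulg1.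
have [U [U' [h' [h [[oU oU' [m [a [b [ra rb hE]]]]] [_ _ [m' [a' [b' [ra' rb' hE']]]]] [Uh0 U'1 hx] hF]]]]] :=
  rfm (h0, 1%g) Wh.
have rho (q : nat) (c : 'I_q -> fg_space G -> k) (w : 'I_q -> k) :
    (forall i, reg U (c i)) -> reg U (fun x => \sum_i c i x * w i).
  by move=> rc; apply: reg_sum => // i _; apply: reg_mul => //; exact: reg_cst.
pose dn x := \sum_i a' i x * b' i (1%g : G).
have rdn : reg U dn by exact: rho.
have oN := opn_neq0 laG oU rdn; set N := [set _ | _] in oN.
have NU : N `<=` U by move=> x [].
pose nm x := \sum_i a i x * b i (1%g : G).
(* The quotient rule in [g] at [1], applied to the numerator and denominator found above. *)
exists N, (fun x => nm x * (- (dn x ^- 2 * \sum_i a' i x * delta (b' i))) +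
   (dn x)^-1 * \sum_i a i x * delta (b i)); split=> //.
- by split=> //; rewrite /dn -(hE' (h0, (1%g : G))).
- have ri : reg N (fun x => (dn x)^-1).
    by apply: reg_inv => //; [exact: (reg_sub aG oU oN NU)|move=> x []].
  have ri2 : reg N (fun x => dn x ^- 2).
    have := reg_exp laG 2 oN ri; congr (reg _ _); apply/funext => x.
    by rewrite exprVn.
  apply: reg_add => //; apply: reg_mul => //.
  + by apply: (reg_sub aG oU oN NU); exact: rho.
  + apply: reg_opp => //; apply: reg_mul => //.
    by apply: (reg_sub aG oU oN NU); exact: rho.
  + by apply: (reg_sub aG oU oN NU); exact: rho.
- move=> x [Ux dx] Vx; rewrite /vf /=.
  pose nx g := \sum_i a i x * b i g; pose ex g := \sum_i a' i x * b' i g.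
  have rex : reg U' ex.
    by apply: reg_sum => // i _; apply: reg_mul => //; exact: reg_cst.
  have rnx : reg U' nx.
    by apply: reg_sum => // i _; apply: reg_mul => //; exact: reg_cst.
  have oM := opn_neq0 laG oU' rex; set M0 := [set _ | _] in oM.
  pose M := M0 `&` ((fun g : fg_space G => (x * g : G)%g) @^-1` (pi @^-1` V)).
  have oM' : opn M by apply: opnI => //; exact: (lmul_morphism x oV').1.
  have M1 : M 1%g by split=> //; rewrite /preimage /= mulg1.
  have gd := gderiv_point laG oM' M1 pd.
  have MU' : M `<=` U' by move=> g [[]].
  have Sn : regat (1%g : fg_space G) nx by exists U'.
  have Se : regat (1%g : fg_space G) ex by exists U'.
  have e0 g : M g -> ex g != 0 by case=> -[].
  have Si := gd_inv gd Se e0.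
  have := D_inv gd e0 Se => /eqm0 Di.
  have Sb i : regat (1%g : fg_space G) (b i) by exists U'.
  have Sb' i : regat (1%g : fg_space G) (b' i) by exists U'.
  have dsum (q : nat) (c : 'I_q -> fg_space G -> k) (w : 'I_q -> k) :
      (forall i, regat (1%g : fg_space G) (c i)) ->
      delta (fun g => \sum_i w i * c i g) = \sum_i w i * delta (c i).
    move=> rc; have Sc i : regat (1%g : fg_space G) (fun g => w i * c i g).
      by apply: (regat_mul laG) => //; exact: (regat_cst laG).
    have [_ /eqm0 D1] := D_sum gd (index_enum 'I_q) (P := xpredT) (fun i _ => Sc i).
    rewrite [LHS]D1; apply: eq_bigr => i _; have [_ /eqm0 D2] := D_scale gd (w i) (rc i).
    by rewrite [LHS]D2.
  have [_ dD dM dE] := pd.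
  have -> : delta (fun g => f (act (pi x) g)) = delta (fun g => nx g * (ex g)^-1).
    apply: (dE M) => //.
      apply: (morphism_regat (orbit_morphism (pi x))); rewrite act1; exists V; split=> //.
    move=> g [[U'g eg] Vg]; rewrite act_pi.
    have := hF (x, g); rewrite /= => -> //; first by rewrite hE hE'.
    by split=> //; rewrite hE'.
  rewrite dM//; congr (_ * _ + _ * _).
  + rewrite [LHS]Di; congr (- _); rewrite /= -/(dn x); congr (_ * _).
    exact: dsum.
  + exact: dsum.
Qed.

End Action.

(** * Vector fields span, and detect regular functions at a point *)

Section VectorFields.
Local Open Scope classical_set_scope.
Local Open Scope ring_scope.
Variables (k : closedFieldType).
Hypothesis char0 : [pchar k] =i pred0.
Variables (X : fspace k) (G : fgroup k) (P : set G) (pi : fg_space G -> X) (n : nat).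
Hypotheses (laX : locally_affine X) (irrX : irreducible_set (setT : set X)).
Hypothesis smX : smooth_dim X n.
Hypothesis lagG : linear_algebraic_group G.
Hypothesis qpi : @quotient_map k G P X pi.
Let aX := laX.1.
Let laG : locally_affine (fg_space G). Proof. by case: lagG => /affine_locally_affine. Qed.
Let aG := laG.1.
Local Notation act := (act pi).
Local Notation vf := (vf pi).
Local Notation pd1 := (@point_deriv k (fg_space G) 1%g).

(** In characteristic zero the orbit map is a submersion at some point, hence
    everywhere by homogeneity. *)
Lemma vf_span x (y : 'I_n -> X -> k) : cotangent_basis y x -> (forall b, regat x (y b)) ->
  exists delta : 'I_n -> (fg_space G -> k) -> k, (forall a, pd1 (delta a)) /\
    (\matrix_(a, b) vf (delta a) (y b) x) \in unitmx.
Proof.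
move=> cy ry.
have surj : forall x, exists g, pi g = x by case: qpi.
have [h [V [z [delta [Vh [oV rz cz] pd dz]]]]] :=
  generic_submersion char0 laG laX irrX smX (pi_morphism qpi) (pi_open lagG qpi) (1%g : fg_space G).
have [h' hx] := surj x.
have [g acth] : exists g : G, act (pi h) g = x.
  by exists (h^-1 * h')%g; rewrite (act_pi qpi) mulVKg.
(* This map sends [h] to [1], and acting on [x] by [phi a] gives [pi a] moved by [g]; so a tangent
   vector at [h] becomes one at [1] whose field at [x] is the translate of its image under [pi]. *)
pose phi := fun a : fg_space G => ((g^-1 * h^-1) * a * g : G)%g.
have mphi : @morphism k (fg_space G) (fg_space G) phi.
  exact: (morphism_comp (lmul_morphism lagG _) (rmul_morphism lagG g)).
have phih : phi h = 1%g by rewrite /phi mulgVK mulVg.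
exists (fun a f => delta a (f \o phi)); split=> [a|].
  by have := point_deriv_push mphi (pd a); rewrite phih.
pose eps a (f : X -> k) := delta a ((f \o act^~ g) \o pi).
have vfE a f : vf (fun f => delta a (f \o phi)) f x = eps a f.
  rewrite /vf /eps; congr (delta a _); apply/funext => b /=; congr f.
  by rewrite -acth (actM qpi) !(act_pi qpi) /phi !mulgA mulgK mulgV mul1g.
have pde a : point_deriv x (eps a).
  have := point_deriv_push (act_morphism lagG qpi g) (point_deriv_push (pi_morphism qpi) (pd a)).
  by rewrite acth.
(* The coordinates [z] are moved from [pi h] to [x]; the chain rule and [dz] then exhibit [J] as an
   inverse. *)
pose J : 'M[k]_n := \matrix_(b, c) gradient y x (z c \o act^~ (g^-1)%g) 0 b.
suff e : (\matrix_(a, b) vf (fun f => delta a (f \o phi)) (y b) x) *m J = 1%:M.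
  by have [] := mulmx1_unit e.
apply/matrixP => a c; rewrite !mxE -dz.
have rzc : regat x (z c \o act^~ (g^-1)%g).
  apply: (morphism_regat (act_morphism lagG qpi _)); rewrite -acth (actM qpi) mulgV (act1 qpi).
  by exists V.
have := point_deriv_chain laX cy ry rzc (pde a).
rewrite /eps [LHS](_ : _ = delta a (z c \o pi)); last first.
  congr (delta a _); apply/funext => b /=.
  by rewrite (actM qpi) mulgV (act1 qpi).
by move=> ->; apply: eq_bigr => b _; rewrite !mxE vfE mulrC.
Qed.

(** The head of the list acts first, so induction on the list peels off the innermost derivative. *)
Definition vfs (ds : seq ((fg_space G -> k) -> k)) (f : X -> k) : X -> k :=
  foldl (fun f delta => vf delta f) f ds.

Definition pds (ds : seq ((fg_space G -> k) -> k)) := forall delta, List.In delta ds -> pd1 delta.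

Lemma vfs_reg ds V f : pds ds -> opn V -> reg V f -> reg V (vfs ds f).
Proof.
elim: ds f => [|delta ds IH] f pd oV rf //=; apply: IH => //.
  by move=> d dd; apply: pd; right.
by apply: (vf_reg lagG qpi) => //; apply: pd; left.
Qed.

Lemma vf_loc delta V f g : pd1 delta -> opn V -> reg V f -> (forall x, V x -> f x = g x) ->
  forall x, V x -> vf delta f x = vf delta g x.
Proof.
move=> pd oV rf fg x Vx; have [_ _ _ dE] := vf_point lagG qpi x pd.
by apply: (dE V) => //; exists V.
Qed.

Lemma vfs_loc ds V f g : pds ds -> opn V -> reg V f -> (forall x, V x -> f x = g x) ->
  forall x, V x -> vfs ds f x = vfs ds g x.
Proof.
elim: ds f g => [|delta ds IH] f g pd oV rf fg; first exact: fg.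
have pdd : pd1 delta by apply: pd; left.
apply: IH => //; first by move=> d dd; apply: pd; right.
  exact: (vf_reg lagG qpi).
exact: vf_loc.
Qed.

Lemma vfs_add ds V f g : pds ds -> opn V -> reg V f -> reg V g ->
  forall x, V x -> vfs ds (fun z => f z + g z) x = vfs ds f x + vfs ds g x.
Proof.
elim: ds f g => [|delta ds IH] f g pd oV rf rg x Vx //=.
have pdd : pd1 delta by apply: pd; left.
have pds' : pds ds by move=> d dd; apply: pd; right.
have rvf f' : reg V f' -> reg V (vf delta f') by exact: (vf_reg lagG qpi).
rewrite -IH//; try exact: rvf.
apply: (vfs_loc pds' oV) => //; first by apply: rvf; exact: reg_add.
move=> z Vz; have [_ dD _ _] := vf_point lagG qpi z pdd.
by apply: dD; exists V.
Qed.

(** In the iterated Leibniz expansion every term that differentiates [a] applies fewer than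
    [size ds] fields to [f], and so vanishes at [x]. Hence the leading derivative transforms like
    [f] itself. *)
Lemma vfs_mul ds V a f x : pds ds -> opn V -> V x -> reg V a -> reg V f ->
  (forall ds', (size ds' < size ds)%N -> pds ds' -> vfs ds' f x = 0) ->
  vfs ds (fun z => a z * f z) x = a x * vfs ds f x.
Proof.
elim: ds a f => [|delta ds IH] a f pd oV Vx ra rf low //=.
have pdd : pd1 delta by apply: pd; left.
have pds' : pds ds by move=> d dd; apply: pd; right.
have rvf f' : reg V f' -> reg V (vf delta f') by exact: (vf_reg lagG qpi).
have rva := rvf _ ra; have rvff := rvf _ rf.
have raf := reg_mul laX oV ra rvff; have rfa := reg_mul laX oV rva rf.
rewrite (vfs_loc (g := fun z => a z * vf delta f z + vf delta a z * f z) pds' oV)//.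
- rewrite (vfs_add pds' oV)// IH//; last first.
    move=> ds' s' pd'; apply: (low (delta :: ds')) => // d /= [<-//|]; exact: pd'.
  rewrite IH//; last by move=> ds' s' pd'; apply: low => //; exact: leqW.
  by rewrite (low ds) ?mulr0 ?addr0.
- by apply: rvf; exact: reg_mul.
- move=> z Vz; have [_ _ dM _] := vf_point lagG qpi z pdd.
  rewrite {1}/(vf) -/(vf delta _ z) [LHS](dM a f); try by exists V.
  by congr (_ + _); rewrite mulrC.
Qed.

(** Germs with zero Taylor expansion along the group. They form an ideal stable under the vector
    fields, and [taylor] shows that it is zero. *)
Definition flat_at (x0 : X) : set (X -> k) :=
  [set f | regat x0 f /\ forall ds, pds ds -> vfs ds f x0 = 0].

Lemma flat_loc x0 V f g : opn V -> V x0 -> (forall x, V x -> f x = g x) ->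
  flat_at x0 f -> flat_at x0 g.
Proof.
move=> oV Vx0 fg [[U [oU Ux0 rf]] hf].
have oUV : opn (U `&` V) by exact: opnI.
have rf' : reg (U `&` V) f by exact: (reg_sub aX oU oUV (@subIsetl _ _ _)).
split.
  exists (U `&` V); split=> //; apply: (reg_res aX oUV oUV _ rf') => // x [_ Vx].
  by rewrite fg.
move=> ds pd; rewrite -(hf ds pd); apply/esym.
by apply: (vfs_loc pd oUV rf') => // x [_ /fg].
Qed.

Lemma flat_vf x0 delta f : pd1 delta -> flat_at x0 f -> flat_at x0 (vf delta f).
Proof.
move=> pd [[U [oU Ux0 rf]] hf]; split.
  by exists U; split=> //; exact: (vf_reg lagG qpi).
move=> ds pds'; apply: (hf (delta :: ds)) => d /= [<-//|]; exact: pds'.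
Qed.

Lemma flat_add x0 f g : flat_at x0 f -> flat_at x0 g -> flat_at x0 (fun x => f x + g x).
Proof.
move=> [[U [oU Ux0 rf]] hf] [[V [oV Vx0 rg]] hg].
have oUV : opn (U `&` V) by exact: opnI.
have rf' : reg (U `&` V) f by exact: (reg_sub aX oU oUV (@subIsetl _ _ _)).
have rg' : reg (U `&` V) g by exact: (reg_sub aX oV oUV (@subIsetr _ _ _)).
split; first by exists (U `&` V); split=> //; exact: reg_add.
by move=> ds pd; rewrite (vfs_add pd oUV)// hf// hg// addr0.
Qed.

Lemma flat_mul x0 a f : regat x0 a -> flat_at x0 f -> flat_at x0 (fun x => a x * f x).
Proof.
move=> [U [oU Ux0 ra]] [[V [oV Vx0 rf]] hf].
have oUV : opn (U `&` V) by exact: opnI.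
have ra' : reg (U `&` V) a by exact: (reg_sub aX oU oUV (@subIsetl _ _ _)).
have rf' : reg (U `&` V) f by exact: (reg_sub aX oV oUV (@subIsetr _ _ _)).
split; first by exists (U `&` V); split=> //; exact: reg_mul.
move=> ds pd; rewrite (vfs_mul pd oUV)//; first by rewrite hf// mulr0.
by move=> ds' _; exact: hf.
Qed.

Lemma flat_sum x0 I (r : seq I) (F : I -> X -> k) : (forall i, flat_at x0 (F i)) ->
  flat_at x0 (fun x => \sum_(i <- r) F i x).
Proof.
move=> hF; elim: r => [|i r IH].
  have -> : (fun x => \sum_(i <- [::]) F i x) = (fun x => 0).
    by apply/funext => x; rewrite big_nil.
  split; first exact: (regat_cst laX).
  elim=> [|delta ds IH] pd //=.
  rewrite (vfs_loc (g := fun=> 0) _ (opnT aX)) ?IH//.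
  - by move=> d dd; apply: pd; right.
  - by move=> d dd; apply: pd; right.
  - apply: (vf_reg lagG qpi); [by apply: pd; left|exact: opnT|].
    by apply: reg_cst => //; exact: opnT.
  - by move=> x _; have [|dc _ _ _] := vf_point lagG qpi (delta := delta) x; [apply: pd; left|exact: dc].
have -> : (fun x => \sum_(j <- i :: r) F j x) = (fun x => F i x + \sum_(j <- r) F j x).
  by apply/funext => x; rewrite big_cons.
exact: flat_add.
Qed.

(** The matrix of the fields of [vf_span] stays invertible near [x0], so the coordinate derivatives
    are regular combinations of vector fields there, and flatness passes to them. *)
Lemma flat_partial x0 V (y : 'I_n -> X -> k) f b : V x0 -> local_coordinates V y ->
  flat_at x0 f -> flat_at x0 (fun x => gradient y x f 0 b).
Proof.
move=> Vx0 [oV ry cy] ff; have [[U [oU Ux0 rf]] _] := ff.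
have ryx x a : V x -> regat x (y a) by move=> Vx; exists V.
have [delta [pd uM]] := vf_span (cy _ Vx0) (fun a => ryx _ a Vx0).
pose M x : 'M[k]_n := \matrix_(a, b) vf (delta a) (y b) x.
have rM : mxreg V M.
  move=> a c; have := vf_reg lagG qpi (pd a) oV (ry c).
  by congr (reg _ _); apply/funext => x; rewrite mxE.
have oN := opn_neq0 laX oV (reg_det laX oV rM); set N := [set _ | _] in oN.
have Nx0 : N x0 by split=> //; rewrite unitmxE unitfE in uM.
have NV : N `<=` V by move=> x [].
have rI : mxreg N (fun x => invmx (M x)).
  apply: mxreg_inv => //; last by move=> x [].
  by move=> a c; exact: (reg_sub aX oV oN NV).
have oNU : opn (N `&` U) by exact: opnI.
apply: (@flat_loc _ (N `&` U) (fun x => \sum_a invmx (M x) b a * vf (delta a) f x)) => //.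
  move=> x [Nx Ux]; have [Vx dM] := Nx.
  have uMx : M x \in unitmx by rewrite unitmxE unitfE.
  have e : \col_a vf (delta a) f x = M x *m (gradient y x f)^T.
    apply/colP => a; rewrite !mxE.
    rewrite (point_deriv_chain laX (cy _ Vx) _ _ (vf_point lagG qpi x (pd a))).
    - by apply: eq_bigr => c _; rewrite !mxE mulrC.
    - by move=> c; exact: ryx.
    - by exists U.
  have := congr1 (mulmx (invmx (M x))) e; rewrite mulKmx// => /colP /(_ b).
  by rewrite !mxE => <-; apply: eq_bigr => a _; rewrite !mxE.
apply: (@flat_sum x0 _ _ (fun a x => invmx (M x) b a * vf (delta a) f x)) => a.
by apply: flat_mul; [exists N|exact: flat_vf].
Qed.

(** Partial derivatives of a flat polynomial are flat of smaller degree, hence zero by induction.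
    The polynomial is then constant, and the empty list of fields shows that the constant is 0. *)
Lemma flat_peval x0 V (y : 'I_n -> X -> k) (p : mpoly n k) : V x0 -> local_coordinates V y ->
  flat_at x0 (fun x => peval p (\row_a y a x)) -> p = 0.
Proof.
move=> Vx0 lcy; have [oV ry cy] := lcy.
have [m] := ubnP (msize p); elim: m p => // m IH p; rewrite ltnS => sp fp.
have dp b : mderiv b p = 0.
  have [p0|p0] := eqVneq p 0; first by rewrite p0 mderiv0.
  have [//|dn0] := eqVneq (mderiv b p) 0.
  apply: IH.
    apply: leq_trans sp; rewrite -mlead_deg//.
    have := mlead_supp dn0; rewrite mcoeff_msupp mcoeff_mderiv => h.
    have : mnm_add (mlead (mderiv b p)) (mnm1 b) \in msupp p.
      by rewrite mcoeff_msupp; apply: contraNneq h => ->; rewrite mul0rn.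
    by move/msize_mdeg_lt; rewrite mdegD mdeg1 addn1.
  apply: (flat_loc oV Vx0 _ (flat_partial b Vx0 lcy fp)) => x Vx.
  have gd := gderiv_pt laX oV Vx.
  have ryr i : regat x (fun z => (\row_a y a z : 'rV[k]_n) 0 i).
    by exists V; split=> //; have := ry i; congr (reg _ _); apply/funext => z; rewrite mxE.
  have [rp Dp] := D_peval gd ryr p.
  rewrite (@gradient_uniq _ _ _ y x _ (\row_i peval (mderiv i p) (\row_a y a x))) ?mxE//.
    exact: cy.
  apply/is_gradientE.
  rewrite [X in eqm _ _ X](_ : _ = \sum_i peval (mderiv i p) (\row_a y a x) *:
    ((fun z => (\row_a y a z : 'rV[k]_n) 0 i - (\row_a y a x : 'rV[k]_n) 0 i) : X -> k^o)).
    exact: Dp.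
  apply: eq_bigr => i _; rewrite mxE; congr (_ *: _).
  by apply/funext => z; rewrite !mxE.
(* Each nonconstant coefficient occurs in some partial derivative multiplied by a positive integer,
   which is nonzero in characteristic zero. *)
have pC : p = mpolyC n (mcoeff mnm0 p).
  apply/mpolyP => mm; rewrite mcoeffC; have [->|mm0] := eqVneq mm mnm0.
    by rewrite mulr1.
  rewrite mulr0.
  have [i mi] : exists i, mm i != 0%N.
    apply/existsP; apply: contraNT mm0 => /existsPn h; apply/eqP/mnmP => i.
    by rewrite mnm0E; apply/eqP; rewrite -[_ == _]negbK h.
  have mmE : mm = mnm_add (mnm_sub mm (mnm1 i)) (mnm1 i).
    apply/mnmP => j; rewrite mnmDE mnmBE mnm1E subnK//.
    by case: eqP => [<-|//]; rewrite lt0n.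
  have := congr1 (mcoeff (mnm_sub mm (mnm1 i))) (dp i); rewrite mcoeff_mderiv mcoeff0 -mmE.
  by move/eqP; rewrite -mulr_natr mulf_eq0 (pcharf0P k).1// orbF => /eqP.
have [_ /(_ [::])] := fp; rewrite /= pC peval_cst => -> //.
Qed.

(** By [algebraic_over_coordinates] a nonzero flat function would give a nonzero
    flat polynomial in the coordinates. *)
Lemma taylor x0 V f : opn V -> V x0 -> reg V f ->
  (forall ds, pds ds -> vfs ds f x0 = 0) -> forall x, V x -> f x = 0.
Proof.
move=> oV Vx0 rf hf x1 Vx1; apply/eqP/negPn/negP => fx1.
have ff : flat_at x0 f by split=> //; exists V.
have [W [y [Wx0 lcy]]] := smooth_local_coordinates laX smX x0; have [oW ry cy] := lcy.
have [m [p [p0 hp]]] := algebraic_over_coordinates char0 laX irrX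
  (cotangent_basis_spans (cy _ Wx0)) oW Wx0 ry oV Vx0 rf (ex_intro _ x1 (conj Vx1 fx1)).
have oWV : opn (W `&` V) by exact: opnI.
case/eqP: p0; apply: (flat_peval Wx0 lcy).
have ryr a : reg (W `&` V) (fun z => (\row_a y a z : 'rV[k]_n) 0 a).
  have := reg_sub aX oW oWV (@subIsetl _ _ _) (ry a).
  by congr (reg _ _); apply/funext => z; rewrite mxE.
have rf' : reg (W `&` V) f by exact: (reg_sub aX oV oWV (@subIsetr _ _ _)).
(* Solving the algebraic relation for its constant term gives [P_0(y) = q f], which is flat because
   [f] is; yet [P_0] is a nonzero polynomial. *)
pose q z := - \sum_(i < m) peval (p (lift ord0 i)) (\row_a y a z) * f z ^+ i.
apply: (@flat_loc x0 (W `&` V) (fun z => q z * f z)) => //.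
  move=> z [Wz Vz]; have := hp z Wz Vz; rewrite big_ord_recl expr0 mulr1 => /eqP.
  rewrite addr_eq0 => /eqP ->; rewrite /q mulNr mulr_suml; congr (- _).
  by apply: eq_bigr => i _; rewrite -mulrA -exprSr lift0.
apply: flat_mul => //; exists (W `&` V); split=> //.
apply: reg_opp => //; apply: reg_sum => // i _; apply: reg_mul => //.
  exact: reg_peval.
exact: reg_exp.
Qed.

End VectorFields.

(** * Line bundles *)

Section Products.
Local Open Scope classical_set_scope.
Local Open Scope ring_scope.
Variable k : closedFieldType.

Lemma fprod_map (X Y T : fspace k) (phi : X -> Y) (W : set (Defs.fprod Y T)) :
  morphism phi ->
  (opn W -> @opn k (Defs.fprod X T) [set z | W (phi z.1, z.2)]) /\
  forall f, reg W f -> @reg k (Defs.fprod X T) [set z | W (phi z.1, z.2)]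
    (fun z => f (phi z.1, z.2)).
Proof.
move=> mphi.
have H (U : set Y) (V : set T) (h : Y * T -> k) : opn U -> opn V ->
   (exists (m : nat) (f : 'I_m -> Y -> k) (g : 'I_m -> T -> k),
          [/\ (forall i, reg U (f i)), (forall i, reg V (g i)) &
              forall z, h z = \sum_(i < m) f i z.1 * g i z.2]) ->
   [/\ opn (phi @^-1` U), opn V &
   exists (m : nat) (f : 'I_m -> X -> k) (g : 'I_m -> T -> k),
          [/\ (forall i, reg (phi @^-1` U) (f i)), (forall i, reg V (g i)) &
              forall z, h (phi z.1, z.2) = \sum_(i < m) f i z.1 * g i z.2]].
  move=> oU oV [m [f [g [rf rg hE]]]]; have [oU' rU'] := mphi _ oU; split=> //.
  by exists m, (fun i => f i \o phi), g; split=> // i; exact: rU'.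
split.
  move=> oW /= [x t] Wx; have [U [V [h [[oU oV hE] [Ux Vt hx] hW]]]] := oW (phi x, t) Wx.
  exists (phi @^-1` U), V, (fun z => h (phi z.1, z.2)); split=> //; first exact: H.
  by move=> [x' t'] [Ux' Vt' hx']; apply: hW.
move=> f rf /= [x t] Wx.
have [U [V [h' [h [[oU oV hE'] [_ _ hE] [Ux Vt hx] hW]]]]] := rf (phi x, t) Wx.
exists (phi @^-1` U), V, (fun z => h' (phi z.1, z.2)), (fun z => h (phi z.1, z.2)).
split=> //; [exact: H|exact: H|].
by move=> [x' t'] Wx' [Ux' Vt' hx']; apply: hW.
Qed.

Lemma fprod_map_morphism (X Y T : fspace k) (phi : X -> Y) : morphism phi ->
  @morphism k (Defs.fprod X T) (Defs.fprod Y T) (fun z => (phi z.1, z.2)).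
Proof.
by move=> mphi W oW; have [h1 h2] := fprod_map W mphi; split; [exact: h1|exact: h2].
Qed.

Lemma fst_morphism (X T : fspace k) : locally_affine X -> locally_affine T ->
  @morphism k (Defs.fprod X T) X (fun z => z.1).
Proof.
move=> laX laT V oV; have oT := opnT laT.1.
have r1 : reg (setT : set T) (fun=> 1) by exact: reg_cst.
have H f : reg V f -> [/\ opn V, opn (setT : set T) &
   exists (m : nat) (a : 'I_m -> X -> k) (g : 'I_m -> T -> k),
          [/\ (forall i, reg V (a i)), (forall i, reg setT (g i)) &
              forall z : X * T, f z.1 = \sum_(i < m) a i z.1 * g i z.2]].
  move=> rf; split=> //; exists 1%N, (fun=> f), (fun _ _ => 1); split=> // z.
  by rewrite big_ord1 mulr1.
have rV1 : reg V (fun=> 1) by exact: reg_cst.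
split=> [/= [x t] Vx|f rf /= [x t] Vx].
  exists V, setT, (fun=> 1); split=> //; first exact: (H _ rV1).
    by split=> //; rewrite oner_neq0.
  by move=> [x' t'] [].
exists V, setT, (fun z => f z.1), (fun=> 1); split=> //; [exact: H|exact: (H _ rV1)| |].
  by split=> //; rewrite oner_neq0.
by move=> [x' t'] _ _; rewrite divr1.
Qed.

End Products.

Section Bundles.
Local Open Scope classical_set_scope.
Local Open Scope ring_scope.
Variables (k : closedFieldType).
Implicit Types X Y Z : fspace k.

Lemma lb_fun_neq0 X (L : cocycle X) i j x : line_bundle L -> lb_dom i x -> lb_dom j x ->
  lb_fun (c := L) i j x != 0.
Proof.
case=> _ _ _ g1 gM Ux Vx; have := gM i j i x Ux Vx Ux; rewrite g1// => e.
by apply: contra_eqN e => /eqP ->; rewrite mul0r eq_sym oner_neq0.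
Qed.

Lemma pullback_line_bundle X Y (phi : X -> Y) (L : cocycle Y) : fspace_axioms Y ->
  morphism phi -> line_bundle L -> line_bundle (lb_pullback phi L).
Proof.
move=> aY mphi [lo lc lr l1 lM]; split=> /=.
- by move=> i; exact: (mphi _ (lo i)).1.
- by move=> x; exact: lc.
- move=> i j; apply: (mphi _ _).2 (lr i j).
  by apply: opnI.
- by move=> i x; exact: l1.
- by move=> i j l x; exact: lM.
Qed.

Lemma tensor_line_bundle X (L M : cocycle X) : locally_affine X ->
  line_bundle L -> line_bundle M -> line_bundle (lb_tensor L M).
Proof.
move=> laX [lo lc lr l1 lM] [mo mc mr m1 mM]; have aX := laX.1; split=> /=.
- by move=> i; exact: opnI.
- by move=> x; have [i ?] := lc x; have [j ?] := mc x; exists (i, j).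
- move=> [i i'] [j j'] /=.
  have oLL : opn (lb_dom i `&` lb_dom j) by exact: opnI.
  have oMM : opn (lb_dom i' `&` lb_dom j') by exact: opnI.
  have o : opn ((lb_dom i `&` lb_dom i') `&` (lb_dom j `&` lb_dom j')) by do !apply: opnI => //.
  apply: reg_mul => //.
    by apply: (reg_sub aX oLL o _ (lr i j)) => x [[? ?] [? ?]].
  by apply: (reg_sub aX oMM o _ (mr i' j')) => x [[? ?] [? ?]].
- by move=> [i i'] x [? ?] /=; rewrite l1// m1// mulr1.
- move=> [i i'] [j j'] [l l'] x [? ?] [? ?] [? ?] /=.
  by rewrite mulrACA lM// mM.
Qed.

(** The bundle of homomorphisms from [M] to [L], that is [L] tensored with the dual of [M]; note the
    order of the arguments. *)
Definition lb_hom X (L M : cocycle X) : cocycle X :=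
  @Cocycle k X (lb_idx L * lb_idx M)
    (fun i => lb_dom i.1 `&` lb_dom i.2)
    (fun i j x => lb_fun i.1 j.1 x * lb_fun j.2 i.2 x).

Lemma hom_line_bundle X (L M : cocycle X) : locally_affine X ->
  line_bundle L -> line_bundle M -> line_bundle (lb_hom L M).
Proof.
move=> laX [lo lc lr l1 lM] [mo mc mr m1 mM]; have aX := laX.1; split=> /=.
- by move=> i; exact: opnI.
- by move=> x; have [i ?] := lc x; have [j ?] := mc x; exists (i, j).
- move=> [i i'] [j j'] /=.
  have oLL : opn (lb_dom i `&` lb_dom j) by exact: opnI.
  have oMM : opn (lb_dom j' `&` lb_dom i') by exact: opnI.
  have o : opn ((lb_dom i `&` lb_dom i') `&` (lb_dom j `&` lb_dom j')) by do !apply: opnI => //.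
  apply: reg_mul => //.
    by apply: (reg_sub aX oLL o _ (lr i j)) => x [[? ?] [? ?]].
  by apply: (reg_sub aX oMM o _ (mr j' i')) => x [[? ?] [? ?]].
- by move=> [i i'] x [? ?] /=; rewrite l1// m1// mulr1.
- move=> [i i'] [j j'] [l l'] x [? ?] [? ?] [? ?] /=.
  by rewrite mulrACA lM// [X in _ * X]mulrC mM.
Qed.

Lemma tensor_hom_iso X (L M : cocycle X) : locally_affine X ->
  line_bundle L -> line_bundle M -> lb_iso (lb_tensor M (lb_hom L M)) L.
Proof.
move=> laX lbL lbM; have aX := laX.1.
have [lo lc lr l1 lM] := lbL; have [mo mc mr m1 mM] := lbM.
exists (fun (a : lb_idx L) (i : lb_idx M * (lb_idx L * lb_idx M)) x =>
  lb_fun a i.2.1 x * lb_fun i.2.2 i.1 x); split=> /=.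
- move=> a [j [i j']] /=.
  have oLL : opn (lb_dom a `&` lb_dom i) by exact: opnI.
  have oMM : opn (lb_dom j' `&` lb_dom j) by exact: opnI.
  have o : opn (lb_dom a `&` (lb_dom j `&` (lb_dom i `&` lb_dom j'))) by do !apply: opnI => //.
  apply: reg_mul => //.
    by apply: (reg_sub aX oLL o _ (lr a i)) => x [? [? [? ?]]].
  by apply: (reg_sub aX oMM o _ (mr j' j)) => x [? [? [? ?]]].
- move=> a [j [i j']] x /= ? [? [? ?]].
  by rewrite mulf_neq0//; apply: lb_fun_neq0.
- move=> a' a [j [i j']] [l [i2 l']] x /= ? ? [? [? ?]] [? [? ?]].
  rewrite -(lM a' a i2)// -(lM a i i2)// -(mM l' j' l)// -(mM j' j l)//.
  by ring.
Qed.

Lemma lb_iso_refl X (L : cocycle X) : line_bundle L -> lb_iso L L.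
Proof.
move=> lbL; have [lo lc lr l1 lM] := lbL; exists (fun i j => lb_fun i j); split=> //.
  by move=> *; exact: lb_fun_neq0.
by move=> j' j i i' x ? ? ? ?; rewrite lM// lM.
Qed.

(** The constant family with fibre [L], read at the same parameter twice. The base is [X] only
    because a variety with a point is at hand. *)
Lemma lb_iso_alg_equiv X (L M : cocycle X) : variety X -> line_bundle L -> lb_iso L M ->
  alg_equiv L M.
Proof.
move=> vX lbL iso; have laX := variety_locally_affine vX.
have [x0 _] : (setT : set X) !=set0 by case: vX => _ _ [].
exists X, (@lb_pullback k (Defs.fprod X X) X (fun z => z.1) L), x0, x0; split=> //.
  exact: (pullback_line_bundle laX.1 (fst_morphism laX laX) lbL).
exact: (lb_iso_refl lbL).
Qed.

Lemma pullback_iso X Y (phi : X -> Y) (L M : cocycle Y) : fspace_axioms Y -> morphism phi ->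
  (forall i, opn (lb_dom (c := L) i)) -> (forall i, opn (lb_dom (c := M) i)) ->
  lb_iso L M -> lb_iso (lb_pullback phi L) (lb_pullback phi M).
Proof.
move=> aY mphi oL oM [h [hr h0 hM]]; exists (fun j i => h j i \o phi); split=> /=.
- move=> j i; apply: (mphi _ _).2 (hr j i); exact: opnI.
- by move=> j i x; exact: h0.
- by move=> j' j i i' x; exact: hM.
Qed.

(** The connecting family is pulled back along [phi] times the identity of the base. *)
Lemma pullback_alg_equiv X Y (phi : X -> Y) (L M : cocycle Y) : locally_affine Y ->
  morphism phi -> line_bundle L -> line_bundle M -> alg_equiv L M ->
  alg_equiv (lb_pullback phi L) (lb_pullback phi M).
Proof.
move=> laY mphi lbL lbM [T [N [t0 [t1 [vT lbN iso0 iso1]]]]].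
have [lo _ _ _ _] := lbL; have [mo _ _ _ _] := lbM; have [no _ _ _ _] := lbN.
have mp := @fprod_map_morphism k X Y T phi mphi.
have os (t : T) : forall i, opn (lb_dom (c := @lb_pullback k Y (Defs.fprod Y T) (fun x => (x, t)) N) i).
  by move=> i; exact: (slice_morphism (Y := T) t laY (no i)).1.
exists T, (@lb_pullback k (Defs.fprod X T) (Defs.fprod Y T) (fun z => (phi z.1, z.2)) N), t0, t1.
split=> //; last 2 first.
- exact: (pullback_iso laY.1 mphi (os t0) lo iso0).
- exact: (pullback_iso laY.1 mphi (os t1) mo iso1).
have [_ nc nr n1 nM] := lbN; split=> /=.
- by move=> i; exact: (mp _ (no i)).1.
- by move=> x; exact: nc.
- by move=> i j; exact: (fprod_map _ mphi).2 _ (nr i j).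
- by move=> i x; exact: n1.
- by move=> i j l x; exact: nM.
Qed.

End Bundles.

(** * The relative canonical bundle *)

Section Stack.
Local Open Scope ring_scope.
Variables (k : fieldType) (d n : nat).
Implicit Types (A : 'M[k]_(d, n)) (B : 'M[k]_n).

(** The first [d] rows of [B] are overwritten by [A]. Testing the row index by [insub] keeps the
    size [n] without writing it as [d + (n - d)]. *)
Definition stack A B : 'M[k]_n :=
  \matrix_(a, b) (if insub (a : nat) : option 'I_d is Some a' then A a' b else B a b).

Lemma stack_mulr A B Q : stack (A *m Q) (B *m Q) = stack A B *m Q.
Proof.
apply/matrixP => a b; rewrite !mxE; case ea: (insub _) => [a'|].
  by rewrite mxE; apply: eq_bigr => c _; rewrite mxE ea.
by apply: eq_bigr => c _; rewrite mxE ea.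
Qed.

Lemma stack_pid B : stack (pid_mx d *m B) B = B.
Proof.
apply/matrixP => a b; rewrite !mxE; case: insubP => // a' _ ea.
rewrite mxE (bigD1 a)//= big1 ?addr0 => [|c ca].
  by rewrite !mxE ea eqxx -ea ltn_ord mul1r.
have av : ((a : nat) == c) = false by apply/negbTE; rewrite eq_sym.
by rewrite !mxE ea av mul0r.
Qed.

End Stack.

(** Multiplying the first [d] rows by [T] is left multiplication by the block diagonal matrix of [T]
    and an identity. *)
Lemma det_stack_mull (k : fieldType) (d n : nat) (T : 'M[k]_d) (A : 'M[k]_(d, n)) (B : 'M[k]_n) :
  (d <= n)%N -> (\det (stack (T *m A) B) = \det T * \det (stack A B))%R.
Proof.
move=> dn; move: A B; rewrite -(subnKC dn); move: (n - d)%N => c A B.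
have -> : stack (mulmx T A) B = mulmx (block_mx T 0 0 1%:M)%R (stack A B).
  apply/matrixP => a b; rewrite !mxE big_split_ord /=.
  case: (fintype.split_ordP a) => a' ->.
    rewrite [X in (_ + X)%R]big1 ?addr0 => [|i _]; last by rewrite block_mxEur mxE mul0r.
    case: insubP => [i _ /= ei|]; last by rewrite /= ltn_ord.
    have -> : i = a' by apply: val_inj.
    rewrite mxE; apply: eq_bigr => j _; rewrite block_mxEul mxE; congr (_ * _)%R.
    case: insubP => [j' _ /= ej|]; last by rewrite /= ltn_ord.
    by have -> : j' = j by apply: val_inj.
  rewrite [X in (X + _)%R]big1 ?add0r => [|i _]; last by rewrite block_mxEdl mxE mul0r.
  have ge i : (insub (rshift d i : nat) : option 'I_d) = None.
    by apply: insubN; rewrite /= -leqNgt leq_addr.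
  rewrite ge (bigD1 a')//= big1 ?addr0 => [|i ia]; rewrite block_mxEdr !mxE ?ge.
    by rewrite eqxx mul1r.
  by rewrite eq_sym (negPf ia) mul0r.
by rewrite det_mulmx det_ublock det1 mulr1.
Qed.

Section Canonical.
Local Open Scope classical_set_scope.
Local Open Scope ring_scope.
Variables (k : closedFieldType).
Implicit Types X Z : fspace k.

Lemma local_coordinates_regat X d U (x : 'I_d -> X -> k) p a : local_coordinates U x -> U p ->
  regat p (x a).
Proof. by case=> oU rx _ Up; exists U. Qed.

Lemma local_coordinates_basis X d U (x : 'I_d -> X -> k) p : local_coordinates U x -> U p ->
  cotangent_basis x p.
Proof. by case=> _ _ cx; exact: cx. Qed.

(** Smoothness says that the coordinate systems cover, and the cocycle identity is the chain rule
    for Jacobians. *)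
Lemma canonical_line_bundle X : locally_affine X -> smooth_dim X (krull_dim X) ->
  line_bundle (canonical_bundle X).
Proof.
move=> laX smX; have aX := laX.1; split=> /=.
- by move=> [c [oU rx cx]].
- move=> p; have [V [x [Vp lx]]] := smooth_local_coordinates laX smX p.
  by exists (exist _ (V, x) lx).
- move=> [[U x] /= lx] [[V y] /= ly]; have [oU _ _] := lx; have [oV ry _] := ly.
  have oUV : opn (U `&` V) by exact: opnI.
  apply: (reg_det laX oUV) => a b.
  have := gradient_reg laX b lx oV (ry a).
  by congr (reg _ _); apply/funext => p; rewrite mxE.
- move=> [[U x] /= lx] p /= Up.
  rewrite (_ : \matrix_(a, b) _ = 1%:M) ?det1//; apply/matrixP => a b.
  rewrite mxE (gradient_coord laX (local_coordinates_basis lx Up) (local_coordinates_regat a lx Up)).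
  by rewrite !mxE eqxx eq_sym.
- move=> [[U x] /= lx] [[V y] /= ly] [[W z] /= lz] p /= Up Vp Wp.
  rewrite mulrC -det_mulmx; congr (\det _); apply/matrixP => a b; rewrite !mxE.
  rewrite (gradient_chain laX (local_coordinates_basis lx Up) (local_coordinates_basis ly Vp)
    (local_coordinates_regat a lz Wp) (fun b => local_coordinates_regat b ly Vp)).
  by rewrite mxE; apply: eq_bigr => c _; rewrite !mxE.
Qed.

Lemma gradient_pullback X Z (phi : Z -> X) d n (x : 'I_d -> Z -> k) (y : 'I_n -> X -> k) z f :
  locally_affine X -> locally_affine Z -> morphism phi ->
  cotangent_basis x z -> cotangent_basis y (phi z) -> (forall b, regat (phi z) (y b)) ->
  regat (phi z) f ->
  gradient x z (f \o phi) =
  gradient y (phi z) f *m (\matrix_(c, a) gradient x z (y c \o phi) 0 a).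
Proof.
move=> laX laZ mphi cx cy ry rf.
apply: (gradient_uniq cx); first exact: (morphism_regat mphi).
apply: (@is_gradient_trans _ _ laZ _ _ _ (fun c => y c \o phi)).
  have [U [m [a [b [oU Up ra rb h]]]]] := gradientP cy rf.
  exists (phi @^-1` U), m, (fun l => a l \o phi), (fun l => b l \o phi); split=> //.
  - exact: (mphi _ oU).1.
  - by move=> l; have [r1 r2] := ra l; split=> //; exact: (mphi _ oU).2.
  - by move=> l; have [r1 r2] := rb l; split=> //; exact: (mphi _ oU).2.
  - by move=> w Uw; rewrite -h.
move=> c; rewrite (_ : row c _ = gradient x z (y c \o phi)); last by apply/rowP => a; rewrite !mxE.
by apply: gradientP => //; exact: (morphism_regat mphi).
Qed.

End Canonical.

(** * Pullback of effective bundles *)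

Section Relative.
Local Open Scope classical_set_scope.
Local Open Scope ring_scope.
Variables (k : closedFieldType).
Hypothesis char0 : [pchar k] =i pred0.
Variables (X : fspace k) (G : fgroup k) (P : set G) (pi : fg_space G -> X).
Hypotheses (laX : locally_affine X) (irrX : irreducible_set (setT : set X)).
Hypothesis lagG : linear_algebraic_group G.
Hypothesis qpi : @quotient_map k G P X pi.
Variables (Z : fspace k) (phi : Z -> X).
Hypotheses (laZ : locally_affine Z) (mphi : morphism phi).
Let aX := laX.1.
Let aZ := laZ.1.
(** A section of [M] may vanish on [phi(Z)]; its first nonzero iterated derivative
    along vector fields of [G] still transforms like a section of [M] on [phi(Z)]. *)
Lemma pullback_effective n (M : cocycle X) : smooth_dim X n -> (setT : set Z) !=set0 ->
  effective_bundle M -> effective_bundle (lb_pullback phi M).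
Proof.
move=> smX [z0 _] [lbM [s [[sr sM] [i1 [x1 [Ux1 sx1]]]]]].
split; first exact: (pullback_line_bundle aX mphi).
have [mo mc mr m1 mM] := lbM.
(* The minimum is taken over all points of [Z] and all trivializations at once, so that one list
   [ds] serves globally. *)
pose Q m := `[< exists ds i z, [/\ pds ds, size ds = m, lb_dom (c := M) i (phi z) &
  vfs pi ds (s i) (phi z) != 0] >].
have exQ : exists m, Q m.
  have [i Ui] := mc (phi z0).
  suff [ds [pd h]] : exists ds, pds ds /\ vfs pi ds (s i) (phi z0) != 0.
    by exists (size ds); apply/asboolP; exists ds, i, z0.
  apply: contrapT => /forallNP h.
  (* If all derivatives vanish at [phi z0], then [taylor] makes the section zero on an open set,
     which by irreducibility meets the locus where it is nonzero. *)
  have h0 : forall ds, pds ds -> vfs pi ds (s i) (phi z0) = 0.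
    by move=> ds pd; apply/eqP/negPn/negP => e; apply: (h ds).
  have s0 := taylor char0 laX irrX smX lagG qpi (mo i) Ui (sr i) h0.
  have oN := opn_neq0 laX (mo i1) (sr i1).
  have [x [[Ux sx] Uix]] := irr_meet irrX oN (mo i) (ex_intro _ x1 (conj Ux1 sx1)) (ex_intro _ _ Ui).
  by move/eqP: sx; apply; rewrite (sM i1 i)// s0// mulr0.
case: (ex_minnP exQ) => m /asboolP[ds [i2 [z2 [pd sds Ui2 nz]]]] minm.
exists (fun i => vfs pi ds (s i) \o phi); split; last by exists i2, z2.
split=> /= [i|i j z Ui Uj].
  apply: (mphi (mo i)).2; exact: (vfs_reg lagG qpi pd (mo i) (sr i)).
have oij : opn (lb_dom (c := M) i `&` lb_dom j) by exact: opnI.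
rewrite (vfs_loc lagG qpi (g := fun x => lb_fun i j x * s j x) pd oij)//.
- rewrite (vfs_mul laX lagG qpi pd oij)//.
    exact: (reg_sub aX (mo j) oij (@subIsetr _ _ _)).
  (* A nonzero shorter derivative at [phi z] would contradict the minimality of [m]; this is the
     hypothesis of [vfs_mul]. *)
  move=> ds' s' pd'; apply/eqP/negPn/negP => e.
  have := minm (size ds'); rewrite leqNgt -sds s' => /(_ _)/negP; apply => //.
  by apply/asboolP; exists ds', j, z.
- exact: (reg_sub aX (mo i) oij (@subIsetl _ _ _)).
- by move=> x [Uix Ujx]; exact: sM.
Qed.

End Relative.

(** * A nonzero section of the relative canonical bundle *)

Section RelativeCanonical.
Local Open Scope classical_set_scope.
Local Open Scope ring_scope.
Variables (k : closedFieldType).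
Hypothesis char0 : [pchar k] =i pred0.
Variables (X : fspace k) (G : fgroup k) (P : set G) (pi : fg_space G -> X).
Hypotheses (laX : locally_affine X) (irrX : irreducible_set (setT : set X)).
Hypothesis lagG : linear_algebraic_group G.
Hypothesis qpi : @quotient_map k G P X pi.
Variables (Z : fspace k) (phi : Z -> X).
Hypotheses (laZ : locally_affine Z) (mphi : morphism phi).
Hypotheses (smX : smooth_dim X (krull_dim X)) (smZ : smooth_dim Z (krull_dim Z)).
Let aX := laX.1.
Let aZ := laZ.1.
Local Notation vf := (vf pi).
Local Notation pd1 := (@point_deriv k (fg_space G) 1%g).
Local Notation n := (krull_dim X).
Local Notation d := (krull_dim Z).

Lemma point_deriv_lin (Y : fspace k) (p : Y) m (w : 'I_m -> k) (eta : 'I_m -> (Y -> k) -> k) :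
  (forall i, point_deriv p (eta i)) -> point_deriv p (fun f => \sum_i w i * eta i f).
Proof.
move=> pd; split.
- by move=> c; apply: big1 => i _; have [-> _ _ _] := pd i; rewrite mulr0.
- move=> f g rf rg; rewrite -big_split; apply: eq_bigr => i _ /=.
  by have [_ -> // _ _] := pd i; rewrite mulrDr.
- move=> f g rf rg; rewrite !mulr_sumr -big_split; apply: eq_bigr => i _ /=.
  by have [_ _ -> // _] := pd i; ring.
- move=> V f g oV Vp rf fg; apply: eq_bigr => i _.
  by have [_ _ _ dE] := pd i; rewrite (dE V f g).
Qed.

(** Row [a] is the image of [d/dx_a] under the differential of [phi], written in the coordinates
    [y]. *)
Definition tangent_part (x : 'I_d -> Z -> k) (y : 'I_n -> X -> k) (z : Z) : 'M[k]_(d, n) :=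
  \matrix_(a, b) gradient x z (y b \o phi) 0 a.

Definition field_part (delta : 'I_n -> (fg_space G -> k) -> k) (y : 'I_n -> X -> k) (z : Z) :
  'M[k]_n := \matrix_(a, b) vf (delta a) (y b) (phi z).

(** Contracting [dy_1 /\ ... /\ dy_n] with the last [n - d] of the vector fields
    and pulling back to [Z]. *)
Definition relative_section delta (i : {c : set Z * ('I_d -> Z -> k) | local_coordinates c.1 c.2}
    * {c : set X * ('I_n -> X -> k) | local_coordinates c.1 c.2}) (z : Z) : k :=
  \det (stack (tangent_part (sval i.1).2 (sval i.2).2 z) (field_part delta (sval i.2).2 z)).

(** Changing [x] multiplies the first [d] rows by a Jacobian [T], which is the transition of [K_Z];
    changing [y] multiplies the whole matrix on the right by a Jacobian [Q], which is the inverse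
    transition of [K_X]. *)
Lemma relative_sectionP delta : (d <= n)%N -> (forall a, pd1 (delta a)) ->
  @lb_section k Z (lb_hom (canonical_bundle Z) (lb_pullback phi (canonical_bundle X)))
    (relative_section delta).
Proof.
move=> dn pd; split.
  move=> [[[U x] /= lx] [[V y] /= ly]] /=; have [oU rx cx] := lx; have [oV ry cy] := ly.
  have oV' := (mphi oV).1; have oUV : opn (U `&` phi @^-1` V) by exact: opnI.
  apply: (reg_det laZ oUV) => a b.
  have rB : reg (U `&` phi @^-1` V) (fun z => vf (delta a) (y b) (phi z)).
    apply: (reg_sub aZ oV' oUV (@subIsetr _ _ _)).
    exact: (mphi oV).2 _ (vf_reg lagG qpi (pd a) oV (ry b)).
  case ea: (insub (a : nat) : option 'I_d) => [a'|].
    have := gradient_reg laZ a' lx oV' ((mphi oV).2 _ (ry b)).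
    by congr (reg _ _); apply/funext => z; rewrite !mxE ea ?mxE.
  by move: rB; congr (reg _ _); apply/funext => z; rewrite !mxE ea ?mxE.
move=> [[[U x] /= lx] [[V y] /= ly]] [[[U' x'] /= lx'] [[V' y'] /= ly']] z /= [Uz Vz] [U'z V'z].
have cx := local_coordinates_basis lx Uz; have cx' := local_coordinates_basis lx' U'z.
have cy := local_coordinates_basis ly Vz; have cy' := local_coordinates_basis ly' V'z.
have ry b := local_coordinates_regat b ly Vz; have ry' b := local_coordinates_regat b ly' V'z.
have rx b := local_coordinates_regat b lx Uz; have rx' b := local_coordinates_regat b lx' U'z.
pose T : 'M[k]_d := \matrix_(a, b) gradient x z (x' b) 0 a.
pose Q : 'M[k]_n := \matrix_(c, b) gradient y' (phi z) (y b) 0 c.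
have eA : tangent_part x y z = T *m (tangent_part x' y' z *m Q).
  have -> : tangent_part x' y' z *m Q = tangent_part x' y z.
    apply/matrixP => a b; rewrite !mxE.
    rewrite (gradient_pullback laX laZ mphi cx' cy' ry' (ry b)) mxE.
    by apply: eq_bigr => c _; rewrite !mxE mulrC.
  apply/matrixP => a b; rewrite !mxE.
  rewrite (gradient_chain laZ cx cx' (morphism_regat mphi (ry b)) rx') mxE.
  by apply: eq_bigr => c _; rewrite !mxE mulrC.
have eB : field_part delta y z = field_part delta y' z *m Q.
  apply/matrixP => a b; rewrite !mxE.
  rewrite (point_deriv_chain laX cy' ry' (ry b) (vf_point lagG qpi (phi z) (pd a))).
  by apply: eq_bigr => c _; rewrite !mxE mulrC.
rewrite /relative_section /= eA eB det_stack_mull// stack_mulr det_mulmx.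
rewrite [in RHS]mulrAC -mulrA; congr (_ * _).
  by rewrite -det_tr; congr (\det _); apply/matrixP => a b; rewrite !mxE.
congr (_ * _).
by rewrite -det_tr; congr (\det _); apply/matrixP => a b; rewrite !mxE.
Qed.

(** The hypothesis says that every germ at [z0] comes from [X], so the differential of [phi] is
    injective there and its image can be completed to a basis by vector fields of the group. *)
Lemma relative_canonical_effective (z0 : Z) :
  (forall f, regat z0 f -> exists2 g, regat (phi z0) g &
     exists O, [/\ opn O, O z0 & forall z, O z -> f z = g (phi z)]) ->
  effective_bundle (lb_hom (canonical_bundle Z) (lb_pullback phi (canonical_bundle X))).
Proof.
move=> imm; split.
  apply: hom_line_bundle => //; first exact: canonical_line_bundle.
  by apply: (pullback_line_bundle aX mphi); exact: canonical_line_bundle.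
have [U [x [Uz lx]]] := smooth_local_coordinates laZ smZ z0.
have [V [y [Vz ly]]] := smooth_local_coordinates laX smX (phi z0).
have cx := local_coordinates_basis lx Uz; have cy := local_coordinates_basis ly Vz.
have rx b := local_coordinates_regat b lx Uz; have ry b := local_coordinates_regat b ly Vz.
pose A := tangent_part x y z0.
have /choice[g hg] : forall a, exists g, regat (phi z0) g /\
    exists O, [/\ opn O, O z0 & forall z, O z -> x a z = g (phi z)].
  by move=> a; have [g rg hO] := imm _ (rx a); exists g.
(* Extending the coordinates [x] to germs [g] on [X] gives a right inverse of [A], whence its rank
   is [d]. *)
pose H : 'M[k]_(n, d) := \matrix_(b, a) gradient y (phi z0) (g a) 0 b.
have AH : A *m H = 1%:M.
  apply/matrixP => a b; have [rg [W [oW Wz0 xg]]] := hg b.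
  have := gradient_pullback laX laZ mphi cx cy ry rg => /rowP /(_ a).
  have xg' z : W z -> (g b \o phi) z = x b z by move=> Wz; rewrite xg.
  have rgp := morphism_regat mphi rg.
  rewrite -(gradient_eq laZ cx rgp oW Wz0 xg') (gradient_coord laZ cx (rx b)) !mxE eqxx /= => ->.
  by apply: eq_bigr => c _; rewrite !mxE mulrC.
have rA : \rank A = d.
  apply/eqP; rewrite eqn_leq rank_leq_row /=.
  by rewrite -[X in (X <= _)%N](@mxrank1 k) -AH mxrankM_maxl.
have dn : (d <= n)%N by rewrite -rA rank_leq_col.
have [eta [pdeta uN]] := vf_span char0 laX irrX smX lagG qpi cy ry.
pose N : 'M[k]_n := \matrix_(a, b) vf (eta a) (y b) (phi z0).
(* The rows of [R] beyond the rank complete the row space of [A]. The matrix [C] gives constant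
   combinations of the spanning fields [eta] whose values at [phi z0] are the rows of [R]. *)
pose R := row_ebase A; pose C := R *m invmx N.
pose delta a f := \sum_c C a c * eta c f.
have pd a : pd1 (delta a) by exact: point_deriv_lin.
exists (relative_section delta); split; first exact: relative_sectionP.
exists (exist _ (U, x) lx, exist _ (V, y) ly), z0; split=> //.
rewrite /relative_section /= -/A.
have -> : field_part delta y z0 = R.
  transitivity (C *m N); last by rewrite mulmxKV.
  by apply/matrixP => a b; rewrite !mxE; apply: eq_bigr => c _; rewrite !mxE.
(* By the rank decomposition, the stacked determinant is the product of those of [col_ebase A] and
   [R], both invertible. *)
have -> : A = col_ebase A *m (pid_mx d *m R) by have := mulmx_ebase A; rewrite rA mulmxA.
rewrite det_stack_mull// stack_pid mulf_neq0//.
  by have := col_ebase_unit A; rewrite unitmxE unitfE.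
by have := row_ebase_unit A; rewrite unitmxE unitfE.
Qed.

End RelativeCanonical.

(** * Comparison of Neron-Severi classes *)

Section Immersion.
Local Open Scope classical_set_scope.
Local Open Scope ring_scope.
Variables (k : closedFieldType).

Lemma sval_morphism (X : fspace k) (Y : set X) : @morphism k (fsub Y) X (fun y => sval y).
Proof.
move=> V oV; split; first by exists V.
by move=> f rf w Vw; exists V, f.
Qed.

(** Where [beta] is an isomorphism onto an open subset of [Y], a germ is transported to that subset
    and then extended twice, to [Y] and to [X], by the definition of the induced structure in
    [fsub]. *)
Lemma birational_immersion (X Z : fspace k) (Y : set X) (beta : Z -> fsub Y) :
  fspace_axioms Z -> morphism beta -> birational beta ->
  exists z0 : Z, forall f, regat z0 f ->
    exists2 g, regat (sval (beta z0)) g &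
     exists W, [/\ opn W, W z0 & forall z, W z -> f z = g (sval (beta z))].
Proof.
move=> aZ mbeta [U [V [oU [u Uu] oV [gamma [[mg [psi [mpsi K1 K2]]] hg]]]]].
exists u => f [W [oW Wu rf]].
have mf := mpsi _ ((sval_morphism U oW).1).
have rpsi := mf.2 _ ((sval_morphism U oW).2 _ rf).
pose w0 : fsub U := exist _ u Uu.
have Ww0 : (psi @^-1` ((fun w : fsub U => sval w) @^-1` W)) (gamma w0).
  by rewrite /preimage /= K1.
have [U1 [g1 [oU1 U1u rg1 e1]]] := rpsi _ Ww0; rewrite hg /= in U1u.
have [U2 [g2 [oU2 U2u rg2 e2]]] := rg1 _ U1u.
exists g2; first by exists U2.
exists (U `&` W `&` (beta @^-1` U1) `&` (beta @^-1` ((fun y => sval y) @^-1` U2))); split.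
- apply: opnI => //; last exact: (mbeta _ (sval_morphism Y oU2).1).1.
  apply: opnI => //; last exact: (mbeta _ oU1).1.
  exact: opnI.
- by do !split.
- move=> z [[[Uz Wz] U1z] U2z].
  pose w : fsub U := exist _ z Uz.
  have := e1 (gamma w); rewrite /preimage /= K1 hg /= => -> //.
  exact: e2.
Qed.

End Immersion.

Section NeronSeveri.
Local Open Scope classical_set_scope.
Local Open Scope ring_scope.
Variables (R : realType) (k : closedFieldType).
Implicit Types X Z : fspace k.

(** The relation [ns_eq] moves only line bundles; hence [canonical_bundle X] is a
    line bundle as soon as some class involving it is pseudo-effective. *)
Lemma ns_eq_line_bundles X (D E : seq (R * cocycle X)) : locally_affine X -> ns_eq D E ->
  count (fun p => `[< ~ line_bundle p.2 >]) D = count (fun p => `[< ~ line_bundle p.2 >]) E.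
Proof.
move=> laX; have lbF (L : cocycle X) : line_bundle L -> `[< ~ line_bundle L >] = false.
  by move=> h; apply/asboolP => -[].
elim=> //=.
- by move=> D' E' F _ -> _ ->.
- by move=> D1 D2 E1 E2 _ e1 _ e2; rewrite !count_cat e1 e2.
- by move=> D1 E1; rewrite !count_cat addnC.
- by move=> L /lbF ->.
- by move=> r s L /lbF ->.
- by move=> r L M lL lM; rewrite !lbF//; exact: tensor_line_bundle.
- by move=> r L M /lbF -> /lbF ->.
Qed.

Definition ns_pullback X Z (phi : Z -> X) (D : seq (R * cocycle X)) : seq (R * cocycle Z) :=
  [seq (p.1, lb_pullback phi p.2) | p <- D].

Lemma ns_eq_pullback X Z (phi : Z -> X) D E : locally_affine X -> locally_affine Z ->
  morphism phi -> ns_eq D E -> ns_eq (ns_pullback phi D) (ns_pullback phi E).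
Proof.
move=> laX laZ mphi; have lbp (L : cocycle X) := @pullback_line_bundle k Z X phi L laX.1 mphi.
elim=> /=.
- by move=> D'; exact: ns_refl.
- by move=> D' E' _; exact: ns_sym.
- by move=> D' E' F _ h1 _ h2; exact: ns_trans h1 h2.
- by move=> D1 D2 E1 E2 _ h1 _ h2; rewrite /ns_pullback !map_cat; exact: ns_cat.
- by move=> D1 E1; rewrite /ns_pullback !map_cat; exact: ns_catC.
- by move=> L /lbp h; exact: ns_zero.
- by move=> r s L /lbp h; exact: ns_add.
- by move=> r L M /lbp h1 /lbp h2; exact: (ns_tensor r h1 h2).
- move=> r L M lL lM h; apply: ns_alg; [exact: lbp|exact: lbp|].
  exact: pullback_alg_equiv.
Qed.

Lemma ns_pullback_lincomb X Z (phi : Z -> X) m (c : 'rV[R]_m) (M : 'I_m -> cocycle X) :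
  ns_pullback phi (lincomb c M) = lincomb c (fun i => lb_pullback phi (M i)).
Proof. by rewrite /ns_pullback /lincomb -map_comp. Qed.

Definition rv_cons m (a : R) (c : 'rV[R]_m) : 'rV[R]_m.+1 :=
  \row_i (if unlift ord0 i is Some j then c 0 j else a).

Definition fcons (T : Type) m (a : T) (f : 'I_m -> T) (i : 'I_m.+1) : T :=
  if unlift ord0 i is Some j then f j else a.

Lemma lincomb_cons X m (a : R) (c : 'rV[R]_m) (E : cocycle X) (M : 'I_m -> cocycle X) :
  lincomb (rv_cons a c) (fcons E M) = (a, E) :: lincomb c M.
Proof.
rewrite /lincomb enum_ordSl /= /fcons mxE unlift_none; congr (_ :: _).
by rewrite -map_comp; apply: eq_map => i /=; rewrite mxE liftK.
Qed.

(** Prepending a fixed coordinate does not change distances in the sup norm. *)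
Lemma closure_rv_cons m (a : R) (A : set 'rV[R]_m) (B : set 'rV[R]_m.+1) c :
  (forall x, A x -> B (rv_cons a x)) -> closure A c -> closure B (rv_cons a c).
Proof.
move=> AB cA N /nbhs_ballP[e /= e0 eN].
have [x [Ax xe]] := cA _ (nbhsx_ballx c e e0).
exists (rv_cons a x); split; first exact: AB.
apply: eN; split=> [//|i j]; rewrite !mxE; case: (unlift ord0 j) => [j'|]; first exact: xe.2.
exact: ballxx.
Qed.

End NeronSeveri.

Theorem theorem1p1 (R : realType) (k : closedFieldType)
    (char0 : [pchar k]%R =i pred0)
    (X : fspace k) (flagX : generalized_flag_variety X)
    (L : cocycle X) (lbL : line_bundle L) (ampleL : ample L)
    (Y : set X) (subY : subvariety Y) (posY : (0 < krull_dim (fsub Y))%N)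
    (Z : fspace k) (beta : Z -> fsub Y) (resY : resolution beta) :
  (a_invariant R (lb_pullback beta (lb_restrict Y L)) <= a_invariant R L)%E.
Proof.
have [vX _ [G [P [pi [lagG _ _ _ qpi]]]]] := flagX.
have [vZ _ smZ mbeta bbeta] := resY.
have laX := variety_locally_affine vX; have laZ := variety_locally_affine vZ.
have irrX : irreducible_set (setT : set X) by case: vX.
have Z0 : ((setT : set Z) !=set0)%classic by case: vZ => _ _ [].
pose phi z := sval (beta z).
have mphi : morphism phi := morphism_comp mbeta (@sval_morphism k X Y).
(* It suffices that every [t] admissible for [X] is admissible for [Z]. *)
apply: le_ereal_inf => _ [t tX <-]; exists t => //.
rewrite (_ : lb_pullback beta (lb_restrict Y L) = lb_pullback phi L)//.
have [m [c [M [lbM eqM clM]]]] := tX.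
have lbKX : line_bundle (canonical_bundle X).
  have := ns_eq_line_bundles laX eqM; rewrite /= => e.
  (* The count of entries that are not line bundles is at least 1 on the left if [K_X] is one of
     them, and 0 on the right. *)
  apply: contrapT => nK; move: e; have /asboolP -> := nK.
  rewrite (_ : count _ (lincomb c M) = 0%N) ?addn0 ?addnS//.
  rewrite count_map (@eq_count _ _ pred0) ?count_pred0// => i /=.
  by apply/asboolP => -[].
(* The trivializations of [K_X] are indexed by coordinate systems, so their covering [X] is
   smoothness. *)
have smX : smooth_dim X (krull_dim X).
  move=> p; have [_ /(_ p)[[[U x] /= lx] Up] _ _ _] := lbKX.
  by have [oU rx cx] := lx; exists U, x; split=> //; exact: cx.
have lbKZ := canonical_line_bundle laZ smZ.
have lbpKX := pullback_line_bundle laX.1 mphi lbKX.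
have [z0 imm] := birational_immersion laZ.1 mbeta bbeta.
set E := lb_hom (canonical_bundle Z) (lb_pullback phi (canonical_bundle X)).
have effE : effective_bundle E.
  exact: (relative_canonical_effective char0 laX irrX lagG qpi laZ mphi smX smZ imm).
have lbE := effE.1.
(* The parametrizing family for [X] is pulled back, with the effective bundle [E] added in front at
   coefficient 1. *)
exists m.+1, (rv_cons 1%R c), (fcons E (fun i => lb_pullback phi (M i))); split.
- move=> i; rewrite /fcons; case: (unlift ord0 i) => [j|] //.
  exact: (pullback_line_bundle laX.1 mphi).
- rewrite lincomb_cons -ns_pullback_lincomb.
  have h1 := ns_eq_pullback laX laZ mphi eqM.
  (* [K_Z] is replaced by [phi^* K_X + E], using that the tensor product is isomorphic, hence
     algebraically equivalent, to [K_Z]. *)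
  apply: (ns_trans (E := [:: (t, lb_pullback phi L)] ++
      ([:: (1%R, lb_pullback phi (canonical_bundle X))] ++ [:: (1%R, E)]))).
    apply: (@ns_cat R k Z [:: _] [:: _] [:: _]); first exact: ns_refl.
    apply: (ns_trans (E := [:: (1%R, lb_tensor (lb_pullback phi (canonical_bundle X)) E)])).
      apply/ns_sym/ns_alg => //; first exact: tensor_line_bundle.
      apply: lb_iso_alg_equiv => //; first exact: tensor_line_bundle.
      exact: tensor_hom_iso.
    exact: ns_tensor.
  rewrite catA; apply: (ns_trans (ns_catC _ _)).
  apply: (@ns_cat R k Z [:: _] [:: _]); first exact: ns_refl.
  exact: h1.
(* The approximating coefficients for [X] are reused; the pullback of each effective class stays
   effective, and so does its sum with [E]. *)
- apply: closure_rv_cons clM => x [m' [e [N [e0 effN eqN]]]].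
  exists m'.+1, (rv_cons 1%R e), (fcons E (fun i => lb_pullback phi (N i))); split.
  + by move=> i; rewrite mxE; case: (unlift ord0 i) => [j|] //; exact: ler01.
  + move=> i; rewrite /fcons; case: (unlift ord0 i) => [j|] //.
    exact: (pullback_effective char0 laX irrX lagG qpi mphi smX Z0).
  + rewrite !lincomb_cons -!ns_pullback_lincomb.
    apply: (@ns_cat R k Z [:: _] [:: _]); first exact: ns_refl.
    exact: ns_eq_pullback.
Qed.
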